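(* Let $0\le q<1$ and $x>0$. The asymptotic expansion at $q=1$ of the q-gamma function $\Gamma_q(x)=(1-q)^{1-x}\prod_{n=0}^\infty\frac{1-q^{n+1}}{1-q^{n+x}}$ is given by $$\Gamma_q(x)=\Gamma(x)\left(\frac{\log q}{q-1}\,q^{\frac{x}{4}}\right)^{x-1}\prod_{k=3}^\infty e^{-\frac{\zeta(2-k)}{k!}B_k(x)(\log q)^{k-1}}.$$
   Context: $B_k(x)$ are the Bernoulli polynomials, defined by $\frac{te^{xt}}{e^t-1}=\sum_{n=0}^\infty\frac{B_n(x)}{n!}t^n$; $\zeta$ is the Riemann zeta function; $\Gamma$ is the gamma function. *)

(* Defs.v *)
From mathcomp Require Export all_boot all_order all_algebra.
From mathcomp Require Export all_classical all_reals all_analysis.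
From mathcomp Require Export complex.
Import Order.TTheory GRing.Theory Num.Theory.
Import numFieldNormedType.Exports.

Set Implicit Arguments.
Unset Strict Implicit.
Unset Printing Implicit Defensive.

Local Open Scope classical_set_scope.
Local Open Scope complex_scope.
Local Open Scope ring_scope.

Section Defs.
Context {R : realType}.

(* Convergence is genuine for 0 <= q < 1 and x > 0.  With [powR], 0 `^ y = 0
   for y > 0, so the value q = 0 is covered as well. *)
Definition qGamma (q x : R) : R :=
  (1 - q) `^ (1 - x) *
  lim ((fun N => \prod_(0 <= n < N)
                   ((1 - q ^+ n.+1) / (1 - q `^ (n%:R + x)))) @ \oo).

(* Euler's integral, used only for x > 0. *)
Definition Gamma (x : R) : R :=
  (\int[lebesgue_measure]_(t in `]0%R, +oo[) (t `^ (x - 1) * expR (- t)))%R.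

(* The generating function determines the coefficients, hence B, uniquely;
   its singularity at t = 0 is removable, whence the punctured
   neighbourhood. *)
Definition is_bernoulli_polynomials (B : nat -> {poly R}) : Prop :=
  forall x : R, \forall t \near 0^',
    pseries (fun n => (B n).[x] / n`!%:R) t @ \oo -->
    t * expR (x * t) / (expR t - 1).

Definition cexp (z : R[i]) : R[i] :=
  (expR (complex.Re z))%:C *
  (cos (complex.Im z) +i* sin (complex.Im z)).

Definition analytic_at (f : R[i] -> R[i]) (a : R[i]) : Prop :=
  exists c : nat -> R[i], \forall z \near (a : R[i]^o),
    (series (fun n => c n * (z - a) ^+ n) : nat -> R[i]^o) @ \oo
      --> (f z : R[i]^o).

(* The analytic continuation of the Dirichlet series to the connected set
   C \ {1}: the two clauses determine zeta there, and zeta 1 is left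
   arbitrary.  Such a zeta is real on the real axis minus 1, so taking
   [complex.Re] of its values there loses nothing. *)
Definition is_riemann_zeta (zeta : R[i] -> R[i]) : Prop :=
  (forall s : R[i], s != 1 -> analytic_at zeta s) /\
  (forall s : R[i], 1 < complex.Re s ->
    (series (fun n => cexp (- s * (ln n.+1%:R)%:C)) : nat -> R[i]^o) @ \oo
      --> (zeta s : R[i]^o)).

(* f ~ g * \prod_(k >= m) u k at F, the k-th factor being 1 + O(phi k): each
   truncation of the (in general divergent) product approximates f up to a
   relative error of the order of the first omitted factor. *)
Definition asymptotic_product (F : filter_on R)
    (phi : nat -> R -> R)
    (f g : R -> R) (m : nat) (u : nat -> R -> R) : Prop :=
  forall N, (m <= N)%N ->
    (fun q => f q / (g q * \prod_(m <= k < N) u k q) - 1 : R^o)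
      =O_F (phi N : R -> R^o).

End Defs.

(* Main.v *)
Require Import Defs.
Import Order.TTheory GRing.Theory Num.Theory.
Import numFieldNormedType.Exports.
From mathcomp Require Import ring lra zify.
Set Implicit Arguments.
Unset Strict Implicit.
Unset Printing Implicit Defensive.
Local Open Scope classical_set_scope.
Local Open Scope ring_scope.

(** Put [q = expR (- t)], so that [t] tends to [0] from the right.  With
[phi y = ln ((1 - expR (- y)) / y)] the product of the first [M] factors of the
q-gamma function is
[[
  M! / (x (x + 1) ... (x + M - 1))
    * expR (\sum_(n < M) (phi (t * (n + 1)) - phi (t * (n + x)))),
]]
by [qprodE].  The first factor is, up to the power [M ^ (1 - x)], Gauss'
product, whose limit is [Gamma x] ([gauss_cvg_pos]).

The sum is evaluated by the Euler-Maclaurin method.  The function [phi] extends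
to [0] together with all its derivatives, and those of order at least [2] are
bounded by a multiple of [1 / (1 + y) ^ 2] ([phi_decay]).  On each interval
[[t n, t (n + 1)]] the difference [phi (t (n + 1)) - phi (t (n + x))] is a
combination of the increments of the derivatives of [phi] over that interval,
with the weights [(B_k(1) - B_k(x)) / k!], up to a Taylor remainder
([em_step]).  The increments telescope, and the remainders, of size
[t ^ N / (1 + t n) ^ 2], add up to [O(t ^ (N - 1))] ([em_sum]).  At infinity
every boundary term vanishes but the one of [k = 1], which compensates
[M ^ (1 - x)] and leaves the power [t ^ (x - 1)] ([qprod_cvg]).

There remain the boundary terms at [0], that is, the Taylor coefficients of
[phi], which are Bernoulli numbers: the [(k - 1)]-th derivative of [phi] at [0]
is [B_(k-1)(0) / (k - 1)].  The term [k = 2] is the factor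
[q ^ (x (x - 1) / 4)].  For odd [k >= 3] one has [B_k(1) = 0] and
[B_(k-1)(0) / (k - 1) = - zeta (2 - k)], which gives the [k]-th factor of the
statement; for even [k >= 4] both [B_(k-1)(0)] and [zeta (2 - k)] are [0]
([em_const_zeta]).

The values [zeta (- m) = - B_(m+1)(1) / (m + 1)] have to be derived from the
analytic continuation ([zeta_neg]).  For real [s > 1], expand
[(n + 1) ^ (1 - s) = n ^ (1 - s) (1 + 1 / n) ^ (1 - s)] by the binomial series
and sum over [n >= 2]: the left-hand sides telescope against the terms of order
[0], and the other orders produce the shifted values [zeta (s + k - 1) - 1].
Truncated at order [K], this is a relation with a remainder that is holomorphic
for [Re s > 2 - K] ([zcheck_real], [holo_zrem]), so it persists along a path
that avoids the real axis between its end points ([zcheck_continued]).  At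
[s = - m] the binomial coefficients are those of Pascal's triangle and the
relation is a recurrence for [zeta (- m)] ([zeta_recurrence]); the Bernoulli
numbers satisfy the same one ([bern_rec]).

Holomorphic functions are handled as functions with an absolutely convergent
power series at each point.  The only theorem of complex analysis that this
needs is the identity theorem along a segment ([holo_identity_segment]), for
which isolation of zeros suffices; that the remainder is holomorphic follows
from the absolute convergence of a double series ([wiener_csum]). *)

(** * Calculus on the real line *)

Section Calculus.
Context {R : realType}.
Implicit Types (f g : R -> R) (x : R).

(** The rules for derivatives are put in terms of explicit abstractions, so that
the derivative of a compound expression is built by unification; this lemma
then normalizes its value. *)
Lemma is_derive_eqr f x (df df' : R) :
  is_derive x 1 f df -> df = df' -> is_derive x 1 f df'.
Proof. by move=> ? <-. Qed.

Lemma is_derive_add f g x (df dg : R) :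
  is_derive x 1 f df -> is_derive x 1 g dg ->
  is_derive x 1 (fun y => f y + g y) (df + dg).
Proof. by move=> ? ?; exact: is_deriveD. Qed.

Lemma is_derive_const (c x : R) : is_derive x 1 (fun _ : R => c) 0.
Proof. exact: is_derive_cst. Qed.

Lemma is_derive_var x : is_derive x 1 (fun y : R => y) 1.
Proof. exact: is_derive_id. Qed.

Lemma is_derive_opp f x (df : R) :
  is_derive x 1 f df -> is_derive x 1 (fun y => - f y) (- df).
Proof. by move=> ?; exact: is_deriveN. Qed.

Lemma is_derive_mul f g x (df dg : R) :
  is_derive x 1 f df -> is_derive x 1 g dg ->
  is_derive x 1 (fun y => f y * g y) (df * g x + f x * dg).
Proof.
move=> fx gx; apply: (is_derive_eqr (is_deriveM fx gx)).
by rewrite addrC; congr (_ + _); exact: mulrC.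
Qed.

Lemma is_derive_mulr f c x (df : R) :
  is_derive x 1 f df -> is_derive x 1 (fun y => f y * c) (df * c).
Proof.
move=> fx; have := is_derive_mul fx (is_derive_const c x).
by rewrite mulr0 addr0.
Qed.

Lemma is_derive_mull f c x (df : R) :
  is_derive x 1 f df -> is_derive x 1 (fun y => c * f y) (c * df).
Proof.
move=> fx; have := is_derive_mul (is_derive_const c x) fx.
by rewrite mul0r add0r.
Qed.

Lemma is_derive_comp f g x (df dg : R) :
  is_derive (g x) 1 f df -> is_derive x 1 g dg ->
  is_derive x 1 (fun y => f (g y)) (df * dg).
Proof. by move=> ? ?; exact: is_derive1_comp. Qed.

Lemma is_derive_pow n x :
  is_derive x 1 (fun y => y ^+ n) (n%:R * x ^+ n.-1).
Proof.
apply: DeriveDef; first exact: exprn_derivable.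
by rewrite exp_derive /GRing.scale /= mulr1.
Qed.

Lemma is_derive_inv x : x != 0 ->
  is_derive x 1 (fun y => y^-1) (- x ^- 2).
Proof.
move=> x0; have := @is_deriveV _ id x 1 1 x0 _.
by rewrite /GRing.scale /= mulr1; apply.
Qed.

Lemma is_derive_continuous f x (df : R) :
  is_derive x 1 f df -> {for x, continuous f}.
Proof.
by move=> [fx _]; apply: differentiable_continuous; exact/derivable1_diffP.
Qed.

Lemma is_derive_taylor_term (a c y : R) (j : nat) :
  is_derive y 1 (fun y => (y - a) ^+ j.+1 / j.+1`!%:R * c)
                ((y - a) ^+ j / j`!%:R * c).
Proof.
apply: is_derive_eqr.
  apply: is_derive_mulr; apply: is_derive_mulr.
  apply: (@is_derive_comp (fun z => z ^+ j.+1)).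
    exact: is_derive_pow.
rewrite subr0 mulr1 factS natrM /=.
have f0 : j`!%:R != 0 :> R by rewrite pnatr_eq0 -lt0n fact_gt0.
have j0 : 1 + j%:R != 0 :> R by rewrite -mulrS pnatr_eq0.
by field; apply/andP.
Qed.

Definition taylor_sum (K : nat) (a : R) (c : nat -> R) (y : R) : R :=
  \sum_(0 <= j < K) (y - a) ^+ j / j`!%:R * c j.

Lemma taylor_sum0 K (a : R) c : taylor_sum K.+1 a c a = c 0.
Proof.
rewrite /taylor_sum big_nat_recl// big1 ?addr0; last first.
  by move=> i _; rewrite subrr expr0n /= !mul0r.
by rewrite expr0 fact0 divr1 mul1r.
Qed.

Lemma is_derive_taylor_sum K (a : R) c (y : R) :
  is_derive y 1 (taylor_sum K.+1 a c) (taylor_sum K a (c \o S) y).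
Proof.
elim: K => [|K IH].
  rewrite (_ : taylor_sum 1 a c = cst (c 0)).
    by rewrite /taylor_sum big_geq//; exact: is_derive_cst.
  by apply/funext => z; rewrite /taylor_sum big_nat1 expr0 fact0 divr1 mul1r.
rewrite (_ : taylor_sum K.+2 a c = fun z =>
   taylor_sum K.+1 a c z + (z - a) ^+ K.+1 / K.+1`!%:R * c K.+1); last first.
  by apply/funext => z; rewrite /taylor_sum big_nat_recr.
rewrite [taylor_sum K.+1 a (c \o S) y]/taylor_sum big_nat_recr//=.
by apply: is_derive_add => //; exact: is_derive_taylor_term.
Qed.

(** Taylor's inequality for a sequence of successive derivatives that need only
be differentiable in the open interval.  Induction on the order: the
derivative of the remainder is the remainder of [g 1], and a function that
vanishes at [a] grows at most as a primitive of a bound of its derivative. *)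
Lemma taylor_ineq K (g : nat -> R -> R) (a b M : R) : a <= b ->
  (forall j, (j < K)%N -> {within `[a, b], continuous (g j)}) ->
  (forall j y, (j < K)%N -> y \in `]a, b[ -> is_derive y 1 (g j) (g j.+1 y)) ->
  (forall y, y \in `[a, b] -> `|g K y| <= M) ->
  `|g 0 b - taylor_sum K a (g ^~ a) b| <= M * (b - a) ^+ K / K`!%:R.
Proof.
elim: K g b => [|K IH] g b ab cg dg gM.
  rewrite /taylor_sum big_geq// subr0 expr0 fact0 divr1 mulr1.
  by apply: gM; rewrite in_itv /= ab lexx.
pose r y := g 0 y - taylor_sum K.+1 a (g ^~ a) y.
pose dr y := g 1 y - taylor_sum K a ((g ^~ a) \o S) y.
have drM y : y \in `[a, b] -> `|dr y| <= M * (y - a) ^+ K / K`!%:R.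
  rewrite in_itv /= => /andP[ay yb].
  apply: (IH (fun j => g j.+1)) => // [j jK|j z jK|z].
  - apply: continuous_subspaceW (cg j.+1 jK).
    by apply: subset_itvl; rewrite bnd_simp.
  - rewrite in_itv /= => /andP[az zy]; apply: dg => //.
    by rewrite in_itv /= az (lt_le_trans zy yb).
  - rewrite in_itv /= => /andP[az zy]; apply: gM.
    by rewrite in_itv /= az (le_trans zy yb).
have key (s : R) : `|s| = 1 -> s * r b <= M * (b - a) ^+ K.+1 / K.+1`!%:R.
  move=> s1.
  (* the derivative of D is nonnegative by the bound on dr *)
  pose D y := (y - a) ^+ K.+1 / K.+1`!%:R * M + - (s * r y).
  have dD y : y \in `]a, b[ ->
      is_derive y 1 D ((y - a) ^+ K / K`!%:R * M + - (s * dr y)).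
    move=> yab; apply: is_derive_add; first exact: is_derive_taylor_term.
    apply: is_derive_opp; apply: is_derive_eqr.
      apply: is_derive_mull; apply: is_derive_add; first exact: dg.
      by apply: is_derive_opp; exact: is_derive_taylor_sum.
    by [].
  have cT : continuous (taylor_sum K.+1 a (g ^~ a)).
    by move=> z; apply: is_derive_continuous; exact: is_derive_taylor_sum.
  have cD : {within `[a, b], continuous D}.
    have cE : continuous (fun y : R => (y - a) ^+ K.+1 / K.+1`!%:R * M).
      move=> z; apply: is_derive_continuous.
      exact: is_derive_taylor_term.
    move=> z; apply: cvgD; first exact: (continuous_subspaceT cE).
    apply: cvgN; apply: cvgM; first exact: cvg_cst.
    apply: cvgB; first exact: cg.
    exact: (continuous_subspaceT cT).
  have [c cab] := MVT_segment ab dD cD.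
  have -> : D a = 0.
    by rewrite /D /r taylor_sum0 !subrr expr0n /= !mul0r mulr0 subr0.
  rewrite subr0 => Db.
  have : 0 <= D b.
    rewrite Db mulr_ge0 ?subr_ge0//.
    rewrite (le_trans (ler_norm _))// normrM s1 mul1r.
    by rewrite (le_trans (drM _ cab))// -mulrA [M * _]mulrC.
  by rewrite subr_ge0 -[M * _ / _]mulrA [M * _]mulrC.
rewrite ler_norml; apply/andP; split.
  by have := key (-1); rewrite normrN1 mulN1r lerNl; exact.
by have := key 1; rewrite normr1 mul1r; exact.
Qed.

(** Multiplied by [1 - x], the sum telescopes. *)
Lemma geometric_sum_le (x : R) n : 0 <= x -> x < 1 ->
  \sum_(0 <= j < n) x ^+ j <= (1 - x)^-1.
Proof.
move=> x0 x1; rewrite -[leRHS]div1r ler_pdivlMr ?subr_gt0//.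
suff -> : (\sum_(0 <= j < n) x ^+ j) * (1 - x) = 1 - x ^+ n.
  by rewrite gerBl exprn_ge0.
elim: n => [|n IH]; first by rewrite big_geq// expr0 subrr mul0r.
by rewrite big_nat_recr//= mulrDl IH exprS; ring.
Qed.

Lemma bounded_series_cvg (v : nat -> R) (M : R) : (forall n, 0 <= v n) ->
  (forall n, \sum_(0 <= k < n) v k <= M) -> cvgn (series v).
Proof.
move=> v0 vM; apply: nondecreasing_is_cvgn.
  by apply/nondecreasing_seqP => n; rewrite seriesSr lerDl.
by exists M => _ [n _ <-]; exact: vM.
Qed.

(** The points [1 / (n + 2)] serve to take limits at [0] from the right, and as
lower ends of intervals that exhaust the positive half-line. *)
Definition small (n : nat) : R := n.+2%:R^-1.

Lemma small_gt0 n : 0 < small n. Proof. by rewrite invr_gt0. Qed.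

Lemma small_lt1 n : small n < 1.
Proof. by rewrite invf_lt1// ltr1n. Qed.

Lemma cvg_small : small @ \oo --> (0 : R).
Proof.
have := @cvg_harmonic R; rewrite -(cvg_shiftn 1).
by apply: cvg_trans; apply: near_eq_cvg; near=> n; rewrite /= addn1.
Unshelve. all: by end_near. Qed.

Lemma cvg_powN (c : R) : 0 < c -> expR (- (c * ln n.+2%:R)) @[n --> \oo] --> (0 : R).
Proof.
move=> c0; apply: (cvg_comp _ _ _ (@cvgr_expR R)).
apply/cvgryPge => A; near=> n.
rewrite -ler_pdivrMl// -[leLHS]expRK ler_ln ?posrE ?expR_gt0//.
rewrite (@le_trans _ _ n%:R)// ?ler_nat; last by rewrite ltnW.
near: n; exact: nbhs_infty_ger.
Unshelve. all: by end_near. Qed.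

End Calculus.

(** * Complex sequences and series *)

Section ComplexLimits.
Local Open Scope complex_scope.
Context {R : realType}.
Local Notation C := R[i].
Local Notation Re := (@complex.Re R).
Local Notation Im := (@complex.Im R).
Local Notation cmod := (@Normc.normc R).
Implicit Types (u v : nat -> C) (z w l : C).

Lemma cmodE z : `|z| = (cmod z)%:C. Proof. by []. Qed.

Lemma cmod_ge0 z : 0 <= cmod z.
Proof. by rewrite -lecR -cmodE normr_ge0. Qed.

Lemma cmodD z w : cmod (z + w) <= cmod z + cmod w.
Proof. exact: le_normcD. Qed.

Lemma cmodN z : cmod (- z) = cmod z.
Proof. exact: normcN. Qed.

Lemma cmodB z w : cmod (z - w) = cmod (w - z).
Proof. by rewrite -cmodN opprB. Qed.

Lemma cmodM z w : cmod (z * w) = cmod z * cmod w.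
Proof. exact: Normc.normcM. Qed.

Lemma cmodX z n : cmod (z ^+ n) = cmod z ^+ n.
Proof.
elim: n => [|n IH]; first by rewrite !expr0 Normc.normc1.
by rewrite !exprS cmodM IH.
Qed.

Lemma cmod_real (x : R) : cmod x%:C = `|x|.
Proof. by rewrite /= expr0n /= addr0 sqrtr_sqr. Qed.

Lemma cmod_Re z : `|Re z| <= cmod z.
Proof. by rewrite -lecR -cmodE; exact: normc_ge_Re. Qed.

Lemma cmod_Im z : `|Im z| <= cmod z.
Proof.
case: z => a b /=; rewrite -sqrtr_sqr ler_sqrt ?lerDr ?sqr_ge0//.
by rewrite addr_ge0 ?sqr_ge0.
Qed.

Lemma cmod_le_ReIm z : cmod z <= `|Re z| + `|Im z|.
Proof.
case: z => a b /=; rewrite -[X in _ <= X]ger0_norm ?addr_ge0// -sqrtr_sqr.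
rewrite ler_sqrt ?sqr_ge0// sqrrD !real_normK ?num_real//.
by rewrite -addrA lerD2l lerDr mulrn_wge0// mulr_ge0.
Qed.

Lemma cmod_sum I (r : seq I) (F : I -> C) :
  cmod (\sum_(i <- r) F i) <= \sum_(i <- r) cmod (F i).
Proof.
elim/big_rec2: _ => [|i x z _ xz]; first by rewrite Normc.normc0.
by rewrite (le_trans (cmodD _ _))// lerD2l.
Qed.

(** Convergence in [R[i]] by way of the real sequence of distances, to which the
limit theorems on real sequences apply. *)
Definition clim u l := cmod (u n - l) @[n --> \oo] --> (0 : R).

Lemma clim_squeeze u l (v : nat -> R) :
  (\forall n \near \oo, cmod (u n - l) <= v n) -> v @ \oo --> 0 -> clim u l.
Proof.
move=> uv v0; rewrite /clim; apply: (squeeze_cvgr _ (cvg_cst 0) v0).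
by near=> n; rewrite cmod_ge0 /=; near: n.
Unshelve. all: by end_near. Qed.

Lemma clim_cst l : clim (fun=> l) l.
Proof.
rewrite /clim subrr Normc.normc0; exact: cvg_cst.
Qed.

Lemma climD u v l m : clim u l -> clim v m -> clim (fun n => u n + v n) (l + m).
Proof.
move=> ul vm; apply: (clim_squeeze _ (v := fun n => cmod (u n - l) + cmod (v n - m))).
  by near=> n; rewrite opprD addrACA cmodD.
by rewrite -[X in _ --> X](addr0 0); exact: cvgD.
Unshelve. all: by end_near. Qed.

Lemma climZ u l a : clim u l -> clim (fun n => a * u n) (a * l).
Proof.
move=> ul; apply: (clim_squeeze _ (v := fun n => cmod a * cmod (u n - l))).
  by near=> n; rewrite -mulrBr cmodM.
by rewrite -[X in _ --> X](mulr0 (cmod a)); apply: cvgM => //; exact: cvg_cst.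
Unshelve. all: by end_near. Qed.

Lemma clim_shift u l k : clim (fun n => u (n + k)%N) l <-> clim u l.
Proof.
have -> : clim (fun n => u (n + k)%N) l =
  (([sequence cmod (u (n + k)%N - l)]_n @ \oo --> (0 : R))) by [].
by rewrite (cvg_shiftn k (fun n => cmod (u n - l)) _).
Qed.

Lemma clim_unique u l m : clim u l -> clim u m -> l = m.
Proof.
move=> ul um; apply/eqP; rewrite -subr_eq0; apply/eqP/Normc.eq0_normc.
apply/eqP; rewrite eq_le cmod_ge0 andbT.
have H : cmod (u n - l) + cmod (u n - m) @[n --> \oo] --> (0 : R).
  by rewrite -[X in _ --> X](addr0 0); exact: cvgD.
rewrite -(cvg_lim _ H)//; apply: limr_ge; first by apply/cvg_ex; exists 0.
near=> n; rewrite (_ : l - m = (l - u n) + (u n - m)); last first.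
  by ring.
by rewrite (le_trans (cmodD _ _))// lerD2r cmodB.
Unshelve. all: by end_near. Qed.

Lemma clim_le u l (z : C) (M : R) : clim u l ->
  (\forall n \near \oo, cmod (u n - z) <= M) -> cmod (l - z) <= M.
Proof.
move=> ul uM.
have H : M + cmod (u n - l) @[n --> \oo] --> M.
  rewrite -[X in _ --> X](addr0 M); apply: cvgD => //; exact: cvg_cst.
rewrite -(cvg_lim _ H)//; apply: limr_ge; first by apply/cvg_ex; exists M.
near=> n; rewrite (_ : l - z = (u n - z) + (l - u n)); last first.
  by ring.
by rewrite (le_trans (cmodD _ _))// [cmod (l - _)]cmodB lerD2r; near: n.
Unshelve. all: by end_near. Qed.

(** Taken componentwise, so as to be total; by [csumP] it is the sum of the series
when the sums of the moduli are bounded. *)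
Definition csum u : C :=
  limn (series (Re \o u)) +i* limn (series (Im \o u)).

Lemma csumP u (M : R) : (forall n, \sum_(0 <= k < n) cmod (u k) <= M) ->
  clim (fun n => \sum_(0 <= k < n) u k) (csum u).
Proof.
move=> uM.
have part (p : C -> R) : (forall z, `|p z| <= cmod z) -> cvgn (series (p \o u)).
  move=> pu; apply: normed_cvg; apply: (bounded_series_cvg (M := M)) => n; first by rewrite /=.
  by rewrite (le_trans _ (uM n))//=; apply: ler_sum => i _; exact: pu.
have cR := part _ cmod_Re; have cI := part _ cmod_Im.
apply: (clim_squeeze _ (v := fun n =>
  `|series (Re \o u) n - limn (series (Re \o u))| +
  `|series (Im \o u) n - limn (series (Im \o u))|)).
  near=> n; rewrite (le_trans (cmod_le_ReIm _))// /series /= /csum.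
  by rewrite !raddfB /= !raddf_sum.
rewrite -[X in _ --> X](addr0 0); apply: cvgD.
  exact/norm_cvg0P/subr_cvg0.
exact/norm_cvg0P/subr_cvg0.
Unshelve. all: by end_near. Qed.

Lemma csum_tail u (M : R) N : (forall n, \sum_(0 <= k < n) cmod (u k) <= M) ->
  cmod (csum u - \sum_(0 <= k < N) u k) <= M - \sum_(0 <= k < N) cmod (u k).
Proof.
move=> uM; apply: (clim_le (csumP uM)).
near=> n.
have Nn : (N <= n)%N by near: n; exact: nbhs_infty_ge.
rewrite [X in X - _](big_cat_nat (n := N))//= addrAC subrr add0r lerBrDl.
rewrite (le_trans _ (uM n))// [leRHS](big_cat_nat (n := N))//= lerD2l.
exact: cmod_sum.
Unshelve. all: by end_near. Qed.

Lemma cmod_cexp z : cmod (cexp z) = expR (Re z).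
Proof.
rewrite /cexp cmodM cmod_real ger0_norm ?expR_ge0//.
by rewrite -[RHS]mulr1 /= cos2Dsin2 sqrtr1.
Qed.

Lemma cexpD z w : cexp (z + w) = cexp z * cexp w.
Proof.
case: z w => [x y] [x' y']; rewrite /cexp /= expRD cosD sinD.
by apply/eqP; rewrite eq_complex /=; apply/andP; split; apply/eqP; ring.
Qed.

Lemma cexp_real (x : R) : cexp x%:C = (expR x)%:C.
Proof. by rewrite /cexp /= cos0 sin0 mulr1. Qed.

(** On the ray [t |-> t z] the exponential solves a linear differential
equation, so Taylor's inequality applies to the real part of [k * cexp (t z)],
where [k = 1] and [k = - i] give the two components. *)
Lemma cexp_taylor_Re (k z : C) K :
  `|Re (k * (cexp z - \sum_(0 <= j < K) (j`!%:R^-1)%:C * z ^+ j))| <=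
  cmod k * cmod z ^+ K * expR `|Re z| / K`!%:R.
Proof.
pose g j (t : R) := expR (t * Re z) * (Re (k * z ^+ j) * cos (t * Im z)
   - Im (k * z ^+ j) * sin (t * Im z)).
have gE j t : g j t = Re (k * z ^+ j * cexp (t%:C * z)).
  rewrite /g /cexp; case: (k * z ^+ j) => p q; case: (z) => x y /=.
  by rewrite !mul0r !subr0 !addr0; ring.
have dg j (y : R) : is_derive y 1 (g j) (g j.+1 y).
  have dc (c : R) : is_derive y 1 (fun t => t * c) c.
    apply: (is_derive_eqr (is_derive_mulr c (is_derive_var y))).
    by rewrite mul1r.
  apply: is_derive_eqr.
  rewrite /g exprSr mulrA /GRing.scale /=.
  case: (k * z ^+ j) => p q; case: (z) => x w /=.
  by ring.
have cg j : continuous (g j).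
  by move=> y; exact: is_derive_continuous (dg j y).
have M0 : 0 <= cmod k * cmod z ^+ K by rewrite mulr_ge0 ?exprn_ge0 ?cmod_ge0.
have gM y : y \in `[0, 1] -> `|g K y| <= cmod k * cmod z ^+ K * expR `|Re z|.
  rewrite in_itv /= => /andP[y0 y1].
  rewrite gE (le_trans (cmod_Re _))// cmodM cmod_cexp cmodM cmodX ler_wpM2l//.
  rewrite ler_expR; case: (z) => x w /=; rewrite mul0r subr0.
  by rewrite (le_trans (ler_norm _))// normrM (ger0_norm y0) ler_piMl.
have := taylor_ineq ler01 (fun j _ => continuous_subspaceT (cg j))
  (fun j y _ _ => dg j y) gM.
rewrite subr0 expr1n mulr1; apply: le_trans.
rewrite le_eqVlt; apply/orP; left; apply/eqP; congr (`|_|).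
rewrite mulrBr raddfB /= gE expr0 mulr1 mul1r; congr (_ - _).
rewrite mulr_sumr raddf_sum /= /taylor_sum; apply: eq_bigr => j _.
rewrite gE subr0 expr1n mul0r cexp_real expR0 mulr1 mulrCA.
by case: (k * z ^+ j) => p q /=; rewrite mul0r subr0 div1r.
Qed.

Lemma cexp_series z :
  clim (fun n => \sum_(0 <= j < n) (j`!%:R^-1)%:C * z ^+ j) (cexp z).
Proof.
pose e K := cmod z ^+ K * expR `|Re z| / K`!%:R.
apply: (clim_squeeze _ (v := fun K => e K + e K)).
  near=> K; rewrite cmodB (le_trans (cmod_le_ReIm _))// lerD//.
    by have := cexp_taylor_Re 1 z K; rewrite !mul1r Normc.normc1 mul1r.
  have := cexp_taylor_Re (- 'i) z K; rewrite cmodN.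
  have -> : cmod 'i = 1 by rewrite /= expr0n expr1n add0r sqrtr1.
  rewrite mul1r; case: (cexp z - _) => p q /=.
  by rewrite oppr0 mul0r sub0r mulN1r opprK.
have e0 : e @ \oo --> (0 : R).
  have -> : e = fun K => exp_coeff (cmod z) K * expR `|Re z|.
    by apply/funext => K; rewrite /e /exp_coeff /= mulrAC.
  rewrite -[X in _ --> X](mul0r (expR `|Re z|)).
  apply: cvgM; last exact: cvg_cst.
  exact: cvg_series_cvg_0 (@is_cvg_series_exp_coeff R (cmod z)).
by rewrite -[X in _ --> X](addr0 0); exact: cvgD.
Unshelve. all: by end_near. Qed.

End ComplexLimits.

(** * Absolutely convergent power series *)

Section Wiener.
Local Open Scope complex_scope.
Context {R : realType}.
Local Notation C := R[i].
Local Notation Re := (@complex.Re R).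
Local Notation Im := (@complex.Im R).
Local Notation cmod := (@Normc.normc R).
Implicit Types (a b z w : C) (r M : R) (f g : C -> C).

(** On the closed disc of centre [a] and radius [r], [f] is the sum of a power
series whose norm in the weighted [l^1] space is at most [M].  Since the norm is
explicit, infinitely many such functions can be added on a common disc. *)
Definition wiener a r f M :=
  exists c : nat -> C,
    (forall n, \sum_(0 <= j < n) cmod (c j) * r ^+ j <= M) /\
    (forall z, cmod (z - a) <= r ->
       clim (fun n => \sum_(0 <= j < n) c j * (z - a) ^+ j) (f z)).

Lemma wiener_ext a r f g M : (forall z, cmod (z - a) <= r -> f z = g z) ->
  wiener a r f M -> wiener a r g M.
Proof.
move=> fg [c [cM cf]]; exists c; split=> // z za; rewrite -fg//; exact: cf.
Qed.

Lemma wiener_le a r f M M' : M <= M' -> wiener a r f M -> wiener a r f M'.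
Proof.
by move=> MM [c [cM cf]]; exists c; split=> // n; rewrite (le_trans (cM n)).
Qed.

Lemma wiener_radius a r r' f M : 0 <= r' -> r' <= r ->
  wiener a r f M -> wiener a r' f M.
Proof.
move=> r0 rr [c [cM cf]]; exists c; split=> [n|z za]; last first.
  by apply: cf; rewrite (le_trans za).
rewrite (le_trans _ (cM n))//; apply: ler_sum => j _.
by rewrite ler_wpM2l ?cmod_ge0// lerXn2r ?nnegrE// (le_trans r0).
Qed.

Lemma wiener_ge0 a r f M : wiener a r f M -> 0 <= M.
Proof. by move=> [c [cM _]]; have := cM 0; rewrite big_geq. Qed.

Lemma wiener_cst a r k : 0 <= r -> wiener a r (fun=> k) (cmod k).
Proof.
move=> r0; pose c j : C := if j is 0 then k else 0.
have sumc (F : nat -> C) n : \sum_(0 <= j < n.+1) c j * F j = k * F 0.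
  by rewrite big_nat_recl// big1 ?addr0// => i _; rewrite mul0r.
exists c; split=> [n|z za].
  case: n => [|n]; first by rewrite big_geq// cmod_ge0.
  rewrite big_nat_recl//= expr0 mulr1 big1 ?addr0// => i _.
  by rewrite expr0n /= addr0 sqrtr0 mul0r.
apply/(clim_shift _ _ 1).
rewrite (_ : (fun _ => _) = fun=> k); first exact: clim_cst.
by apply/funext => n; rewrite addn1 sumc expr0 mulr1.
Qed.

Lemma wienerD a r f g M N : 0 <= r -> wiener a r f M -> wiener a r g N ->
  wiener a r (fun z => f z + g z) (M + N).
Proof.
move=> r0 [c [cM cf]] [d [dN dg]]; exists (fun j => c j + d j); split=> [n|z za].
  rewrite (le_trans _ (lerD (cM n) (dN n)))// -big_split/=; apply: ler_sum => j _.
  by rewrite -mulrDl ler_wpM2r ?exprn_ge0// cmodD.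
rewrite (_ : (fun _ => _) = fun n => \sum_(0 <= j < n) c j * (z - a) ^+ j +
    \sum_(0 <= j < n) d j * (z - a) ^+ j); first exact: climD (cf z za) (dg z za).
by apply/funext => n; rewrite -big_split; apply: eq_bigr => j _; rewrite mulrDl.
Qed.

Lemma wienerZ a r f M k : wiener a r f M ->
  wiener a r (fun z => k * f z) (cmod k * M).
Proof.
move=> [c [cM cf]]; exists (fun j => k * c j); split=> [n|z za].
  rewrite (_ : \sum_(_ <= _ < _) _ =
    cmod k * \sum_(0 <= j < n) cmod (c j) * r ^+ j).
    by rewrite ler_wpM2l ?cmod_ge0.
  by rewrite mulr_sumr; apply: eq_bigr => j _; rewrite cmodM mulrA.
rewrite (_ : (fun _ => _) = fun n => k * \sum_(0 <= j < n) c j * (z - a) ^+ j).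
  exact: climZ (cf z za).
by apply/funext => n; rewrite mulr_sumr; apply: eq_bigr => j _; rewrite mulrA.
Qed.

Lemma wiener_mulX a r f M : 0 <= r -> wiener a r f M ->
  wiener a r (fun z => (z - a) * f z) (r * M).
Proof.
move=> r0 [c [cM cf]]; exists (fun j => if j is i.+1 then c i else 0).
split=> [[|n]|z za].
- by rewrite big_geq// mulr_ge0// (le_trans _ (cM 0))// big_geq.
- rewrite big_nat_recl//= expr0n /= addr0 sqrtr0 mul0r add0r.
  rewrite (le_trans _ (ler_wpM2l r0 (cM n)))// mulr_sumr.
  by apply: ler_sum => j _; rewrite exprS mulrCA.
- apply/(clim_shift _ _ 1).
  rewrite (_ : (fun _ => _) = fun n => (z - a) * \sum_(0 <= j < n) c j * (z - a) ^+ j).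
    exact: climZ (cf z za).
  apply/funext => n; rewrite addn1 big_nat_recl// mul0r add0r mulr_sumr.
  by apply: eq_bigr => j _; rewrite exprS mulrCA.
Qed.

(** Write [z - b = (z - a) + (a - b)]. *)
Lemma wiener_lin a b r f M : 0 <= r -> wiener a r f M ->
  wiener a r (fun z => (z - b) * f z) ((r + cmod (a - b)) * M).
Proof.
move=> r0 fM; rewrite mulrDl.
apply: wiener_ext (wienerD r0 (wiener_mulX r0 fM) (wienerZ (a - b) fM)) => z _.
by ring.
Qed.

Lemma wiener_exp a r (L : R) : 0 <= r ->
  wiener a r (fun z => cexp (z * L%:C)) (expR (Re a * L + r * `|L|)).
Proof.
move=> r0; exists (fun j => cexp (a * L%:C) * ((L ^+ j / j`!%:R)%:C)).
split=> [n|z za].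
  rewrite (_ : \sum_(_ <= _ < _) _ = expR (Re a * L) *
      \sum_(0 <= j < n) exp_coeff (r * `|L|) j); last first.
    rewrite mulr_sumr; apply: eq_bigr => j _.
    rewrite cmodM cmod_cexp cmod_real normrM normfV normrX.
    rewrite [X in _ / X]ger0_norm// /exp_coeff /= exprMn.
    by case: (a) => x y /=; rewrite mulr0 subr0; ring.
  rewrite expRD ler_wpM2l ?expR_ge0//.
  apply: nondecreasing_cvgn_le; last exact: is_cvg_series_exp_coeff.
  apply/nondecreasing_seqP => i; rewrite seriesSr lerDl.
  by rewrite /exp_coeff /= divr_ge0// exprn_ge0// mulr_ge0.
rewrite (_ : z * L%:C = a * L%:C + (z - a) * L%:C); last by ring.
rewrite cexpD; have := climZ (cexp (a * L%:C)) (cexp_series ((z - a) * L%:C)).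
rewrite (_ : (fun _ => _ * _) = fun n => \sum_(0 <= j < n)
    cexp (a * L%:C) * (L ^+ j / j`!%:R)%:C * (z - a) ^+ j)//.
apply/funext => n; rewrite mulr_sumr; apply: eq_bigr => j _.
rewrite exprMn rmorphM rmorphXn /=; ring.
Qed.

Lemma wiener_bound a r f M z : wiener a r f M -> cmod (z - a) <= r ->
  cmod (f z) <= M.
Proof.
move=> [c [cM cf]] za; rewrite -[f z]subr0; apply: clim_le (cf z za) _.
near=> n; rewrite subr0 (le_trans _ (cM n))// (le_trans (cmod_sum _ _))//.
apply: ler_sum => j _; rewrite cmodM cmodX ler_wpM2l ?cmod_ge0//.
by rewrite lerXn2r ?nnegrE ?cmod_ge0// (le_trans _ za) ?cmod_ge0.
Unshelve. all: by end_near. Qed.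

(** In the disc, a power of [z - a] of order [j > p] is at most [r ^ (j - p - 1)]
times the power of order [p + 1]. *)
Lemma wiener_leading_term a r f M (c : nat -> C) p z : 0 < r ->
  (forall n, \sum_(0 <= j < n) cmod (c j) * r ^+ j <= M) ->
  (forall z, cmod (z - a) <= r ->
       clim (fun n => \sum_(0 <= j < n) c j * (z - a) ^+ j) (f z)) ->
  (forall j, (j < p)%N -> c j = 0) -> cmod (z - a) <= r ->
  cmod (f z - c p * (z - a) ^+ p) <= cmod (z - a) ^+ p.+1 * (M / r ^+ p.+1).
Proof.
move=> r0 cM cf c0 za; apply: clim_le (cf z za) _.
near=> n.
have pn : (p < n)%N by near: n; exact: nbhs_infty_gt.
rewrite (big_cat_nat (n := p))//=; last exact: ltnW.
rewrite big1_seq ?add0r; last first.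
  by move=> j /= /[!mem_index_iota] /andP[_ jp]; rewrite c0// mul0r.
rewrite big_ltn// addrAC subrr add0r (le_trans (cmod_sum _ _))//.
have sM : \sum_(p.+1 <= j < n) cmod (c j) * r ^+ j <= M.
  rewrite (le_trans _ (cM n))// [leRHS](big_cat_nat (n := p.+1))//= lerDr.
  by rewrite sumr_ge0// => j _; rewrite mulr_ge0 ?cmod_ge0// exprn_ge0// ltW.
rewrite mulrCA (le_trans _ (ler_wpM2r _ sM))//; last first.
  by rewrite divr_ge0 ?exprn_ge0 ?cmod_ge0// ltW.
rewrite mulr_suml; apply: ler_sum_nat => j /andP[pj _].
rewrite cmodM cmodX -mulrA ler_wpM2l ?cmod_ge0//.
rewrite -(subnK pj) !exprD mulrACA divff ?mulr1 ?expf_neq0 ?gt_eqF//.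
rewrite ler_wpM2r ?exprn_ge0 ?cmod_ge0// lerXn2r ?nnegrE ?cmod_ge0//.
exact: ltW.
Unshelve. all: by end_near. Qed.

(** The case [p = 0] of [wiener_leading_term] gives a Lipschitz bound. *)
Lemma wiener_continuous a r f M : 0 < r -> wiener a r f M ->
  forall z, cmod (z - a) <= r -> cmod (f z - f a) <= cmod (z - a) * (M / r).
Proof.
move=> r0 [c [cM cf]] z za.
have := wiener_leading_term (p := 0) r0 cM cf _ za.
rewrite !expr1 expr0 mulr1.
have -> : c 0 = f a.
  apply: clim_unique (cf a _); last by rewrite subrr Normc.normc0 ltW.
  apply/(clim_shift _ _ 1).
  rewrite (_ : (fun _ => _) = fun=> c 0); first exact: clim_cst.
  apply/funext => n; rewrite addn1 big_nat_recl// subrr expr0 mulr1.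
  by rewrite big1 ?addr0// => i _; rewrite exprS mul0r mulr0.
exact.
Qed.

(** Were [c p] the first nonzero coefficient, [f z / (z - a) ^+ p] would tend
to [c p] along the zeros of [f]. *)
Lemma wiener_identity a r f M : 0 < r -> wiener a r f M ->
  (forall e : R, 0 < e -> exists z, [/\ z != a, cmod (z - a) <= e & f z = 0]) ->
  forall z, cmod (z - a) <= r -> f z = 0.
Proof.
move=> r0 [c [cM cf]] zeros.
have c0 p : c p = 0.
  elim/ltn_ind: p => p IH; apply/eqP/negPn/negP => cp.
  have cp0 : 0 < cmod (c p).
    rewrite lt0r cmod_ge0 andbT; apply: contra cp => /eqP/Normc.eq0_normc ->.
    by [].
  have M0 : 0 <= M by rewrite (le_trans _ (cM 0))// big_geq.
  (* at this distance the terms after the leading one amount to at most half of it *)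
  pose e := Num.min r (cmod (c p) / (2 * (M / r ^+ p.+1 + 1))).
  have K0 : 0 < M / r ^+ p.+1 + 1.
    by rewrite ltr_wpDl// divr_ge0// exprn_ge0// ltW.
  have e0 : 0 < e by rewrite lt_min r0 divr_gt0// mulr_gt0.
  have [z [za ze fz]] := zeros e e0.
  have zr : cmod (z - a) <= r by rewrite (le_trans ze)// ge_min lexx.
  have := wiener_leading_term r0 cM cf IH zr.
  have w0 : 0 < cmod (z - a).
    rewrite lt0r cmod_ge0 andbT; apply: contra za => /eqP/Normc.eq0_normc/eqP.
    by rewrite subr_eq0.
  rewrite fz sub0r cmodN cmodM cmodX exprS mulrC -mulrA.
  rewrite mulrCA ler_pM2l ?exprn_gt0// leNgt => /negP; apply.
  have := ze; rewrite le_min => /andP[_]; rewrite ler_pdivlMr ?mulr_gt0// => h.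
  rewrite (@lt_le_trans _ _ (cmod (z - a) * (2 * (M / r ^+ p.+1 + 1))))//.
  rewrite ltr_pM2l//; move: K0; set K := M / _ => K0; lra.
move=> z za; apply: clim_unique (cf z za) _.
rewrite (_ : (fun _ => _) = fun=> 0); first exact: clim_cst.
by apply/funext => n; rewrite big1// => i _; rewrite c0 mul0r.
Qed.

End Wiener.

Section WienerSum.
Local Open Scope complex_scope.
Context {R : realType}.
Local Notation C := R[i].
Local Notation Re := (@complex.Re R).
Local Notation Im := (@complex.Im R).
Local Notation cmod := (@Normc.normc R).
Implicit Types (a b z w : C) (r M : R) (f g : C -> C).

Lemma cmod_dist z w : `|cmod z - cmod w| <= cmod (z - w).
Proof.
have H x y : cmod x - cmod y <= cmod (x - y).
  by rewrite lerBlDr (le_trans _ (cmodD _ _))// subrK.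
by rewrite ler_norml lerNl opprB H cmodB H.
Qed.

Lemma csum_tail_dom (u : nat -> C) (v : nat -> R) (T : R) N :
  (forall k, cmod (u k) <= v k) -> (forall n, \sum_(0 <= k < n) v k <= T) ->
  cmod (csum u - \sum_(0 <= k < N) u k) <= T - \sum_(0 <= k < N) v k.
Proof.
move=> uv vT.
pose T' := T - \sum_(0 <= k < N) v k + \sum_(0 <= k < N) cmod (u k).
rewrite (le_trans (csum_tail (M := T') N _))//; last by rewrite /T' addrK.
move=> n; rewrite /T'; have TN := vT N; have Tn := vT n.
have mono (w : nat -> R) m p q : (forall k, 0 <= w k) -> (p <= q)%N ->
    \sum_(m <= k < p) w k <= \sum_(m <= k < q) w k.
  move=> w0 pq; have [mp|pm] := leqP m p; last first.
    by rewrite [leLHS]big_geq ?(ltnW pm)// sumr_ge0.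
  by rewrite [leRHS](big_cat_nat (n := p))//= lerDl sumr_ge0.
have [nN|/ltnW Nn] := leqP n N.
  by have := mono (cmod \o u) 0 _ _ (fun k => cmod_ge0 _) nN; rewrite /=; lra.
move: Tn; rewrite [X in X <= T -> _](big_cat_nat (n := N))//=.
rewrite [X in _ -> X <= _](big_cat_nat (n := N))//=.
have : \sum_(N <= k < n) cmod (u k) <= \sum_(N <= k < n) v k by exact: ler_sum.
lra.
Qed.

Lemma clim_sum (u : nat -> nat -> C) (l : nat -> C) J :
  (forall j, clim (u j) (l j)) ->
  clim (fun n => \sum_(0 <= j < J) u j n) (\sum_(0 <= j < J) l j).
Proof.
move=> ul; elim: J => [|J IH].
  rewrite big_geq// (_ : (fun _ => _) = fun=> 0); first exact: clim_cst.
  by apply/funext => n; rewrite big_geq.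
rewrite big_nat_recr//=.
rewrite (_ : (fun _ => _) = fun n => \sum_(0 <= j < J) u j n + u J n).
  exact: climD.
by apply/funext => n; rewrite big_nat_recr.
Qed.

Lemma clim_cmod (u : nat -> C) l : clim u l -> cmod (u n) @[n --> \oo] --> cmod l.
Proof.
move=> ul; apply/subr_cvg0/norm_cvg0P.
apply: (squeeze_cvgr _ (cvg_cst 0) ul); near=> n; rewrite normr_ge0 /=.
exact: cmod_dist.
Unshelve. all: by end_near. Qed.

(** Summation commutes with taking power series coefficients, by absolute
convergence of the double series. *)
Lemma wiener_csum a r (f : nat -> C -> C) (M : nat -> R) (S : R) : 0 < r ->
  (forall n, wiener a r (f n) (M n)) ->
  (forall N, \sum_(0 <= n < N) M n <= S) ->
  wiener a r (fun z => csum (f ^~ z)) S.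
Proof.
move=> r0 fM MS.
have [c cP] := choice fM.
have cM n J : \sum_(0 <= j < J) cmod (c n j) * r ^+ j <= M n by case: (cP n).
have cf n z : cmod (z - a) <= r ->
  clim (fun J => \sum_(0 <= j < J) c n j * (z - a) ^+ j) (f n z).
  by case: (cP n) => _; exact.
have M0 n : 0 <= M n by rewrite (le_trans _ (cM n 0))// big_geq.
have c1 n j : cmod (c n j) * r ^+ j <= M n.
  rewrite (le_trans _ (cM n j.+1))// big_nat_recr//= lerDr sumr_ge0// => i _.
  by rewrite mulr_ge0 ?cmod_ge0// exprn_ge0// ltW.
pose d j := csum (c ^~ j).
have dlim j : clim (fun N => \sum_(0 <= n < N) c n j) (d j).
  apply: (@csumP _ _ (S / r ^+ j)) => N.
  rewrite ler_pdivlMr ?exprn_gt0// (le_trans _ (MS N))// mulr_suml.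
  exact: ler_sum.
have M_cvg : cvgn (series M) by exact: (@bounded_series_cvg _ _ S).
have MT N : \sum_(0 <= n < N) M n <= limn (series M).
  apply: (nondecreasing_cvgn_le _ M_cvg N).
  by apply/nondecreasing_seqP => n; rewrite seriesSr lerDl.
(* truncating the outer sum at N changes each partial power series by at most
   the tail of the series of norms *)
have tail J N w : cmod w <= r ->
    cmod (\sum_(0 <= j < J) d j * w ^+ j -
          \sum_(0 <= n < N) \sum_(0 <= j < J) c n j * w ^+ j) <=
    limn (series M) - \sum_(0 <= n < N) M n.
  move=> wr.
  have H : clim (fun N => \sum_(0 <= j < J) w ^+ j * (\sum_(0 <= n < N) c n j))
      (\sum_(0 <= j < J) w ^+ j * d j).
    by apply: clim_sum => j; exact: climZ.
  under eq_bigr do rewrite mulrC.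
  apply: clim_le H _; near=> p.
  have Np : (N <= p)%N by near: p; exact: nbhs_infty_ge.
  have -> : \sum_(0 <= j < J) w ^+ j * (\sum_(0 <= n < p) c n j) =
      \sum_(0 <= n < p) \sum_(0 <= j < J) c n j * w ^+ j.
    rewrite exchange_big/=; apply: eq_bigr => j _; rewrite mulr_sumr.
    by apply: eq_bigr => n _; rewrite mulrC.
  rewrite [X in X - _](big_cat_nat (n := N))//= addrAC subrr add0r.
  rewrite (le_trans (cmod_sum _ _))// lerBrDl (le_trans _ (MT p))//.
  rewrite [leRHS](big_cat_nat (n := N))//= lerD2l; apply: ler_sum => n _.
  rewrite (le_trans (cmod_sum _ _))// (le_trans _ (cM n J))//.
  apply: ler_sum => j _; rewrite cmodM cmodX ler_wpM2l ?cmod_ge0//.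
  by rewrite lerXn2r ?nnegrE ?cmod_ge0// ltW.
exists d; split=> [J|z za].
  have H : \sum_(0 <= j < J) cmod (\sum_(0 <= n < N) c n j) * r ^+ j @[N --> \oo]
      --> \sum_(0 <= j < J) cmod (d j) * r ^+ j.
    elim: J => [|J IH].
      rewrite big_geq// (_ : (fun _ => _) = fun=> 0); first exact: cvg_cst.
      by apply/funext => N; rewrite big_geq.
    rewrite big_nat_recr//=; rewrite (_ : (fun _ => _) = fun N =>
      \sum_(0 <= j < J) cmod (\sum_(0 <= n < N) c n j) * r ^+ j +
      cmod (\sum_(0 <= n < N) c n J) * r ^+ J); last first.
      by apply/funext => N; rewrite big_nat_recr.
    apply: cvgD => //; apply: cvgM; last exact: cvg_cst.
    exact: (clim_cmod (dlim J)).
  rewrite -(cvg_lim _ H)//; apply: limr_le; first by apply/cvg_ex; eexists; exact: H.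
  near=> N; rewrite (le_trans _ (MS N))//.
  rewrite (le_trans (y := \sum_(0 <= j < J) \sum_(0 <= n < N) cmod (c n j) * r ^+ j))//.
    apply: ler_sum => j _; rewrite -mulr_suml ler_wpM2r ?cmod_sum//.
    by rewrite exprn_ge0// ltW.
  by rewrite exchange_big/=; apply: ler_sum => n _; exact: cM.
rewrite /clim; apply/cvgrPdist_le => e e0.
have T0 : limn (series M) - \sum_(0 <= n < N) M n @[N --> \oo] --> 0.
  rewrite -[X in _ --> X](subrr (limn (series M))).
  by apply: cvgB => //; exact: cvg_cst.
have e3 : 0 < e / 3 by rewrite divr_gt0.
have [N _ NT] : \forall N \near \oo, limn (series M) - \sum_(0 <= n < N) M n <= e / 3.
  move/cvgrPdist_le : T0 => /(_ _ e3); apply: filterS => N.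
  by rewrite sub0r normrN => /ler_normlW.
have {}NT := NT N (leqnn N).
have H : clim (fun J => \sum_(0 <= n < N) \sum_(0 <= j < J) c n j * (z - a) ^+ j)
    (\sum_(0 <= n < N) f n z).
  by apply: clim_sum => n; exact: cf.
have tf : cmod (csum (f ^~ z) - \sum_(0 <= n < N) f n z) <=
    limn (series M) - \sum_(0 <= n < N) M n.
  by apply: csum_tail_dom => // n; exact: wiener_bound (fM n) za.
near=> J; rewrite sub0r normrN ger0_norm ?cmod_ge0//.
have HJ : cmod (\sum_(0 <= n < N) \sum_(0 <= j < J) c n j * (z - a) ^+ j -
    \sum_(0 <= n < N) f n z) <= e / 3.
  near: J; move/cvgrPdist_le : H => /(_ _ e3); apply: filterS => J.
  by rewrite sub0r normrN ger0_norm ?cmod_ge0.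
have := tail J N _ za; move: HJ tf NT.
set A := \sum_(0 <= j < J) _; set B := \sum_(0 <= n < N) \sum_(_ <= _ < _) _.
set D := \sum_(0 <= n < N) f n z; set E := csum _ => h1 h2 h3 h4.
have -> : A - E = (A - B) + (B - D) + (D - E) by ring.
have := cmodD (A - B + (B - D)) (D - E); have := cmodD (A - B) (B - D).
rewrite (cmodB D E); lra.
Unshelve. all: by end_near. Qed.

End WienerSum.

(** * Analytic continuation along a segment *)

Section Holomorphic.
Local Open Scope complex_scope.
Context {R : realType}.
Local Notation C := R[i].
Local Notation Re := (@complex.Re R).
Local Notation Im := (@complex.Im R).
Local Notation cmod := (@Normc.normc R).
Implicit Types (a b z w : C) (r M : R) (f g h : C -> C).

Definition holo f a := exists r M, 0 < r /\ wiener a r f M.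

Lemma holo_ext f g a : (forall z, f z = g z) -> holo f a -> holo g a.
Proof.
by move=> fg [r [M [r0 H]]]; exists r, M; split=> //; exact: wiener_ext H.
Qed.

Lemma holo_cst k a : holo (fun=> k) a.
Proof. by exists 1, (cmod k); split=> //; exact: wiener_cst. Qed.

Lemma holoD f g a : holo f a -> holo g a -> holo (fun z => f z + g z) a.
Proof.
move=> [r [M [r0 fM]]] [s [N [s0 gN]]].
have m0 : 0 < Num.min r s by rewrite lt_min r0.
exists (Num.min r s), (M + N); split=> //; apply: wienerD; first exact: ltW.
  apply: wiener_radius fM; first exact: ltW.
  by rewrite ge_min lexx.
apply: wiener_radius gN; first exact: ltW.
by rewrite ge_min lexx orbT.
Qed.

Lemma holo_sum (F : nat -> C -> C) a m n : (forall i, (m <= i < n)%N -> holo (F i) a) ->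
  holo (fun z => \sum_(m <= i < n) F i z) a.
Proof.
elim: n => [|n IH] H.
  by apply: holo_ext (holo_cst 0 a) => z; rewrite big_geq.
have [mn|nm] := leqP m n; last first.
  by apply: holo_ext (holo_cst 0 a) => z; rewrite big_geq.
apply: (@holo_ext (fun z => \sum_(m <= i < n) F i z + F n z)).
  by move=> z; rewrite big_nat_recr.
apply: holoD; last by apply: H; rewrite mn /=.
by apply: IH => i /andP[mi ni]; apply: H; rewrite mi ltnW.
Qed.

Lemma holoZ k f a : holo f a -> holo (fun z => k * f z) a.
Proof.
by move=> [r [M [r0 H]]]; exists r, (cmod k * M); split=> //; exact: wienerZ.
Qed.

Lemma holo_exp (L : R) a : holo (fun z => cexp (z * L%:C)) a.
Proof. by exists 1; eexists; split; last exact: wiener_exp. Qed.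

Lemma holo_shift f b a : holo f (a + b) -> holo (fun z => f (z + b)) a.
Proof.
move=> [r [M [r0 [c [cM cf]]]]]; exists r, M; split=> //; exists c; split=> // z za.
have e : z + b - (a + b) = z - a by ring.
by have := cf (z + b); rewrite e; exact.
Qed.

Lemma holo_continuous f a (e : R) : holo f a -> 0 < e ->
  exists2 d : R, 0 < d & forall z, cmod (z - a) <= d -> cmod (f z - f a) <= e.
Proof.
move=> [r [M [r0 H]]] e0; have M0 := wiener_ge0 H.
have K0 : 0 < M / r + 1 by rewrite ltr_wpDl// divr_ge0// ltW.
exists (Num.min r (e / (M / r + 1))); first by rewrite lt_min r0 divr_gt0.
move=> z; rewrite le_min => /andP[zr ze].
rewrite (le_trans (wiener_continuous r0 H zr))//.
move: ze; rewrite ler_pdivlMr//; apply: le_trans.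
by rewrite ler_wpM2l ?cmod_ge0// lerDl.
Qed.

(** The zeros of [h] along the segment form an initial piece; at its end point
the zeros accumulate, so the power series there is zero and the piece can be
extended. *)
Lemma holo_identity_segment h a b :
  (forall t : R, 0 <= t <= 1 -> holo h (a + t%:C * (b - a))) ->
  (exists2 e : R, 0 < e & forall z, cmod (z - a) <= e -> h z = 0) ->
  exists2 e : R, 0 < e & forall z, cmod (z - b) <= e -> h z = 0.
Proof.
move=> hh [e e0 ha].
have [ab|ab] := eqVneq a b; first by exists e => //; rewrite -ab.
pose p (t : R) := a + t%:C * (b - a).
pose l := cmod (b - a).
have l0 : 0 < l.
  rewrite lt0r cmod_ge0 andbT; apply: contra ab => /eqP/Normc.eq0_normc/eqP.
  by rewrite subr_eq0 eq_sym.
have pd s t : cmod (p s - p t) = `|s - t| * l.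
  rewrite (_ : p s - p t = (s - t)%:C * (b - a)) ?cmodM ?cmod_real//.
  by rewrite rmorphB /p /=; ring.
pose S := [set t : R | 0 <= t <= 1 /\ forall s, 0 <= s <= t -> h (p s) = 0].
have S1 : ubound S 1 by move=> t [/andP[]].
have [t0 t00 St0] : exists2 t, 0 < t & S t.
  exists (Num.min 1 (e / l)); first by rewrite lt_min ltr01 divr_gt0.
  split; first by rewrite ge_min lexx le_min ler01 divr_ge0 ?(ltW e0) ?(ltW l0).
  move=> s /andP[s0]; rewrite le_min => /andP[s1 sl]; apply: ha.
  have := pd s 0; rewrite {2}/p rmorph0 mul0r addr0 => ->.
  by rewrite subr0 ger0_norm// -ler_pdivlMr.
have hS : has_sup S by split; [exists t0|exists 1].
pose s := sup S.
have ts t : S t -> t <= s by move=> St; apply: ub_le_sup => //; exists 1.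
have s0 : 0 < s by rewrite (lt_le_trans t00)// ts.
have s1 : s <= 1 by apply: ge_sup => //; exists t0.
have below t : 0 <= t -> t < s -> h (p t) = 0.
  move=> t_0 ts0; have [|u Su tu] := sup_gt _ ts0; first by exists t0.
  by apply: (proj2 Su); rewrite t_0 ltW.
have s01 : 0 <= s <= 1 by rewrite ltW.
have [r [M [r0 hM]]] := hh s s01.
have zero : forall z, cmod (z - p s) <= r -> h z = 0.
  apply: (wiener_identity r0 hM) => d d0.
  have m0 : 0 < Num.min s (d / l) by rewrite lt_min s0 divr_gt0.
  exists (p (s - Num.min s (d / l))); split.
  - rewrite -subr_eq0; apply/eqP => /(congr1 cmod).
    rewrite pd Normc.normc0 addrAC subrr add0r normrN gtr0_norm// => /eqP.
    by rewrite mulf_eq0 !gt_eqF.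
  - rewrite pd addrAC subrr add0r normrN gtr0_norm// -ler_pdivlMr//.
    by rewrite ge_min lexx orbT.
  - by apply: below; rewrite ?subr_ge0 ?ge_min ?lexx// ltrBlDr ltrDl.
suff s_1 : s = 1.
  exists r => // z zb; apply: zero; rewrite s_1 /p rmorph1 mul1r addrCA subrr.
  by rewrite addr0.
apply/eqP; rewrite eq_le s1 leNgt; apply/negP => slt.
have rl : 0 < r / l by rewrite divr_gt0.
have : s < Num.min 1 (s + r / l) by rewrite lt_min slt ltrDl.
rewrite ltNge => /negP; apply; apply: ts; split.
  by rewrite ge_min lexx le_min ler01 /= addr_ge0 ?ltW.
move=> t /andP[t_0]; rewrite le_min => /andP[t1 tsl].
have [tls|slt'] := ltP t s; first exact: below.
apply: zero; rewrite pd ger0_norm ?subr_ge0// -ler_pdivlMr//.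
by rewrite lerBlDl.
Qed.

Lemma cvg_clim (u : nat -> C) (l : C) :
  (u : nat -> C^o) @ \oo --> (l : C^o) -> clim u l.
Proof.
move=> ul; apply/cvgrPdist_le => d d0.
have /cvgrPdist_le /(_ d%:C) := ul.
rewrite ltcR => /(_ d0); apply: filterS => n h.
by rewrite sub0r normrN ger0_norm ?cmod_ge0// cmodB -lecR.
Qed.

(** Bounded terms at distance [e / 2] from the centre give a geometric
majorant at distance [e / 4]. *)
Lemma analytic_at_holo f a : analytic_at f a -> holo f a.
Proof.
move=> [c /nbhs_ballP [e0 /= e0_gt0 H]].
(* a positive element of R[i] is real *)
have [e e_gt0 {e0 e0_gt0} H] : exists2 e : R, 0 < e & forall z, cmod (z - a) < e ->
    clim (fun n => \sum_(0 <= j < n) c j * (z - a) ^+ j) (f z).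
  case: e0 e0_gt0 H => e i; rewrite ltcE /= => /andP[/eqP-> e_gt0] H.
  exists e => // z za; apply: cvg_clim; apply: H.
  by rewrite -ball_normE /ball_ /= -[`|_|]/((cmod (a - z))%:C) ltcR cmodB.
have e2 : 0 < e / 2 by rewrite divr_gt0.
have e4 : 0 < e / 4 by rewrite divr_gt0.
have [K K0 cK] : exists2 K, 0 <= K & forall n, cmod (c n) * (e / 2) ^+ n <= K.
  have za : cmod (a + (e / 2)%:C - a) < e.
    by rewrite addrAC subrr add0r cmod_real gtr0_norm// ltr_pdivrMr// ltr_pMr// ltr1n.
  have := H _ za; rewrite addrAC subrr add0r => Hl.
  have : cvgn (fun n => cmod (c n) * (e / 2) ^+ n).
    apply/cvg_ex; exists 0.
    have Hd : clim (fun n => c n * (e / 2)%:C ^+ n) 0.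
      have H1 := climD ((clim_shift _ _ 1).2 Hl) (climZ (-1) Hl).
      rewrite mulN1r subrr in H1.
      rewrite (_ : (fun _ => _) = fun n =>
        \sum_(0 <= j < n + 1) c j * (e / 2)%:C ^+ j +
        -1 * \sum_(0 <= j < n) c j * (e / 2)%:C ^+ j) //.
      apply/funext => n; rewrite addn1 big_nat_recr//= mulN1r.
      by rewrite addrAC subrr add0r.
    apply: cvg_trans Hd; apply: near_eq_cvg; near=> n.
    by rewrite subr0 cmodM cmodX cmod_real gtr0_norm.
  move/cvg_has_ub => [K HK]; exists K.
    by rewrite (le_trans _ (HK _ (ex_intro2 _ _ 0%N I erefl))).
  by move=> n; rewrite (le_trans (ler_norm _))// HK//; exists n.
exists (e / 4), (K * 2); split=> //; exists c; split=> [n|z za]; last first.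
  by apply: H; rewrite (le_lt_trans za)// ltr_pdivrMr// ltr_pMr// ltr1n.
have geo : \sum_(0 <= j < n) (2^-1 : R) ^+ j <= 2.
  have h : (1 - 2^-1)^-1 = 2 :> R by field.
  by rewrite -[leRHS]h; apply: geometric_sum_le; lra.
rewrite (le_trans _ (ler_wpM2l K0 geo))// mulr_sumr; apply: ler_sum => j _.
rewrite (_ : e / 4 = e / 2 * 2^-1); last by field.
by rewrite exprMn mulrA ler_wpM2r ?exprn_ge0.
Unshelve. all: by end_near. Qed.

End Holomorphic.

(** * Generalized binomial coefficients *)

Section GeneralizedBinomial.
Local Open Scope complex_scope.

Definition gbin {F : numFieldType} (x : F) (k : nat) : F :=
  (\prod_(0 <= i < k) (x - i%:R)) / k`!%:R.

Lemma gbin0 {F : numFieldType} (x : F) : gbin x 0 = 1.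
Proof. by rewrite /gbin big_geq// fact0 divr1. Qed.

Lemma gbinS {F : numFieldType} (x : F) k :
  gbin x k.+1 = gbin x k * ((x - k%:R) / k.+1%:R).
Proof.
by rewrite /gbin big_nat_recr//= factS mulnC natrM invfM mulrACA.
Qed.

Lemma gbin_nat {F : numFieldType} n k : gbin (n%:R : F) k = 'C(n, k)%:R.
Proof.
have -> : gbin (n%:R : F) k = (n ^_ k)%:R / k`!%:R.
  congr (_ / _); elim: k => [|k IH]; first by rewrite big_geq.
  rewrite big_nat_recr//= IH ffactnSr natrM.
  have [kn|nk] := leqP k n; first by rewrite natrB.
  by rewrite ffact_small// !mul0r.
by rewrite -bin_ffact natrM mulfK// pnatr_eq0 -lt0n fact_gt0.
Qed.

Lemma gbin_complex {R : realType} (x : R) k : gbin x%:C k = (gbin x k)%:C.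
Proof.
elim: k => [|k IH]; first by rewrite !gbin0.
rewrite !gbinS IH [RHS]rmorphM /=; congr (_ * _).
by rewrite [RHS]rmorphM fmorphV rmorphB /= !rmorph_nat.
Qed.

(** The factors [- A - i] have the largest modulus among the factors [x - i] with
[|x| <= A], so this majorizes [gbin] on the disc of radius [A]. *)
Definition rising {R : realType} (A : R) (k : nat) : R := `|gbin (- A) k|.

End GeneralizedBinomial.

Section BinomialBounds.
Local Open Scope complex_scope.
Context {R : realType}.
Local Notation cmod := (@Normc.normc R).
Implicit Types (A : R).

Lemma risingS A k : 0 <= A -> rising A k.+1 = rising A k * ((A + k%:R) / k.+1%:R).
Proof.
move=> A0; rewrite /rising gbinS normrM; congr (_ * _).
by rewrite -opprD mulNr normrN ger0_norm// divr_ge0// addr_ge0.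
Qed.

Lemma rising_ge0 A k : 0 <= rising A k. Proof. exact: normr_ge0. Qed.

(** The quotient of consecutive terms tends to [1], so it ends up below [3 / 2].
Any ratio less than [2] would do, since the coefficients are multiplied by powers
of [1 / n] with [n >= 2]. *)
Lemma rising_le A : 0 <= A ->
  exists2 D : R, 0 <= D & forall k, rising A k <= D * (3 / 2) ^+ k.
Proof.
move=> A0; pose k0 := (Num.truncn (2 * A)).+1.
pose D := \sum_(0 <= i < k0.+1) rising A i.
have D0 : 0 <= D by rewrite sumr_ge0// => i _; exact: rising_ge0.
exists D => // k; have [kk|] := leqP k k0.
  rewrite (@le_trans _ _ D)//.
    rewrite /D (big_cat_nat (n := k.+1))//= big_nat_recr//= addrAC lerDr.
    by rewrite addr_ge0// sumr_ge0// => i _; exact: rising_ge0.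
  rewrite ler_peMr// exprn_ege1//; lra.
elim: k => // k IH; rewrite ltnS leq_eqVlt => kk.
have {IH} : rising A k <= D * (3 / 2) ^+ k.
  have [/eqP <-|/IH//] := orP kk.
  rewrite (@le_trans _ _ D)//.
    rewrite /D big_nat_recr//= lerDr sumr_ge0// => i _; exact: rising_ge0.
  rewrite ler_peMr// exprn_ege1//; lra.
rewrite risingS// exprSr [X in _ -> _ <= X]mulrA => H.
apply: ler_pM => //; first exact: rising_ge0.
  by rewrite divr_ge0// addr_ge0.
have {}kk : (k0 <= k)%N by rewrite leq_eqVlt.
have : 2 * A <= k%:R.
  by rewrite (le_trans (ltW (truncnS_gt _)))// ler_nat.
rewrite ler_pdivrMr// -[k.+1%:R]natr1 => H1.
have := ler0n R k; lra.
Qed.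

Lemma gbin_le (x A : R) k : `|x| <= A -> `|gbin x k| <= rising A k.
Proof.
move=> xA; have A0 : 0 <= A by rewrite (le_trans _ xA).
elim: k => [|k IH]; first by rewrite /rising !gbin0.
rewrite gbinS risingS// normrM ler_pM//.
rewrite normrM normfV [`|_.+1%:R|]ger0_norm// ler_wpM2r//.
by rewrite (le_trans (ler_normB _ _))// [`|k%:R|]ger0_norm// lerD2r.
Qed.

(** Each factor of the binomial coefficient is affine in [s], and [wiener_lin]
bounds the cost of multiplying by it. *)
Lemma wiener_gbin (a : R[i]) (r M : R) (f : R[i] -> R[i]) k : 0 <= r ->
  wiener a r f M ->
  wiener a r (fun s => gbin (1 - s) k * f s) (rising (r + cmod (1 - a)) k * M).
Proof.
move=> r0 fM; have A0 : 0 <= r + cmod (1 - a) by rewrite addr_ge0// cmod_ge0.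
elim: k => [|k IH].
  rewrite /rising gbin0 normr1 mul1r; apply: wiener_ext fM => z _.
  by rewrite gbin0 mul1r.
have kc : k.+1%:R = (k.+1%:R : R)%:C by rewrite rmorph_nat.
have H := wienerZ (- (k.+1%:R)^-1) (wiener_lin (1 - k%:R) r0 IH).
apply: (wiener_le _ (wiener_ext _ H)); last first.
  move=> z _; rewrite gbinS.
  by ring.
rewrite risingS// cmodN kc -fmorphV cmod_real ger0_norm ?invr_ge0//.
set W := rising _ k.
have X : cmod (a - (1 - k%:R)) <= cmod (1 - a) + k%:R.
  rewrite opprB addrA addrAC (le_trans (cmodD _ _))// cmodB.
  have -> : (k%:R : R[i]) = (k%:R : R)%:C by rewrite rmorph_nat.
  by rewrite cmod_real ger0_norm.
have W0 : 0 <= k.+1%:R^-1 * W * M.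
  by rewrite mulr_ge0 ?(wiener_ge0 fM)// mulr_ge0 ?invr_ge0 ?rising_ge0.
rewrite [leLHS](_ : _ = (r + cmod (a - (1 - k%:R))) * (k.+1%:R^-1 * W * M)).
  rewrite [leRHS](_ : _ = (r + cmod (1 - a) + k%:R) * (k.+1%:R^-1 * W * M)).
    by rewrite ler_wpM2r// -addrA lerD2l.
  by ring.
by ring.
Qed.

(** The powers [(1 + y) `^ (x - n)] are at most [1], so the Taylor remainder of
order [n] at the origin is at most [|gbin x n| * u ^ n]; the coefficients grow
at most like [(3 / 2) ^ n], and [u <= 1 / 2]. *)
Lemma binomial_series (x u : R) : x <= 0 -> 0 <= u -> u <= 2^-1 ->
  \sum_(0 <= k < n) gbin x k * u ^+ k @[n --> \oo] --> (1 + u) `^ x.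
Proof.
move=> x0 u0 u2.
pose g j y := j`!%:R * gbin x j * (1 + y) `^ (x - j%:R).
have dg j (y : R) : 0 <= y -> is_derive y 1 (g j) (g j.+1 y).
  move=> y0; have y1 : 0 < 1 + y by rewrite ltr_pwDl.
  have d1 : is_derive y 1 (fun z => 1 + z) 1.
    apply: (is_derive_eqr (is_derive_add (is_derive_const 1 y) (is_derive_var y))).
    by rewrite add0r.
  have d2 := is_derive_mull (j`!%:R * gbin x j)
    (is_derive_comp (is_derive1_powR (x - j%:R) y1) d1).
  apply: (is_derive_eqr d2); rewrite /g gbinS factS natrM -addrA -opprD natr1.
  have j0 : 1 + j%:R != 0 :> R by rewrite -mulrS pnatr_eq0.
  by field.
have [D D0 HD] := rising_le (normr_ge0 x).
have rem n : `|(1 + u) `^ x - \sum_(0 <= k < n) gbin x k * u ^+ k| <=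
    D * (3 / 4) ^+ n.
  have cg j : (j < n)%N -> {within `[0, u], continuous (g j)}.
    move=> _; apply: continuous_in_subspaceT => y; rewrite inE/= in_itv/=.
    by move=> /andP[y0 _]; exact: is_derive_continuous (dg j y y0).
  have dg' j y : (j < n)%N -> y \in `]0, u[ -> is_derive y 1 (g j) (g j.+1 y).
    by move=> _; rewrite in_itv /= => /andP[/ltW y0 _]; exact: dg.
  have gM y : y \in `[0, u] -> `|g n y| <= n`!%:R * rising `|x| n.
    rewrite in_itv /= => /andP[y0 yu].
    rewrite /g normrM normrM ger0_norm// -[leRHS]mulr1.
    apply: ler_pM; rewrite ?mulr_ge0//; first by rewrite ler_wpM2l// gbin_le.
    rewrite ger0_norm ?powR_ge0// -[leRHS](powRr0 (1 + y)) ler_powR ?lerDl//.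
    by rewrite subr_le0 (le_trans x0).
  have := taylor_ineq u0 cg dg' gM.
  rewrite /taylor_sum /g fact0 mul1r gbin0 mul1r subr0 subr0 => H.
  rewrite (_ : \sum_(_ <= _ < _) _ = \sum_(0 <= j < n) (u ^+ j / j`!%:R *
      (j`!%:R * gbin x j * (1 + 0) `^ (x - j%:R)))); last first.
    apply: eq_bigr => j _; rewrite addr0 powR1; field.
    by rewrite pnatr_eq0 -lt0n fact_gt0.
  rewrite (le_trans H)// mulrAC -[_ * rising _ _]mulrC mulfK; last first.
    by rewrite pnatr_eq0 -lt0n fact_gt0.
  rewrite (_ : 3 / 4 = 3 / 2 * 2^-1); last by field.
  rewrite exprMn mulrA ler_pM ?rising_ge0 ?exprn_ge0//.
  by rewrite lerXn2r// nnegrE; lra.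
apply/cvgrPdist_le => e e0.
have : geometric D (3 / 4) @ \oo --> (0 : R).
  by apply: cvg_geometric; rewrite ger0_norm; lra.
move=> /cvgrPdist_le /(_ e e0); apply: filterS => n.
by rewrite sub0r normrN => /ler_normlW; apply: le_trans; exact: rem.
Qed.

End BinomialBounds.

(** * The zeta function at non-positive integers *)

Section Zeta.
Local Open Scope complex_scope.
Context {R : realType}.
Local Notation C := R[i].
Local Notation Re := (@complex.Re R).
Local Notation Im := (@complex.Im R).
Local Notation cmod := (@Normc.normc R).

(** The term of order [k] in the expansion of
[(n + 1) ^ (1 - s) = n ^ (1 - s) (1 + 1 / n) ^ (1 - s)] by the binomial series. *)
Definition zterm (n k : nat) (s : C) : C :=
  gbin (1 - s) k * cexp ((1 - k%:R - s) * (ln n%:R)%:C).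

Definition zterm_norm (a : C) (r : R) (n k : nat) : R :=
  rising (r + cmod (1 - a)) k * expR ((1 - k%:R - Re a + r) * ln n%:R).

Lemma wiener_zterm a r n k : 0 <= r -> (0 < n)%N ->
  wiener a r (zterm n k) (zterm_norm a r n k).
Proof.
move=> r0 n0; apply: wiener_gbin => //.
have L0 : 0 <= ln n%:R :> R by rewrite ln_ge0// ler1n.
have H := wienerZ (cexp ((1 - k%:R) * (ln n%:R)%:C)) (wiener_exp a (- ln n%:R) r0).
apply: (wiener_le _ (wiener_ext _ H)); last first.
  by move=> z _; rewrite -cexpD rmorphN /=; congr cexp; ring.
rewrite cmod_cexp normrN ger0_norm// -expRD ler_expR.
have -> : (1 - k%:R : C) = (1 - k%:R)%:C by rewrite rmorphB rmorph1 rmorph_nat.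
by rewrite /= mulr0 subr0; lra.
Qed.

(** The hypothesis makes the power of [n] in the bound of order [K + 1 + k] at most
[n ^ (- 2 - k)].  The factor [n ^ (- 2)] is kept for the sum over [n], and
[n ^ (- k) <= 2 ^ (- k)] against the growth [(3 / 2) ^ k] of the coefficients
leaves the ratio [3 / 4]. *)
Lemma zterm_norm_sum a r K : 0 <= r -> 2 <= Re a - r + K%:R ->
  exists2 S : R, 0 <= S & forall n N, (2 <= n)%N ->
    \sum_(0 <= k < N) zterm_norm a r n (K.+1 + k) <= S * n%:R ^- 2.
Proof.
move=> r0 aK; have A0 : 0 <= r + cmod (1 - a) by rewrite addr_ge0// cmod_ge0.
have [D D0 HD] := rising_le A0.
pose S := D * (3 / 2) ^+ K.+1 * 4.
have S0 : 0 <= S by rewrite mulr_ge0// mulr_ge0// exprn_ge0//; lra.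
exists S => // n N n2.
have n0 : 0 < n%:R :> R by rewrite ltr0n (leq_trans _ n2).
have nn2 : 2 <= n%:R :> R by rewrite ler_nat.
have L0 : 0 <= ln n%:R :> R by rewrite ln_ge0//; lra.
have term k : zterm_norm a r n (K.+1 + k) <=
    D * (3 / 2) ^+ K.+1 * n%:R ^- 2 * (3 / 4) ^+ k.
  have -> : (3 / 4 : R) = 3 / 2 * 2^-1 by field.
  rewrite (exprMn _ (3 / 2)).
  have -> : D * (3 / 2) ^+ K.+1 * n%:R ^- 2 * ((3 / 2) ^+ k * 2^-1 ^+ k) =
    (D * (3 / 2) ^+ (K.+1 + k)) * (n%:R ^- 2 * 2^-1 ^+ k) by rewrite exprD; ring.
  apply: ler_pM; rewrite ?rising_ge0 ?expR_ge0//.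
  rewrite (@le_trans _ _ (n%:R ^- 2 * n%:R ^- k))//; last first.
    rewrite ler_wpM2l ?invr_ge0 ?exprn_ge0// ?(ltW n0)// -exprVn.
    by rewrite lerXn2r ?nnegrE ?invr_ge0 ?(ltW n0)// lef_pV2 ?posrE.
  rewrite -invfM -exprD -{2}(lnK n0) -expRM_natl -expRN ler_expR natrD natrD.
  rewrite -mulNr ler_wpM2r// -[K.+1%:R]natr1; lra.
rewrite (le_trans (ler_sum _ (fun k _ => term k)))// -mulr_sumr.
have -> : S * n%:R ^- 2 = D * (3 / 2) ^+ K.+1 * n%:R ^- 2 * 4.
  by rewrite /S; ring.
rewrite ler_wpM2l//.
  by rewrite mulr_ge0 ?invr_ge0 ?exprn_ge0 ?(ltW n0)// mulr_ge0// exprn_ge0//; lra.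
have h : (1 - 3 / 4)^-1 = 4 :> R by field.
by rewrite -[leRHS]h; apply: geometric_sum_le; lra.
Qed.

Lemma sum_inv_sqr_le N : \sum_(0 <= m < N) (m.+2%:R : R) ^- 2 <= 1.
Proof.
suff : \sum_(0 <= m < N) (m.+2%:R : R) ^- 2 <= 1 - N.+1%:R^-1.
  by move=> /le_trans; apply; rewrite gerBl invr_ge0.
elim: N => [|N IH]; first by rewrite big_geq// invr1 subrr.
rewrite big_nat_recr//= (le_trans (lerD IH (lexx _)))//.
have x0 : 0 < N.+1%:R :> R by rewrite ltr0n.
rewrite -[N.+2%:R]natr1; move: (N.+1%:R) x0 => x x0.
have x1 : 0 < x + 1 by rewrite ltr_pwDr// ltW.
rewrite -subr_ge0 (_ : _ - _ = (x * (x + 1) ^+ 2)^-1).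
  by rewrite invr_ge0 mulr_ge0// ?exprn_ge0// ltW.
by field; rewrite !gt_eqF.
Qed.

Definition ztail K (n : nat) (s : C) : C := csum (fun k => zterm n (K.+1 + k) s).

(** The sum starts with [n = 2]: for [n = 1] the binomial series sits on the boundary
of its disc of convergence. *)
Definition zrem K (s : C) : C := csum (fun m => ztail K m.+2 s).

Lemma wiener_ztail a r K : 0 < r -> 2 <= Re a - r + K%:R ->
  exists2 S : R, 0 <= S & forall n, (2 <= n)%N ->
    wiener a r (ztail K n) (S * n%:R ^- 2).
Proof.
move=> r0 aK; have [S S0 HS] := zterm_norm_sum (ltW r0) aK.
exists S => // n n2.
apply: (@wiener_csum _ _ _ _ (fun k => zterm_norm a r n (K.+1 + k))) => // [k|N].
  by apply: wiener_zterm; [exact: ltW|rewrite (leq_trans _ n2)].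
exact: HS.
Qed.

Lemma sum_ztail_le (S : R) N : 0 <= S ->
  \sum_(0 <= m < N) S * (m.+2%:R : R) ^- 2 <= S.
Proof.
by move=> S0; rewrite -mulr_sumr ler_piMr// sum_inv_sqr_le.
Qed.

Lemma holo_zrem a K : 2 < Re a + K%:R -> holo (zrem K) a.
Proof.
move=> aK; have r0 : 0 < Re a + K%:R - 2 by rewrite subr_gt0.
have [|S S0 HS] := @wiener_ztail a _ K r0; first lra.
exists (Re a + K%:R - 2), S; split=> //.
apply: (@wiener_csum _ _ _ _ (fun m => S * m.+2%:R ^- 2)) => // [m|N].
  exact: HS.
exact: sum_ztail_le.
Qed.

Lemma csum0 (u : nat -> C) : (forall k, u k = 0) -> csum u = 0.
Proof.
move=> u0; have H : forall n, \sum_(0 <= k < n) cmod (u k) <= 0.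
  by move=> n; rewrite big1// => k _; rewrite u0 Normc.normc0.
apply: (clim_unique (csumP H)).
rewrite (_ : (fun _ => _) = fun=> 0); first exact: clim_cst.
by apply/funext => n; rewrite big1.
Qed.

(** At [s = 1 - p] the binomial coefficients of order greater than [p] vanish. *)
Lemma zrem0 K p : (p <= K)%N -> zrem K (1 - p%:R) = 0.
Proof.
move=> pK; apply: csum0 => m; apply: csum0 => k.
rewrite /zterm opprB addrCA subrr addr0 gbin_nat bin_small ?mul0r//.
by rewrite addSn ltnS (leq_trans pK)// leq_addr.
Qed.

End Zeta.

Section ZetaContinuation.
Local Open Scope complex_scope.
Context {R : realType}.
Local Notation C := R[i].
Local Notation Re := (@complex.Re R).
Local Notation Im := (@complex.Im R).
Local Notation cmod := (@Normc.normc R).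

(** This is [n ^ (1 - s)]. *)
Definition zpow (n : nat) (s : C) : C := cexp ((1 - s) * (ln n%:R)%:C).

Lemma natC k : (k%:R : C) = (k%:R : R)%:C.
Proof. by rewrite rmorph_nat. Qed.

Lemma clim_real (u : nat -> R) (l : R) : u @ \oo --> l ->
  clim (fun n => (u n)%:C) l%:C.
Proof.
move=> ul; rewrite /clim (_ : (fun _ => _) = fun n => `|u n - l|); last first.
  by apply/funext => n; rewrite -rmorphB cmod_real.
exact/norm_cvg0P/subr_cvg0.
Qed.

Lemma clim_zterm (s : R) n : 1 < s -> (2 <= n)%N ->
  clim (fun N => \sum_(0 <= k < N) zterm n k s%:C) (zpow n.+1 s%:C).
Proof.
move=> s1 n2.
have n0 : 0 < n%:R :> R by rewrite ltr0n (leq_trans _ n2).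
have u2 : n%:R^-1 <= 2^-1 :> R by rewrite lef_pV2 ?posrE// ler_nat.
have s0 : 1 - s <= 0 by lra.
have := binomial_series s0 (ltW _) u2; rewrite invr_gt0 => /(_ n0) H.
have {}H := climZ (expR ((1 - s) * ln n%:R))%:C (clim_real H).
move: H; rewrite -rmorphM /= /powR gt_eqF ?addr_gt0 ?invr_gt0// -expRD.
have -> : (1 - s) * ln n%:R + (1 - s) * ln (1 + n%:R^-1) = (1 - s) * ln n.+1%:R :> R.
  rewrite -mulrDr -lnM ?posrE ?addr_gt0 ?invr_gt0//; congr (_ * ln _).
  by rewrite mulrDr mulr1 divff ?gt_eqF// natr1.
rewrite /zpow -[1 - s%:C]/(1%:C - s%:C) -rmorphB -rmorphM cexp_real.
rewrite (_ : (fun _ => _) = (fun N => \sum_(0 <= k < N) zterm n k s%:C))//.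
apply/funext => N; rewrite rmorph_sum mulr_sumr; apply: eq_bigr => k _.
rewrite /zterm -[1 - s%:C]/(1%:C - s%:C) natC -rmorphB gbin_complex.
rewrite -[1 - k%:R%:C]/(1%:C - k%:R%:C) -!rmorphB -[_ * (ln _)%:C]rmorphM.
rewrite cexp_real -!rmorphM /=; congr (_%:C).
have -> : (1 - k%:R - s) * ln n%:R = (1 - s) * ln n%:R + - (k%:R * ln n%:R) :> R.
  by ring.
by rewrite expRD expRN expRM_natl lnK ?posrE// exprVn; ring.
Qed.

Lemma ztailE (s : R) n K : 1 < s -> (1 <= K)%N -> (2 <= n)%N ->
  ztail K n s%:C = zpow n.+1 s%:C - \sum_(0 <= k < K.+1) zterm n k s%:C.
Proof.
move=> s1 K1 n2.
have sK : 2 <= Re s%:C - 0 + K%:R by have := K1; rewrite -(ler_nat R) /=; lra.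
have [S S0 HS] := zterm_norm_sum (lexx 0) sK.
have bd : forall N, \sum_(0 <= k < N) cmod (zterm n (K.+1 + k) s%:C) <= S * n%:R ^- 2.
  move=> N; rewrite (le_trans _ (HS n N n2))//; apply: ler_sum => k _.
  apply: (wiener_bound (wiener_zterm _ _ (lexx 0) _)).
    by rewrite (leq_trans _ n2).
  by rewrite subrr Normc.normc0.
apply: clim_unique (csumP bd) _.
have H := (clim_shift _ _ K.+1).2 (clim_zterm s1 n2).
have := climD H (clim_cst (- \sum_(0 <= k < K.+1) zterm n k s%:C)).
rewrite (_ : (fun _ => _ + - _) =
  (fun N => \sum_(0 <= k < N) zterm n (K.+1 + k) s%:C))//.
apply/funext => N; rewrite (big_cat_nat (n := K.+1))//= ?leq_addl//.
rewrite addrAC subrr add0r -{1}[K.+1]add0n big_addn addnK.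
by apply: eq_bigr => k _; rewrite addnC.
Qed.

Lemma clim_zpow (s : R) : 1 < s -> clim (fun n => zpow n.+2 s%:C) 0.
Proof.
move=> s1.
have cs (n : nat) : zpow n.+2 s%:C = (expR (- ((s - 1) * ln n.+2%:R)))%:C.
  rewrite /zpow -[1 - s%:C]/(1%:C - s%:C) -rmorphB -rmorphM cexp_real.
  by congr (expR _)%:C; ring.
rewrite (_ : (fun _ => _) = fun n : nat => (expR (- ((s - 1) * ln n.+2%:R)))%:C); last first.
  by apply/funext.
by apply: (@clim_real _ 0); apply: cvg_powN; rewrite subr_gt0.
Qed.

Context (zeta : C -> C) (hzeta : is_riemann_zeta zeta).

Lemma zeta_series (s : R) (k : nat) : 1 < s -> (1 <= k)%N ->
  clim (fun M => \sum_(0 <= m < M) cexp ((1 - k%:R - s%:C) * (ln m.+2%:R)%:C))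
       (zeta (s%:C + k%:R - 1) - 1).
Proof.
move=> s1 k1.
have k1R : 1 <= k%:R :> R by rewrite ler1n.
have := (proj2 hzeta) (s%:C + k%:R - 1) _.
have -> : s%:C + k%:R - 1 = (s + k%:R - 1)%:C.
  by rewrite natC -[s%:C + _ - 1]/(s%:C + k%:R%:C - 1%:C) -rmorphD -rmorphB.
move=> /(_ _)/cvg_clim H.
have {}H : clim (series (fun n => cexp (- (s + k%:R - 1)%:C * (ln n.+1%:R)%:C)))
   (zeta (s + k%:R - 1)%:C) by apply: H; rewrite /=; lra.
have := climD ((clim_shift _ _ 1).2 H) (clim_cst (-1)).
rewrite (_ : (fun _ => _ + - _) = (fun M =>
  \sum_(0 <= m < M) cexp ((1 - k%:R - s%:C) * (ln m.+2%:R)%:C)))//.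
apply/funext => M; rewrite /series /= addn1 big_nat_recl// ln1 mulr0.
rewrite -[cexp 0%:C]/(cexp (0 : R)%:C) cexp_real expR0 addrAC subrr add0r.
have -> // : - (s + k%:R - 1)%:C = 1 - k%:R - s%:C :> C.
by rewrite rmorphB rmorphD rmorph_nat rmorph1; ring.
Qed.

(** Sum the binomial expansions over [n]: the powers [(n + 1) ^ (1 - s)] and the
terms of order [0] telescope to [- 2 ^ (1 - s)], and order [k] yields a
coefficient times [zeta (s + k - 1) - 1]. *)
Lemma zrem_real (s : R) K : 1 < s -> (1 <= K)%N ->
  zrem K s%:C = - zpow 2 s%:C -
    \sum_(1 <= k < K.+1) gbin (1 - s%:C) k * (zeta (s%:C + k%:R - 1) - 1).
Proof.
move=> s1 K1.
have sK : 2 <= Re s%:C - 0 + K%:R by have := K1; rewrite -(ler_nat R) /=; lra.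
have [S S0 HS] := zterm_norm_sum (lexx 0) sK.
have bd N : \sum_(0 <= m < N) cmod (ztail K m.+2 s%:C) <= S.
  rewrite (le_trans _ (sum_ztail_le N S0))//; apply: ler_sum => m _.
  rewrite -[ztail _ _ _]subr0; apply: (clim_le (csumP (M := S * m.+2%:R ^- 2) _)).
    move=> n; rewrite (le_trans _ (HS m.+2 n _))//; apply: ler_sum => k _.
    apply: (wiener_bound (wiener_zterm _ _ (lexx 0) _)) => //.
    by rewrite subrr Normc.normc0.
  near=> n; rewrite subr0 (le_trans (cmod_sum _ _))// (le_trans _ (HS m.+2 n _))//.
  apply: ler_sum => k _; apply: (wiener_bound (wiener_zterm _ _ (lexx 0) _)) => //.
  by rewrite subrr Normc.normc0.
apply: clim_unique (csumP bd) _.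
pose F k (M : nat) := gbin (1 - s%:C) k *
  \sum_(0 <= m < M) cexp ((1 - k%:R - s%:C) * (ln m.+2%:R)%:C).
have HF : clim (fun M => \sum_(1 <= k < K.+1) F k M)
    (\sum_(1 <= k < K.+1) gbin (1 - s%:C) k * (zeta (s%:C + k%:R - 1) - 1)).
  have := @clim_sum _ (fun k => F k.+1)
    (fun k => gbin (1 - s%:C) k.+1 * (zeta (s%:C + k.+1%:R - 1) - 1)) K.
  rewrite big_add1 /= (_ : (fun M => \sum_(1 <= k < K.+1) F k M) =
    (fun M => \sum_(0 <= k < K) F k.+1 M)).
    by apply=> k; apply: climZ; exact: zeta_series.
  by apply/funext => M; rewrite big_add1.
have := climD (climD (clim_zpow s1) (clim_cst (- zpow 2 s%:C))) (climZ (-1) HF).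
rewrite add0r mulN1r.
rewrite (_ : (fun _ => _ + _) = (fun M => \sum_(0 <= m < M) ztail K m.+2 s%:C))//.
apply/funext => M.
under [RHS]eq_bigr do rewrite ztailE//.
rewrite sumrB [X in _ = _ - X]exchange_big/= [X in _ = _ - X]big_nat_recl//.
rewrite opprD addrA; congr (_ + _).
  have -> : \sum_(0 <= m < M) zterm m.+2 0 s%:C = \sum_(0 <= m < M) zpow m.+2 s%:C.
    by apply: eq_bigr => m _; rewrite /zterm gbin0 mul1r subr0.
  by rewrite -sumrB telescope_sumr.
rewrite mulN1r; congr (- _); rewrite big_add1 /=; apply: eq_bigr => k _.
by rewrite /F mulr_sumr.
Unshelve. all: by end_near. Qed.

(** It vanishes for real [s > 1] by [zrem_real], and is holomorphic for
[Re s > 2 - K] off the possible poles [2 - k], [1 <= k <= K]. *)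
Definition zcheck K (s : C) : C :=
  zpow 2 s + \sum_(1 <= k < K.+1) gbin (1 - s) k * (zeta (s + k%:R - 1) - 1)
  + zrem K s.

Lemma zcheck_real (s : R) K : 1 < s -> (1 <= K)%N -> zcheck K s%:C = 0.
Proof. by move=> s1 K1; rewrite /zcheck zrem_real// addrACA subrr add0r subrr. Qed.

Lemma holo_gbin (f : C -> C) (a : C) k : holo f a -> holo (fun s => gbin (1 - s) k * f s) a.
Proof.
move=> [r [M [r0 H]]]; exists r; eexists; split=> //.
exact: wiener_gbin (ltW r0) H.
Qed.

Lemma holo_zpow n (a : C) : holo (zpow n) a.
Proof.
have H := holoZ (cexp (ln n%:R)%:C) (holo_exp (- ln n%:R) a).
by apply: holo_ext H => z; rewrite /zpow -cexpD rmorphN; congr cexp; ring.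
Qed.

Lemma holo_zeta_shift (a : C) k : a + k%:R - 1 != 1 ->
  holo (fun s => zeta (s + k%:R - 1) - 1) a.
Proof.
move=> ak; apply: holoD; last exact: holo_cst.
have := analytic_at_holo ((proj1 hzeta) _ ak); rewrite -addrA => /holo_shift.
by apply: holo_ext => z; rewrite addrA.
Qed.

Lemma holo_zcheck K (a : C) : 2 < Re a + K%:R ->
  (forall k, (1 <= k < K.+1)%N -> a + k%:R - 1 != 1) -> holo (zcheck K) a.
Proof.
move=> aK ak; apply: holoD; last exact: holo_zrem.
apply: holoD; first exact: holo_zpow.
apply: holo_sum => k kK; apply: holo_gbin; apply: holo_zeta_shift; exact: ak.
Qed.

Lemma real_pole (y : R) k : y + k%:R != 2 -> y%:C + k%:R - 1 != 1 :> C.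
Proof.
apply: contra; rewrite natC eq_complex /= => /andP[/eqP h _].
by apply/eqP; lra.
Qed.

(** The possible poles are real, hence avoided by the path from [2] to [2 + i] to
[x], except perhaps at its end points. *)
Lemma zcheck_continued (x : R) K : 2 < x + K%:R -> (1 <= K)%N ->
  (forall k : nat, x + k%:R != 2) -> zcheck K x%:C = 0.
Proof.
move=> xK K1 xk.
have K1R : 1 <= K%:R :> R by rewrite ler1n.
have im0 (y z : R) k : z != 0 -> (y +i* z) + k%:R - 1 != 1 :> C.
  move=> z0; rewrite natC eq_complex /= negb_and; apply/orP; right.
  by rewrite addr0 subr0.
have H2 : exists2 e : R, 0 < e & forall z, cmod (z - 2%:R%:C) <= e -> zcheck K z = 0.
  have [|k kK|r [M [r0 H]]] := @holo_zcheck K 2%:R%:C.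
  - by rewrite /=; lra.
  - apply: real_pole; have : 1 <= k%:R :> R by rewrite ler1n; case/andP: kK.
    by move=> ?; apply/eqP; lra.
  exists r => //; apply: (wiener_identity r0 H) => e e0.
  exists (2 + e)%:C; split.
  - by rewrite (inj_eq (@complexI R)); apply/eqP; lra.
  - by rewrite -rmorphB addrAC subrr add0r cmod_real gtr0_norm.
  - by apply: zcheck_real => //; lra.
have seg1 (t : R) : 2%:R%:C + t%:C * ((2 +i* 1) - 2%:R%:C) = 2 +i* t :> C.
  by apply/eqP; rewrite eq_complex /=; apply/andP; split; apply/eqP; ring.
have H3 : exists2 e : R, 0 < e & forall z, cmod (z - (2 +i* 1)) <= e -> zcheck K z = 0.
  apply: (holo_identity_segment _ H2) => t /andP[t0 t1]; rewrite seg1.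
  have [->|t_neq0] := eqVneq t 0.
    apply: holo_zcheck => [|k kK]; first by rewrite /=; lra.
    apply: (@real_pole 2); have : 1 <= k%:R :> R by rewrite ler1n; case/andP: kK.
    by move=> ?; apply/eqP; lra.
  by apply: holo_zcheck => [|k kK]; [rewrite /=; lra|exact: im0].
have seg2 (t : R) : (2 +i* 1) + t%:C * (x%:C - (2 +i* 1)) =
    (2 + t * (x - 2)) +i* (1 - t) :> C.
  by apply/eqP; rewrite eq_complex /=; apply/andP; split; apply/eqP; ring.
have [e e0 He] : exists2 e : R, 0 < e & forall z, cmod (z - x%:C) <= e -> zcheck K z = 0.
  apply: (holo_identity_segment _ H3) => t /andP[t0 t1]; rewrite seg2.
  have [->|t_neq1] := eqVneq t 1.
    apply: holo_zcheck => [|k kK]; first by rewrite /=; lra.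
    rewrite subrr (_ : 2 + 1 * (x - 2) = x); last by ring.
    exact: (@real_pole x).
  apply: holo_zcheck => [|k kK]; last by apply: im0; rewrite subr_eq0 eq_sym.
  by rewrite /=; nra.
by apply: He; rewrite subrr Normc.normc0 ltW.
Qed.

End ZetaContinuation.

Section ZetaValues.
Local Open Scope complex_scope.
Context {R : realType}.
Local Notation C := R[i].
Local Notation cmod := (@Normc.normc R).

Lemma climM (u v : nat -> C) (l m : C) :
  clim u l -> clim v m -> clim (fun n => u n * v n) (l * m).
Proof.
move=> ul vm; apply: (clim_squeeze _ (v := fun n =>
  cmod (u n - l) * cmod (v n - m) + (cmod l * cmod (v n - m) + cmod m * cmod (u n - l)))).
  near=> n.
  have -> : u n * v n - l * m = (u n - l) * (v n - m) + (l * (v n - m) + m * (u n - l)).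
    by ring.
  by rewrite (le_trans (cmodD _ _))// cmodM lerD2l (le_trans (cmodD _ _))// !cmodM.
have c0 (c : R) (w : nat -> R) : w @ \oo --> (0 : R) -> c * w n @[n --> \oo] --> (0 : R).
  by move=> w0; rewrite -[X in _ --> X](mulr0 c); apply: cvgM => //; exact: cvg_cst.
rewrite -[X in _ --> X](addr0 0); apply: cvgD.
  by rewrite -[X in _ --> X](mulr0 0); exact: cvgM.
by rewrite -[X in _ --> X](addr0 0); apply: cvgD; exact: c0.
Unshelve. all: by end_near. Qed.

Lemma clim_holo (f : C -> C) (a : C) : holo f a ->
  clim (fun n => f (a + (small n)%:C)) (f a).
Proof.
move=> fa; apply/cvgrPdist_le => e e0.
have [d d0 Hd] := holo_continuous fa e0.
have /cvgrPdist_le /(_ d d0) := @cvg_small R; apply: filterS => n.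
rewrite !sub0r !normrN => sd; rewrite [X in X <= _]ger0_norm ?cmod_ge0//.
by apply: Hd; rewrite addrAC subrr add0r cmod_real.
Qed.

Context (zeta : C -> C) (hzeta : is_riemann_zeta zeta).

(** In the relation for [K = 2], the term of order [1] is
[- (s - 1) (zeta s - 1)]; the others are holomorphic at [1], where their sum
is [1]. *)
Lemma zeta_residue :
  clim (fun n => (small n)%:C * (zeta (1 + (small n)%:C) - 1)) 1.
Proof.
pose G (s : C) := zpow 2 s + gbin (1 - s) 2 * (zeta (s + 2%:R - 1) - 1) + zrem 2 s.
have hG : holo G 1.
  apply: holoD; last by apply: holo_zrem; rewrite /=; lra.
  apply: holoD; first exact: holo_zpow.
  apply: holo_gbin; apply: (holo_zeta_shift hzeta).
  by apply: (@real_pole _ 1); apply/eqP; lra.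
have G1 : G 1 = 1.
  rewrite /G /zpow subrr mul0r -[cexp 0%:C]/(cexp (0 : R)%:C).
  have -> : zrem 2 1 = 0 :> C by rewrite -[X in zrem _ X](subr0 1) (zrem0 (p := 0)).
  rewrite -[X in gbin X](mulr0n 1) (gbin_nat 0) bin_small// mul0r.
  by rewrite cexp_real expR0 !addr0.
rewrite -[X in clim _ X]G1; have := clim_holo hG.
rewrite (_ : (fun n => G _) = (fun n => (small n)%:C * (zeta (1 + (small n)%:C) - 1)))//.
apply/funext => n.
have := zcheck_real hzeta (s := 1 + small n) (K := 2) _ isT.
rewrite ltrDl small_gt0 => /(_ isT).
rewrite rmorphD rmorph1 /zcheck big_nat_recr//= big_nat1 /G.
set s := 1 + (small n)%:C; have -> : gbin (1 - s) 1 = - (small n)%:C.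
  by rewrite gbinS gbin0 /s; field.
rewrite addrK => /eqP h; apply/eqP; rewrite -subr_eq0 -(eqP h); apply/eqP; ring.
Qed.

(** At [s = - m] the binomial coefficients of order greater than [m + 1] vanish,
but the one of order [m + 2] is multiplied by the pole of [zeta] at [1].  So the
relation [zcheck = 0] is taken at [- m + 1 / (n + 2)] and passed to the limit,
where [zeta_residue] turns this term into a constant. *)
Lemma zeta_recurrence m :
  \sum_(0 <= j < m.+1) 'C(m.+1, j)%:R * zeta (- j%:R) = m.+2%:R^-1 - 1.
Proof.
pose K := m.+3.
pose G (s : C) := zpow 2 s +
  \sum_(1 <= k < m.+2) gbin (1 - s) k * (zeta (s + k%:R - 1) - 1) +
  gbin (1 - s) K * (zeta (s + K%:R - 1) - 1) + zrem K s.
have natK : K%:R = m%:R + 3 :> R by rewrite /K -addn3 natrD.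
pose a : C := - m%:R.
have aE : a = (- m%:R)%:C by rewrite /a natC rmorphN.
have hG : holo G a.
  apply: holoD; last by apply: holo_zrem; rewrite aE natK /=; lra.
  apply: holoD.
    apply: holoD; first exact: holo_zpow.
    apply: holo_sum => k /andP[_ km]; apply: holo_gbin.
    apply: (holo_zeta_shift hzeta); rewrite aE; apply: real_pole.
    apply/eqP => h; have : k%:R <= m%:R + 1 :> R by rewrite natr1 ler_nat.
    lra.
  apply: holo_gbin; apply: (holo_zeta_shift hzeta); rewrite aE.
  by apply: real_pole; rewrite natK; apply/eqP; lra.
have a1 : 1 - a = m.+1%:R by rewrite /a opprK addrC natr1.
have Ga : G a = 2 ^+ m.+1 +
    \sum_(1 <= k < m.+2) 'C(m.+1, k)%:R * (zeta (a + k%:R - 1) - 1).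
  rewrite /G a1 gbin_nat bin_small ?mul0r// addr0.
  have -> : zrem K a = 0.
    rewrite (_ : a = 1 - m.+1%:R); last by rewrite -a1; ring.
    by apply: zrem0; rewrite /K; lia.
  rewrite addr0; congr (_ + _); last by apply: eq_bigr => k _; rewrite gbin_nat.
  rewrite /zpow a1 (natC m.+1) -rmorphM cexp_real expRM_natl lnK ?posrE//.
  by rewrite rmorphXn rmorph_nat.
have lim1 : clim (fun n => G (a + (small n)%:C)) (m.+2%:R^-1).
  have hb : holo (fun s => gbin (1 - s) m.+1 * (m.+2%:R^-1 : C)) a.
    exact/holo_gbin/holo_cst.
  have := climM (clim_holo hb) zeta_residue.
  rewrite a1 gbin_nat binn mul1r mulr1.
  rewrite (_ : (fun _ => _ * _) = (fun n => G (a + (small n)%:C)))//.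
  apply/funext => n; set e := (small n)%:C.
  have := zcheck_continued hzeta (x := - m%:R + small n) (K := K) _ isT.
  rewrite natK => /(_ _ _) h.
  have {}h : zcheck zeta K (a + e) = 0.
    rewrite aE /e -rmorphD; apply: h; first by have := small_gt0 (R := R) n; lra.
    move=> k; apply/eqP => h; have e0 := small_gt0 (R := R) n; have e1 := small_lt1 (R := R) n.
    have : small n = m.+2%:R - k%:R :> R by rewrite -natr1 -natr1; lra.
    have [mk|km] := leqP m.+2 k.
      have : m.+2%:R <= k%:R :> R by rewrite ler_nat.
      lra.
    have : k.+1%:R <= m.+2%:R :> R by rewrite ler_nat.
    rewrite -natr1; lra.
  move: h; rewrite /zcheck big_nat_recr//= big_nat_recr//= /G.
  set s := a + e; have -> : gbin (1 - s) m.+2 = gbin (1 - s) m.+1 * (- e / m.+2%:R).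
    by rewrite gbinS /s opprD addrA a1 addrAC subrr add0r.
  have -> : s + m.+2%:R - 1 = 1 + e.
    by rewrite /s /a -natr1 -natr1; ring.
  set S := \sum_(_ <= _ < _) _; set T := _ * (zeta (s + K%:R - 1) - 1).
  set Z := zeta (1 + e) - 1; set g := gbin _ _; set i2 := _^-1.
  move=> h; rewrite -[LHS]add0r -h; ring.
have := clim_unique (clim_holo hG) lim1; rewrite Ga => {lim1 hG Ga} H.
have E : \sum_(1 <= k < m.+2) 'C(m.+1, k)%:R * (zeta (a + k%:R - 1) - 1) =
    \sum_(0 <= j < m.+1) 'C(m.+1, j)%:R * zeta (- j%:R) - (2 ^+ m.+1 - 1).
  rewrite big_add1 /= big_nat_rev /= add0n.
  have -> : (2 ^+ m.+1 - 1 : C) = \sum_(0 <= j < m.+1) 'C(m.+1, j)%:R.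
    have := exprDn (1 : C) 1 m.+1; rewrite big_ord_recr /= binn expr1n mulr1 => ->.
    rewrite expr1n mulr1n addrK big_mkord; apply: eq_bigr => i _.
    by rewrite !expr1n mulr1.
  rewrite -sumrB; apply: eq_big_nat => j /andP[_ jm].
  have -> : ((m.+1 - j.+1).+1 = m.+1 - j)%N by lia.
  rewrite bin_sub ?(ltnW jm)// mulrBr mulr1.
  have -> // : a + (m.+1 - j)%:R - 1 = - j%:R.
  by rewrite natrB ?(ltnW jm)// /a -natr1; ring.
by move: H; rewrite E => <-; ring.
Qed.

End ZetaValues.

(** * Expansions at the origin *)

Section Expansion.
Context {R : realType}.
Implicit Types (f g : R -> R) (c d : nat -> R).

(** Asymptotic expansion at the origin to order [n], regardless of the value at
[0]: the generating function of the Bernoulli polynomials has a removable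
singularity there. *)
Definition expand n f c := exists C e : R, [/\ 0 <= C, 0 < e &
  forall t, t != 0 -> `|t| < e ->
    `|f t - \sum_(0 <= k < n) c k * t ^+ k| <= C * `|t| ^+ n].

Lemma expand_ext n f g c : (forall t, t != 0 -> f t = g t) ->
  expand n f c -> expand n g c.
Proof.
move=> fg [C [e [C0 e0 H]]]; exists C, e; split=> // t t0 te.
by rewrite -fg//; exact: H.
Qed.

Lemma expandB n f g c d : expand n f c -> expand n g d ->
  expand n (fun t => f t - g t) (fun k => c k - d k).
Proof.
move=> [C [e [C0 e0 Hf]]] [D [e' [D0 e'0 Hg]]].
exists (C + D), (Num.min e e'); split; rewrite ?addr_ge0//.
  by rewrite lt_min e0.
move=> t t0; rewrite lt_min => /andP[te te'].
have -> : f t - g t - \sum_(0 <= k < n) (c k - d k) * t ^+ k =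
  (f t - \sum_(0 <= k < n) c k * t ^+ k) - (g t - \sum_(0 <= k < n) d k * t ^+ k).
  under eq_bigr do rewrite mulrBl.
  by rewrite sumrB; ring.
by rewrite (le_trans (ler_normB _ _))// mulrDl lerD ?Hf ?Hg.
Qed.

(** Were [c k] the first nonzero coefficient, it would be bounded by a multiple of
[t] for all small [t]. *)
Lemma expand_eq0 n f c : (forall t, t != 0 -> f t = 0) -> expand n f c ->
  forall k, (k < n)%N -> c k = 0.
Proof.
move=> f0 [C [e [C0 e0 H]]] k; elim/ltn_ind: k => k IH kn.
pose D := \sum_(k.+1 <= j < n) `|c j| + C.
have D0 : 0 <= D by rewrite addr_ge0// sumr_ge0.
have bound t : 0 < t -> t < e -> t <= 1 -> `|c k| <= t * D.
  move=> t0 te t1; have := H t; rewrite gt_eqF// gtr0_norm// f0 ?gt_eqF// sub0r.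
  rewrite normrN => /(_ isT te).
  rewrite (big_cat_nat (n := k))//=; last exact: ltnW.
  rewrite big1_seq ?add0r; last first.
    by move=> j /= /[!mem_index_iota] /andP[_ jk]; rewrite IH ?mul0r// (ltn_trans jk).
  rewrite big_ltn// => h.
  have h1 : `|c k * t ^+ k| <= `|c k * t ^+ k + \sum_(k.+1 <= j < n) c j * t ^+ j|
      + `|\sum_(k.+1 <= j < n) c j * t ^+ j|.
    by rewrite -{1}[c k * _](addrK (\sum_(k.+1 <= j < n) c j * t ^+ j)) ler_normB.
  have h2 : `|\sum_(k.+1 <= j < n) c j * t ^+ j| <=
      \sum_(k.+1 <= j < n) `|c j| * t ^+ k.+1.
    rewrite (le_trans (ler_norm_sum _ _ _))//; apply: ler_sum_nat => j /andP[kj _].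
    by rewrite normrM normrX (gtr0_norm t0) ler_wpM2l// ler_wiXn2l// ltW.
  have h3 : C * t ^+ n <= C * t ^+ k.+1 by rewrite ler_wpM2l// ler_wiXn2l// ltW.
  have {h1} : `|c k| * t ^+ k <= t * D * t ^+ k.
    rewrite -[X in _ * X <= _](gtr0_norm (exprn_gt0 k t0)) -normrM.
    rewrite (le_trans h1)// (le_trans (lerD (le_trans h h3) h2))//.
    by rewrite /D -mulr_suml exprS; lra.
  by rewrite ler_pM2r ?exprn_gt0.
apply/eqP/negPn/negP => ck; have ck0 : 0 < `|c k| by rewrite normr_gt0.
pose t := Num.min (Num.min (e / 2) 1) (`|c k| / (2 * (D + 1))).
have D1 : 0 < D + 1 by lra.
have t0 : 0 < t by rewrite !lt_min divr_gt0//= ltr01 divr_gt0// mulr_gt0.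
have te : t < e.
  by rewrite (@le_lt_trans _ _ (e / 2)) ?ge_min ?lexx//; lra.
have t1 : t <= 1 by rewrite !ge_min lexx orbT.
have := bound t t0 te t1; apply/negP; rewrite -ltNge.
rewrite (@le_lt_trans _ _ (t * (D + 1)))//; first by rewrite ler_wpM2l ?ltW//; lra.
have : t <= `|c k| / (2 * (D + 1)) by rewrite /t ge_min lexx orbT.
rewrite ler_pdivlMr ?mulr_gt0// => h; lra.
Qed.

Lemma expand_unique n f c d : expand n f c -> expand n f d ->
  forall k, (k < n)%N -> c k = d k.
Proof.
move=> fc fd k kn; apply/eqP; rewrite -subr_eq0; apply/eqP.
by apply: (expand_eq0 _ (expandB fc fd)) => // t _; rewrite subrr.
Qed.

Lemma expand_bounded n f c : expand n f c -> exists C e : R, [/\ 0 <= C, 0 < e &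
  forall t, t != 0 -> `|t| < e -> `|f t| <= C].
Proof.
move=> [C [e [C0 e0 H]]].
exists (C + \sum_(0 <= k < n) `|c k|), (Num.min e 1); split.
- by rewrite addr_ge0// sumr_ge0.
- by rewrite lt_min e0 ltr01.
move=> t t0; rewrite lt_min => /andP[te t1].
rewrite -[f t](subrK (\sum_(0 <= k < n) c k * t ^+ k)) (le_trans (ler_normD _ _))//.
apply: lerD.
  by rewrite (le_trans (H t t0 te))// ler_piMr// exprn_ile1// ltW.
rewrite (le_trans (ler_norm_sum _ _ _))//; apply: ler_sum => k _.
by rewrite normrM normrX ler_piMr// exprn_ile1// ltW.
Qed.

(** The product of two expansions to order [n]: the truncations multiply as
polynomials, up to a polynomial multiple of [t ^+ n]. *)
Lemma expandM n f g c d : expand n f c -> expand n g d ->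
  expand n (fun t => f t * g t)
    (fun k => \sum_(0 <= i < k.+1) c i * d (k - i)%N).
Proof.
move=> fc gd.
have [Cg [eg [Cg0 eg0 Hg]]] := expand_bounded gd.
have [C [e [C0 e0 Hf]]] := fc; have [D [e' [D0 e'0 Hgd]]] := gd.
pose P := \poly_(i < n) c i; pose Q := \poly_(i < n) d i.
have hP t : P.[t] = \sum_(0 <= k < n) c k * t ^+ k.
  by rewrite horner_poly big_mkord.
have hQ t : Q.[t] = \sum_(0 <= k < n) d k * t ^+ k.
  by rewrite horner_poly big_mkord.
pose S := drop_poly n (P * Q).
have PQ : P * Q = take_poly n (P * Q) + S * 'X^n by rewrite poly_take_drop.
have hT t : (take_poly n (P * Q)).[t] =
    \sum_(0 <= k < n) (\sum_(0 <= i < k.+1) c i * d (k - i)%N) * t ^+ k.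
  rewrite horner_poly big_mkord; apply: eq_bigr => k _; congr (_ * _).
  rewrite coefM big_mkord; apply: eq_bigr => i _; rewrite !coef_poly.
  rewrite (leq_ltn_trans _ (ltn_ord k)) ?leq_ord -1?ltnS//.
  by rewrite ltnS (leq_ltn_trans _ (ltn_ord k)) ?leq_subr.
have bpoly (p : {poly R}) : exists2 K : R, 0 <= K & forall t, `|t| <= 1 -> `|p.[t]| <= K.
  exists (\sum_(i < size p) `|p`_i|); first by rewrite sumr_ge0.
  move=> t t1; rewrite horner_coef (le_trans (ler_norm_sum _ _ _))//.
  by apply: ler_sum => i _; rewrite normrM normrX ler_piMr// exprn_ile1.
have [KP KP0 HP] := bpoly P; have [KS KS0 HS] := bpoly S.
exists (C * Cg + KP * D + KS), (Num.min (Num.min e e') (Num.min eg 1)); split.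
- by rewrite !addr_ge0// mulr_ge0.
- by rewrite !lt_min e0 e'0 eg0 ltr01.
move=> t t0; rewrite !lt_min -!andbA => /and4P[te te' teg /ltW t1].
have -> : f t * g t - \sum_(0 <= k < n) (\sum_(0 <= i < k.+1) c i * d (k - i)%N) * t ^+ k =
   (f t - P.[t]) * g t + P.[t] * (g t - Q.[t]) + S.[t] * t ^+ n.
  rewrite -hT; have : (P * Q).[t] = (take_poly n (P * Q) + S * 'X^n).[t] by rewrite -PQ.
  by rewrite hornerD !hornerM hornerXn => h; rewrite mulrBl mulrBr h; ring.
rewrite (le_trans (ler_normD _ _))// [leRHS]mulrDl lerD//; last first.
  by rewrite normrM normrX ler_wpM2r// HS.
rewrite (le_trans (ler_normD _ _))// [leRHS]mulrDl lerD//; rewrite normrM.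
  by rewrite mulrAC ler_pM//; [rewrite hP Hf|rewrite Hg].
by rewrite -mulrA ler_pM//; [rewrite HP|rewrite hQ Hgd].
Qed.

(** The terms of a convergent series are bounded. *)
Lemma pseries_geometric f c :
  (\forall t \near 0^', pseries c t @ \oo --> f t) ->
  exists K r : R, [/\ 0 <= K, 0 < r, (forall n, `|c n| * r ^+ n <= K) &
    forall t, t != 0 -> `|t| < r -> pseries c t @ \oo --> f t].
Proof.
move=> /nbhs_ballP [e /= e0 H].
have e2 : 0 < e / 2 by rewrite divr_gt0.
have Hb t : t != 0 -> `|t| < e -> pseries c t @ \oo --> f t.
  by move=> t0 te; apply: H => //; rewrite /ball /= sub0r normrN.
have /cvgP/cvg_series_cvg_0/cvgP/cvg_has_ub [K HK] :
    pseries c (e / 2) @ \oo --> f (e / 2).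
  by apply: Hb; rewrite ?gt_eqF// gtr0_norm// ltr_pdivrMr// ltr_pMr// ltr1n.
exists K, (e / 2); split=> // [|n|t t0 te].
- by rewrite (le_trans _ (HK _ (ex_intro2 _ _ 0%N I erefl))).
- rewrite (le_trans _ (HK _ (ex_intro2 _ _ n I erefl)))//=.
  by rewrite normrM normrX (gtr0_norm e2).
- by apply: Hb => //; rewrite (lt_trans te)// ltr_pdivrMr// ltr_pMr// ltr1n.
Qed.

(** At half the radius the tail is dominated by a geometric series of ratio
[1 / 2]. *)
Lemma expand_pseries n f c :
  (\forall t \near 0^', pseries c t @ \oo --> f t) -> expand n f c.
Proof.
move=> /pseries_geometric [K [r [K0 r0 cK H]]].
exists (K / r ^+ n * 2), (r / 2); split=> //.
- by rewrite mulr_ge0// divr_ge0// exprn_ge0// ltW.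
- by rewrite divr_gt0.
move=> t t0 te.
have Ht : pseries c t @ \oo --> f t.
  by apply: H => //; lra.
have Hn : `|pseries c t N - \sum_(0 <= k < n) c k * t ^+ k| @[N --> \oo] -->
    `|f t - \sum_(0 <= k < n) c k * t ^+ k|.
  by apply: cvg_norm; apply: cvgB => //; exact: cvg_cst.
rewrite -(cvg_lim _ Hn)//; apply: limr_le; first by apply/cvg_ex; eexists; exact: Hn.
near=> N.
have nN : (n <= N)%N by near: N; exact: nbhs_infty_ge.
rewrite /pseries /series /= (big_cat_nat (n := n))//= addrAC subrr add0r.
rewrite (le_trans (ler_norm_sum _ _ _))//.
have term k : (n <= k)%N -> `|c k * t ^+ k| <= K / r ^+ n * `|t| ^+ n * (2^-1) ^+ (k - n).
  move=> nk; rewrite normrM normrX -{1 2}(subnK nk) exprD.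
  have -> : K / r ^+ n * `|t| ^+ n * 2^-1 ^+ (k - n) =
    (K / (r ^+ n * r ^+ (k - n))) * ((r * 2^-1) ^+ (k - n) * `|t| ^+ n).
    rewrite exprMn; field; rewrite !expf_neq0//; lra.
  apply: ler_pM; rewrite ?mulr_ge0 ?exprn_ge0//.
    by rewrite -exprD subnKC// subnK// ler_pdivlMr ?exprn_gt0.
  by rewrite ler_wpM2r ?exprn_ge0// lerXn2r ?nnegrE//; lra.
rewrite (@le_trans _ _ (\sum_(n <= k < N)
    K / r ^+ n * `|t| ^+ n * (2^-1) ^+ (k - n)))//.
  by apply: ler_sum_nat => k /andP[nk _]; exact: term.
rewrite -mulr_sumr [leRHS]mulrAC ler_wpM2l//.
  by rewrite mulr_ge0 ?exprn_ge0// divr_ge0// exprn_ge0// ltW.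
rewrite -{1}[n]add0n big_addn.
have h : (1 - 2^-1)^-1 = 2 :> R by field.
under eq_bigr do rewrite addnK.
rewrite -[leRHS]h; apply: geometric_sum_le; lra.
Unshelve. all: by end_near. Qed.

End Expansion.

(** * Bernoulli polynomials and zeta values *)

Section Bernoulli.
Context {R : realType}.

Lemma pseries_expR (x t : R) : pseries (fun k => x ^+ k / k`!%:R) t @ \oo --> expR (x * t).
Proof.
rewrite (_ : pseries _ t = series (exp_coeff (x * t))).
  exact: is_cvg_series_exp_coeff.
by apply/funext => n; apply: eq_bigr => k _; rewrite /exp_coeff /= exprMn mulrAC.
Qed.

Lemma expand_expR n (x : R) : expand n (fun t => expR (x * t)) (fun k => x ^+ k / k`!%:R).
Proof. by apply: expand_pseries; near=> t; exact: pseries_expR.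
Unshelve. all: by end_near. Qed.

Lemma expand_expRm1 n : expand n (fun t : R => (expR t - 1) / t) (fun k => k.+1`!%:R^-1).
Proof.
apply: expand_pseries; near=> t.
have t0 : t != 0 by near: t; exact: nbhs_dnbhs_neq.
have H : (series (exp_coeff t) (n + 1)%N - 1) / t @[n --> \oo] --> (expR t - 1) / t.
  apply: cvgM; last exact: cvg_cst.
  apply: cvgB; last exact: cvg_cst.
  by have := is_cvg_series_exp_coeff t; rewrite -(cvg_shiftn 1).
apply: cvg_trans H; apply: near_eq_cvg; near=> N.
rewrite /pseries /series /= addn1 big_nat_recl// /exp_coeff /= expr0 fact0 divr1.
rewrite addrAC subrr add0r mulr_suml; apply: eq_bigr => k _.
by rewrite exprSr mulrAC mulfK// mulrC.
Unshelve. all: by end_near. Qed.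

Lemma expR_neq1 (t : R) : t != 0 -> expR t - 1 != 0.
Proof. by move=> t0; rewrite subr_eq0 -expR0 (inj_eq (@expR_inj R)). Qed.

Context (B : nat -> {poly R}) (hB : is_bernoulli_polynomials B).

(** The normalization [B_k(x) / k!] is the one of the generating function, in which
convolutions carry no binomial coefficients. *)
Definition bern (x : R) (k : nat) : R := (B k).[x] / k`!%:R.

Lemma expand_bern n x : expand n (fun t => t * expR (x * t) / (expR t - 1)) (bern x).
Proof. exact: expand_pseries (hB x). Qed.

(** Compare coefficients in
[(t expR (x t) / (expR t - 1)) * ((expR t - 1) / t) = expR (x t)]. *)
Lemma bern_rec x j : \sum_(0 <= k < j.+1) bern x k / (j.+1 - k)`!%:R = x ^+ j / j`!%:R.
Proof.
have := expand_unique (expand_ext _ (expandM (expand_bern j.+1 x) (expand_expRm1 j.+1)))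
  (expand_expR j.+1 x).
move=> /(_ _ j (ltnSn j)) <-.
  by apply: eq_big_nat => k /andP[_ kj]; rewrite subSn.
by move=> t t0; field; rewrite t0 expR_neq1.
Qed.

(** The substitution of [- t] for [t] exchanges [t / (expR t - 1)] and
[t * expR t / (expR t - 1)]. *)
Lemma bern_reflection k : bern 1 k = (-1) ^+ k * bern 0 k.
Proof.
have H : expand k.+1 (fun t : R => t * expR (1 * t) / (expR t - 1))
    (fun j => (-1) ^+ j * bern 0 j).
  have [C [e [C0 e0 H]]] := expand_bern k.+1 0.
  exists C, e; split=> // t t0 te.
  have := H (- t); rewrite oppr_eq0 normrN => /(_ t0 te).
  rewrite mul0r expR0 mulr1 mul1r.
  have -> : - t / (expR (- t) - 1) = t * expR t / (expR t - 1).
    rewrite expRN; have := expR_gt0 t; have := expR_neq1 t0.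
    move: (expR t) => w w1 w0.
    have wn0 : w != 0 by rewrite gt_eqF.
    have -> : w^-1 - 1 = - (w - 1) / w by field.
    by rewrite invfM invrK invrN; ring.
  congr (`|_ - _| <= _); apply: eq_bigr => j _.
  by rewrite -[- t]mulN1r exprMn; ring.
exact: (expand_unique (expand_bern k.+1 1) H).
Qed.

(** The generating functions at [1] and at [0] differ by [t]. *)
Lemma bern_01 k : k != 1%N -> bern 1 k = bern 0 k.
Proof.
move=> k1.
have H : expand k.+2 (fun t : R => t * expR (1 * t) / (expR t - 1) - t)
    (fun j => bern 1 j - (j == 1%N)%:R).
  apply: expandB; first exact: expand_bern.
  exists 0, 1; split=> // t _ _; rewrite mul0r.
  rewrite (bigD1_seq 1%N) ?mem_index_iota ?iota_uniq//= big1 => [|i /negPf->].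
    by rewrite mul1r expr1 addr0 subrr normr0.
  by rewrite mul0r.
have := expand_unique (expand_ext _ H) (expand_bern k.+2 0).
move=> /(_ _ k) <-//; first by rewrite (negPf k1) subr0.
by move=> t t0; rewrite mul1r mul0r expR0; field; exact: expR_neq1.
Qed.

Lemma bern_odd k : odd k -> k != 1%N -> bern 0 k = 0.
Proof.
move=> ok k1; have := bern_reflection k; rewrite bern_01// -signr_odd ok expr1.
by move=> h; lra.
Qed.

Lemma bern0 x : bern x 0 = 1.
Proof.
have := bern_rec x 0; rewrite big_nat1 expr0 fact0 divr1.
by move=> ->; rewrite divr1.
Qed.

Lemma bern1 x : bern x 1 = x - 2^-1.
Proof.
have := bern_rec x 1; rewrite big_nat_recr//= big_nat1 bern0 expr1 /= !factS fact0.
by rewrite !muln1 !divr1 => h; lra.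
Qed.

Lemma bern2 x : bern x 2 = (x ^+ 2 - x + 6^-1) / 2.
Proof.
have := bern_rec x 2; rewrite big_nat_recr//= big_nat_recr//= big_nat1 bern0 bern1.
rewrite /= !factS fact0 !muln1 !divr1 => h.
by rewrite -[LHS](addKr (1 / (3 * 2)%:R + (x - 2^-1) / 2)) h natrM; field.
Qed.

Context (zeta : R[i] -> R[i]) (hzeta : is_riemann_zeta zeta).

(** By [zeta_recurrence] and by [bern_rec] at [x = 1], both sides satisfy the same
triangular recurrence. *)
Lemma zeta_neg m : complex.Re (zeta (- m%:R)) = - bern 1 m.+1 * m`!%:R.
Proof.
elim/ltn_ind: m => m IH.
have Renat n (z : R[i]) : complex.Re (n%:R * z) = n%:R * complex.Re z.
  by rewrite natC; case: z => a b /=; rewrite mul0r subr0.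
have mf k : k`!%:R != 0 :> R by rewrite pnatr_eq0 -lt0n fact_gt0.
pose Z j := complex.Re (zeta (- j%:R)).
have HZ : \sum_(0 <= j < m.+1) 'C(m.+1, j)%:R * Z j = m.+2%:R^-1 - 1.
  have := congr1 (@complex.Re R) (zeta_recurrence hzeta m).
  rewrite raddf_sum /= natC -fmorphV -[_ - 1]/(_ - (1 : R)%:C)%C -rmorphB /= => <-.
  by apply: eq_bigr => j _; rewrite Renat.
have HB : \sum_(0 <= j < m.+1) 'C(m.+1, j)%:R * (- bern 1 j.+1 * j`!%:R) =
    m.+2%:R^-1 - 1.
  have := bern_rec 1 m.+1; rewrite big_nat_recl// bern0 subn0 expr1n.
  rewrite !div1r => /(congr1 (fun u => - (u - m.+2`!%:R^-1) * m.+1`!%:R)).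
  rewrite addrAC subrr add0r mulNr mulr_suml -sumrN => h.
  rewrite (_ : m.+2%:R^-1 - 1 = - (m.+1`!%:R^-1 - m.+2`!%:R^-1) * m.+1`!%:R); last first.
    have n0 : m.+2%:R != 0 :> R by rewrite pnatr_eq0.
    rewrite (factS m.+1) natrM invfM mulNr mulrBl mulVf// -mulrA mulVf// mulr1.
    by rewrite opprB.
  rewrite -h; apply: eq_big_nat => j /andP[_ jm].
  have := bin_fact (ltnW jm) => /(congr1 (fun n => n%:R : R)); rewrite !natrM => <-.
  by rewrite subSS; field; exact: mf.
move: HZ; rewrite -HB !big_nat_recr//= => /eqP.
rewrite (eq_big_nat _ _ (F2 := fun j => 'C(m.+1, j)%:R * (- bern 1 j.+1 * j`!%:R))).
  rewrite (inj_eq (addrI _)) => /eqP/mulfI; apply.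
  by rewrite pnatr_eq0 -lt0n bin_gt0.
by move=> j /andP[_ jm]; rewrite /Z IH.
Qed.

End Bernoulli.

(** * Real power series and their derivatives *)

Section PowerSeries.
Context {R : realType}.
Implicit Types (c : nat -> R) (r : R).

(** Boundedness of the terms inside the disc is the form in which a radius of
convergence passes to the derived series. *)
Definition ps_radius c r := forall s, 0 < s -> s < r ->
  exists2 K : R, 0 <= K & forall n, `|c n| * s ^+ n <= K.

(** Move to a slightly larger radius [u]: the factor [n + 1] is absorbed by
[(s / u) ^ n], as [n + 1] terms of a geometric series add up to at least
[(n + 1) (s / u) ^ n]. *)
Lemma ps_radius_diffs c r : ps_radius c r -> ps_radius (pseries_diffs c) r.
Proof.
move=> cr s s0 sr; pose u := (s + r) / 2.
have su : s < u by rewrite /u; lra.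
have ur : u < r by rewrite /u; lra.
have u0 : 0 < u by lra.
clearbody u; have un0 : u != 0 by rewrite gt_eqF.
have [K K0 HK] := cr u u0 ur.
have x1 : s / u < 1 by rewrite ltr_pdivrMr// mul1r.
have x0 : 0 <= s / u by rewrite divr_ge0// ltW.
exists (K / u * (1 - s / u)^-1).
  by rewrite !mulr_ge0 ?invr_ge0 ?subr_ge0 ?(ltW u0) ?(ltW x1).
move=> n; rewrite /pseries_diffs normrM ger0_norm//.
have h1 : n.+1%:R * (s / u) ^+ n <= (1 - s / u)^-1.
  rewrite (le_trans _ (geometric_sum_le n.+1 x0 x1))//.
  rewrite mulr_natl -[X in _ *+ X]subn0 -sumr_const_nat.
  apply: ler_sum_nat => k /andP[_ kn].
  by rewrite ler_wiXn2l// ltW.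
have -> : n.+1%:R * `|c n.+1| * s ^+ n =
    (`|c n.+1| * u ^+ n.+1 / u) * (n.+1%:R * (s / u) ^+ n).
  by rewrite exprMn exprVn exprS; field; rewrite un0 expf_neq0.
apply: ler_pM => //; rewrite ?mulr_ge0 ?exprn_ge0 ?invr_ge0 ?(ltW u0)//.
by rewrite ler_wpM2r ?invr_ge0 ?(ltW u0).
Qed.

Lemma ps_radius_cvg c r (x : R) : ps_radius c r -> `|x| < r -> cvgn (pseries c x).
Proof.
move=> cr xr; pose u := (`|x| + r) / 2.
have u0 : 0 < u by have := normr_ge0 x; rewrite /u; lra.
have xu : `|x| < `|u| by rewrite (gtr0_norm u0) /u; lra.
have ur : u < r by rewrite /u; lra.
clearbody u; have un0 : u != 0 by rewrite gt_eqF.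
have [K K0 HK] := cr u u0 ur.
have q1 : `|x| / u < 1 by rewrite ltr_pdivrMr// mul1r -(gtr0_norm u0).
have q0 : 0 <= `|x| / u by rewrite divr_ge0// ltW.
apply: normed_cvg.
apply: (@bounded_series_cvg _ _ (K * (1 - `|x| / u)^-1)) => n; first by rewrite /=.
rewrite (le_trans _ (ler_wpM2l K0 (geometric_sum_le n q0 q1)))// mulr_sumr.
apply: ler_sum => k _ /=; rewrite normrM normrX.
have -> : `|c k| * `|x| ^+ k = `|c k| * u ^+ k * (`|x| / u) ^+ k.
  by rewrite exprMn exprVn; field; rewrite expf_neq0.
by rewrite ler_wpM2r ?exprn_ge0.
Qed.

Definition psum c (x : R) : R := limn (pseries c x).

Lemma is_derive_psum c r (x : R) : ps_radius c r -> `|x| < r ->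
  is_derive x 1 (psum c) (psum (pseries_diffs c) x).
Proof.
move=> cr xr; pose u := (`|x| + r) / 2.
have u0 : 0 < u by have := normr_ge0 x; rewrite /u; lra.
have ur : `|u| < r by rewrite gtr0_norm// /u; lra.
have c1 := ps_radius_diffs cr; have c2 := ps_radius_diffs c1.
apply: (@pseries_snd_diffs R c u x); try exact: ps_radius_cvg ur.
by rewrite (gtr0_norm u0) /u; lra.
Qed.

Lemma expand_psum c r n : 0 < r -> ps_radius c r -> expand n (psum c) c.
Proof.
move=> r0 cr; apply: expand_pseries; near=> t.
apply: (ps_radius_cvg cr).
by near: t; exact: dnbhs0_lt.
Unshelve. all: by end_near. Qed.

End PowerSeries.

(** * The function ln ((1 - exp (- y)) / y) *)

Section Phi.
Context {R : realType}.
Context (B : nat -> {poly R}) (hB : is_bernoulli_polynomials B).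
Local Notation bern := (bern B).

(** Planck's function [w = 1 / (expR y - 1)] is the derivative of
[ln (1 - expR (- y))] and satisfies [w' = - w - w ^ 2], so that all further
derivatives are polynomials in [w]. *)
Definition planck (y : R) : R := (expR y - 1)^-1.

Fixpoint planck_poly (k : nat) : {poly R} :=
  if k is j.+1 then (planck_poly j)^`() * (- 'X - 'X ^+ 2) else 'X.

(** The [k]-th derivative of [ln (1 - expR (- y)) - ln y] in closed form; the
subtracted fraction belongs to [ln y]. *)
Definition phi_pos (k : nat) (y : R) : R :=
  if k is j.+1 then (planck_poly j).[planck y] - (-1) ^+ j * j`!%:R / y ^+ j.+1
  else ln (1 - expR (- y)) - ln y.

(** The [k]-th derivative of [ln ((1 - expR (- y)) / y)], extended to [0] by its limit:
the Taylor coefficients of the first derivative are the [B_(j+1)(0) / (j + 1)!]. *)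
Definition phi (k : nat) (y : R) : R :=
  if 0 < y then phi_pos k y else if k is j.+1 then bern 0 j.+1 * j`!%:R else 0.

Lemma expR_sub1_gt0 (y : R) : 0 < y -> 0 < expR y - 1.
Proof. by move=> y0; rewrite subr_gt0 expR_gt1. Qed.

Lemma is_derive_planck (y : R) : 0 < y ->
  is_derive y 1 planck (- planck y - planck y ^+ 2).
Proof.
move=> y0; have e0 := expR_sub1_gt0 y0.
have d1 : is_derive y 1 (fun z => expR z - 1) (expR y).
  apply: (is_derive_eqr (is_derive_add (is_derive_expR y) (is_derive_const (-1) y))).
  by rewrite addr0.
have e1 : expR y - 1 != 0 by rewrite gt_eqF.
apply: (is_derive_eqr (is_derive_comp (g := fun z => expR z - 1)
  (is_derive_inv e1) d1)).
by rewrite /planck; field.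
Qed.

Lemma is_derive_phi_pos k (y : R) : 0 < y -> is_derive y 1 (phi_pos k) (phi_pos k.+1 y).
Proof.
move=> y0; have e0 := expR_sub1_gt0 y0; have yn0 : y != 0 by rewrite gt_eqF.
case: k => [|k].
  have d1 : is_derive y 1 (fun z => 1 - expR (- z)) (expR (- y)).
    have dN := is_derive_opp (is_derive_var y).
    apply: (is_derive_eqr (is_derive_add (is_derive_const 1 y)
      (is_derive_opp (is_derive_comp (is_derive_expR (- y)) dN)))).
    by rewrite add0r mulrN1 opprK.
  have p0 : 0 < 1 - expR (- y) by rewrite subr_gt0 expR_lt1 oppr_lt0.
  apply: (is_derive_eqr (is_derive_add (is_derive_comp (g := fun z => 1 - expR (- z))
    (is_derive1_ln p0) d1)
      (is_derive_opp (is_derive1_ln y0)))).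
  rewrite /phi_pos /= hornerX expr0 fact0 expr1 mulr1 div1r; congr (_ - _).
  rewrite /planck expRN; have := expR_gt0 y; move: (expR y) e0 => v v1 v0.
  have h1 : v != 0 by rewrite gt_eqF.
  have h2 : v - 1 != 0 by rewrite gt_eqF.
  by rewrite -[1 - v^-1]/(1 - v^-1) (_ : 1 - v^-1 = (v - 1) / v); field; rewrite ?h1 ?h2.
have d2 : is_derive y 1 (fun z => (planck_poly k).[planck z]) (planck_poly k.+1).[planck y].
  apply: (is_derive_eqr (is_derive_comp (is_derive_poly (planck_poly k) (planck y))
     (is_derive_planck y0))).
  by rewrite /= hornerM !hornerE.
have d3 : is_derive y 1 (fun z => (-1) ^+ k * k`!%:R / z ^+ k.+1)
    ((-1) ^+ k.+1 * k.+1`!%:R / y ^+ k.+2).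
  have yk : y ^+ k.+1 != 0 by rewrite expf_neq0.
  apply: (is_derive_eqr (is_derive_mull ((-1) ^+ k * k`!%:R)
    (is_derive_comp (g := fun z => z ^+ k.+1)
      (is_derive_inv yk) (is_derive_pow k.+1 y)))).
  rewrite /= factS natrM !exprS; field; rewrite yn0 expf_neq0//.
exact: is_derive_add d2 (is_derive_opp d3).
Qed.

Lemma is_derive_phi k (y : R) : 0 < y -> is_derive y 1 (phi k) (phi k.+1 y).
Proof.
move=> y0; rewrite {2}/phi y0.
apply: (near_eq_is_derive _ (is_derive_phi_pos k y0)).
near=> z; rewrite /phi; have -> // : 0 < z.
near: z; exact: lt_nbhsr.
Unshelve. all: by end_near. Qed.

(** The derivative [1 / (expR y - 1) - 1 / y] is the generating function of the
Bernoulli numbers with its constant term removed, divided by [y]. *)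
Lemma planck_series : exists2 r : R, 0 < r & ps_radius (fun n => bern 0 n.+1) r /\
  forall y, 0 < y -> y < r -> phi_pos 1 y = psum (fun n => bern 0 n.+1) y.
Proof.
have [K [r [K0 r0 HK Hc]]] := pseries_geometric (hB 0).
exists r => //; split.
  move=> s s0 sr; exists (K / r); first by rewrite divr_ge0// ltW.
  move=> n; rewrite ler_pdivlMr// (le_trans _ (HK n.+1))// exprSr mulrA.
  rewrite ler_wpM2r ?(ltW r0)// ler_wpM2l// lerXn2r ?nnegrE ?ltW//.
move=> y y0 yr; apply/esym/cvg_lim => //.
have yn0 : y != 0 by rewrite gt_eqF.
pose c n := (B n).[0] / n`!%:R.
have H0 : pseries c y (n + 1)%N @[n --> \oo] --> y / (expR y - 1).
  rewrite (cvg_shiftn 1 (pseries c y)); have := Hc y yn0.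
  by rewrite gtr0_norm// mul0r expR0 mulr1; exact.
have H : (pseries c y (n + 1)%N - 1) / y @[n --> \oo] --> phi_pos 1 y.
  have -> : phi_pos 1 y = (y / (expR y - 1) - 1) / y.
    have h := gt_eqF (expR_sub1_gt0 y0).
    rewrite /phi_pos /= hornerX expr0 fact0 expr1 /planck; field.
    by rewrite yn0 h.
  apply: cvgM; last exact: cvg_cst.
  by apply: cvgB => //; exact: cvg_cst.
apply: cvg_trans H; apply: near_eq_cvg; near=> n.
rewrite /= /pseries /series /= addn1 big_nat_recl// expr0 mulr1.
have -> : c 0 = 1 by exact: bern0 hB 0.
rewrite /= addrAC subrr add0r mulr_suml; apply: eq_bigr => k _.
by rewrite exprSr mulrA mulfK.
Unshelve. all: by end_near. Qed.

Definition phi_coef (k : nat) : nat -> R :=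
  iter k (@pseries_diffs R) (fun n => bern 0 n.+1).

Lemma phi_coef0 k j : phi_coef k j = bern 0 (j + k).+1 * (j + k)`!%:R / j`!%:R.
Proof.
have mf i : i`!%:R != 0 :> R by rewrite pnatr_eq0 -lt0n fact_gt0.
elim: k j => [|k IH] j; first by rewrite addn0 mulfK.
rewrite /phi_coef iterS -/(phi_coef k) /pseries_diffs IH addSnnS factS natrM.
by rewrite invfM; field; rewrite mf -mulrS pnatr_eq0.
Qed.

(** Near [0] the derivatives are those of the power series of [planck_series], which
may be differentiated term by term. *)
Lemma phi_series : exists2 r : R, 0 < r & forall k, ps_radius (phi_coef k) r /\
  forall y, 0 < y -> y < r -> phi_pos k.+1 y = psum (phi_coef k) y.
Proof.
have [r r0 [rc H]] := planck_series; exists r => //; elim=> [|k [IH1 IH2]]; first by [].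
split; first exact: ps_radius_diffs.
move=> y y0 yr; have yr' : `|y| < r by rewrite gtr0_norm.
have [_ <-] := is_derive_psum IH1 yr'.
have [_ <-] := is_derive_phi_pos k.+1 y0.
apply: near_eq_derive; near=> z; apply: IH2.
  by near: z; exact: lt_nbhsr.
by near: z; exact: lt_nbhsl.
Unshelve. all: by end_near. Qed.

(** For [k = 0], the inequality [expR z >= 1 + z] at [z = y] and at [z = - y] gives
[- y <= phi 0 y <= 0]; for [k > 0] the power series is continuous. *)
Lemma phi_at_right0 k : phi k y @[y --> 0^'+] --> phi k 0.
Proof.
case: k => [|k].
  apply: (squeeze_cvgr (f := fun y => - y) (h := cst 0)).
  - near=> y; have y0 : 0 < y by [].
    rewrite /phi y0 /=; have e0 := expR_gt0 (- y).
    have p0 : 0 < 1 - expR (- y) by rewrite subr_gt0 expR_lt1 oppr_lt0.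
    rewrite -ln_div ?posrE// -[leLHS]expRK; apply/andP; split.
      rewrite ler_ln ?posrE ?expR_gt0 ?divr_gt0// ler_pdivlMr//.
      have v0 : expR y != 0 by rewrite gt_eqF ?expR_gt0.
      rewrite expRN -subr_ge0 (_ : _ - _ = (expR y - (1 + y)) / expR y); last by field.
      by rewrite divr_ge0 ?expR_ge0// subr_ge0 expR_ge1Dx.
    rewrite -ln1 ler_ln ?posrE ?divr_gt0// ler_pdivrMr// mul1r.
    by have := expR_ge1Dx (- y); lra.
  - rewrite /phi ltxx -[X in _ --> X]oppr0; apply: cvgN; exact: cvg_at_right_filter.
  - rewrite /phi ltxx; exact: cvg_cst.
have [r r0 H] := phi_series; have [cr Hk] := H k.
have -> : phi k.+1 0 = phi_coef k 0.
  by rewrite /phi ltxx phi_coef0 add0n fact0 divr1.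
have [C [e [C0 e0 He]]] := expand_psum 1 r0 cr.
apply/cvgrPdist_le => d d0; near=> y.
have y0 : 0 < y by [].
have yr : y < r by near: y; exact: nbhs_right_lt.
rewrite /phi y0 Hk// distrC.
have := He y; rewrite gt_eqF// big_nat1 expr0 mulr1 expr1 gtr0_norm// => h.
have ye : y < e by near: y; exact: nbhs_right_lt.
rewrite (le_trans (h isT ye))// (@le_trans _ _ ((C + 1) * y))//.
  by rewrite ler_wpM2r ?(ltW y0)// lerDl.
rewrite -ler_pdivlMl; last by lra.
near: y; apply: nbhs_right_le; rewrite mulr_gt0// invr_gt0; lra.
Unshelve. all: by end_near. Qed.

End Phi.

Section PhiBounds.
Context {R : realType}.
Context (B : nat -> {poly R}) (hB : is_bernoulli_polynomials B).
Local Notation bern := (bern B).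
Local Notation phi := (phi B).

Lemma phi_continuous k (a b : R) : 0 <= a -> {within `[a, b], continuous (phi k)}.
Proof.
move=> a0; pose m := Num.max b 0 + 1.
have m0 : 0 < m by rewrite ltr_pwDr// le_max lexx orbT.
have H : {within `[0, m], continuous (phi k)}.
  apply/continuous_within_itvP => //; split.
  - move=> y; rewrite in_itv /= => /andP[y0 _].
    exact: is_derive_continuous (is_derive_phi B k y0).
  - exact: (phi_at_right0 hB).
  - exact: cvg_at_left_filter (is_derive_continuous (is_derive_phi B k m0)).
apply: continuous_subspaceW H => y /=; rewrite !in_itv /= => /andP[ay yb].
rewrite (le_trans a0 ay) (le_trans yb)//.
by rewrite /m (@le_trans _ _ (Num.max b 0)) ?le_max ?lexx// lerDl.
Qed.

Lemma planck_gt0 (y : R) : 0 < y -> 0 < planck y.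
Proof. by move=> y0; rewrite invr_gt0 expR_sub1_gt0. Qed.

Lemma planck_le_inv (y : R) : 0 < y -> planck y <= y^-1.
Proof.
move=> y0; rewrite lef_pV2 ?posrE ?expR_sub1_gt0//.
by have := expR_ge1Dx y; lra.
Qed.

Lemma planck_le_inv2 (y : R) : 0 < y -> planck y <= 2 / y ^+ 2.
Proof.
move=> y0; rewrite -[leRHS]invrK invfM invrK mulrC.
rewrite lef_pV2 ?posrE ?expR_sub1_gt0 ?divr_gt0 ?exprn_gt0//.
by have := expR_ge1Dxn 1 (ltW y0); rewrite !factS fact0 !muln1; lra.
Qed.

Lemma planck_polyX k : exists Q, @planck_poly R k = 'X * Q.
Proof.
case: k => [|k]; first by exists 1; rewrite mulr1.
exists ((planck_poly k)^`() * (- 1 - 'X)) => /=; ring.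
Qed.

(** Away from [0], both [planck y] and the powers of [1 / y] of order at least [2]
are bounded by multiples of [1 / y ^ 2]. *)
Lemma phi_pos_le k (e : R) : 0 < e -> exists2 C : R, 0 <= C &
  forall y, e <= y -> `|phi_pos k.+2 y| <= C / y ^+ 2.
Proof.
move=> e0; have [Q HQ] := planck_polyX k.+1.
pose C1 := \sum_(i < size Q) `|Q`_i| * e ^- i.
have C10 : 0 <= C1.
  by rewrite sumr_ge0// => i _; rewrite mulr_ge0// invr_ge0 exprn_ge0 ?(ltW e0).
exists (C1 * 2 + k.+1`!%:R / e ^+ k).
  by rewrite addr_ge0 ?mulr_ge0 ?invr_ge0 ?exprn_ge0 ?(ltW e0).
move=> y ey; have y0 : 0 < y by rewrite (lt_le_trans e0).
have w0 := planck_gt0 y0.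
rewrite /phi_pos HQ hornerM hornerX (le_trans (ler_normB _ _))// mulrDl lerD//.
  rewrite normrM mulrC (gtr0_norm w0) -mulrA ler_pM ?planck_le_inv2 ?(ltW w0)//.
  rewrite horner_coef (le_trans (ler_norm_sum _ _ _))//; apply: ler_sum => i _.
  rewrite normrM ler_wpM2l// normrX (gtr0_norm w0) -exprVn lerXn2r ?nnegrE ?(ltW w0)//.
    by rewrite invr_ge0 (ltW e0).
  rewrite (le_trans (planck_le_inv y0))// lef_pV2//.
rewrite !normrM normrX normrN1 expr1n mul1r ger0_norm// normfV normrX (gtr0_norm y0).
rewrite -mulrA ler_wpM2l// -invfM -addn2 exprD lef_pV2 ?posrE ?mulr_gt0 ?exprn_gt0//.
by rewrite ler_wpM2r ?exprn_ge0 ?(ltW y0)// lerXn2r ?nnegrE ?(ltW y0) ?(ltW e0).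
Qed.

(** Near [0] the function is bounded, being the sum of a power series, and away
from [0] the bound is [phi_pos_le]. *)
Lemma phi_decay k : exists2 C : R, 0 <= C &
  forall y, 0 <= y -> `|phi k.+2 y| <= C / (1 + y) ^+ 2.
Proof.
have [r r0 H] := phi_series hB; have [cr Hk] := H k.+1.
have [C1 [e [C10 e0 He]]] := expand_bounded (expand_psum 1 r0 cr).
pose d := Num.min (Num.min r e) 1 / 2.
have d0 : 0 < d by rewrite divr_gt0// !lt_min r0 e0 ltr01.
have dr : d < r.
  have : Num.min (Num.min r e) 1 <= r by rewrite !ge_min lexx.
  by rewrite /d; lra.
have de : d < e.
  have : Num.min (Num.min r e) 1 <= e by rewrite !ge_min lexx orbT.
  by rewrite /d; lra.
have d1 : d <= 1.
  have : Num.min (Num.min r e) 1 <= 1 by rewrite !ge_min lexx orbT.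
  by rewrite /d; lra.
have [C2 C20 HC2] := phi_pos_le k d0.
pose C0 := `|phi k.+2 0|; have phi0 : `|phi k.+2 0| <= C0 by [].
have C00 : 0 <= C0 by exact: normr_ge0.
clearbody C0 d.
have A0 : 0 <= C2 * ((1 + d) / d) ^+ 2.
  by rewrite mulr_ge0 ?exprn_ge0// divr_ge0 ?addr_ge0 ?(ltW d0).
exists (4 * (C1 + C0) + C2 * ((1 + d) / d) ^+ 2).
  by rewrite addr_ge0// mulr_ge0// addr_ge0.
move=> y y0; have y1 : 0 < 1 + y by rewrite ltr_pwDl.
have [yd|yd] := leP y d.
  rewrite ler_pdivlMr ?exprn_gt0// (@le_trans _ _ (4 * (C1 + C0)))//; last first.
    by rewrite lerDl.
  rewrite mulrC; apply: ler_pM; rewrite ?exprn_ge0 ?(ltW y1)//.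
    have -> : 4 = 2 ^+ 2 :> R by ring.
    by rewrite lerXn2r ?nnegrE ?(ltW y1)//; lra.
  have [->|yn0] := eqVneq y 0; first by rewrite (le_trans phi0)// lerDr.
  have y_gt0 : 0 < y by rewrite lt0r yn0.
  rewrite /phi y_gt0 Hk ?(le_lt_trans yd)// (le_trans (He y yn0 _)) ?lerDl//.
  by rewrite gtr0_norm// (le_lt_trans yd).
have y_gt0 : 0 < y by rewrite (lt_trans d0).
rewrite /phi y_gt0 (le_trans (HC2 y (ltW yd)))//.
rewrite (@le_trans _ _ (C2 * ((1 + d) / d) ^+ 2 / (1 + y) ^+ 2))//; last first.
  by rewrite ler_wpM2r ?invr_ge0 ?exprn_ge0 ?(ltW y1)// lerDr mulr_ge0// addr_ge0.
rewrite -mulrA ler_wpM2l// -exprVn -exprVn -exprMn lerXn2r ?nnegrE ?invr_ge0 ?(ltW y_gt0)//.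
  by rewrite mulr_ge0 ?divr_ge0 ?invr_ge0 ?addr_ge0 ?(ltW d0) ?(ltW y_gt0).
rewrite ler_pdivlMr// mulrC ler_pdivrMr// mulrAC ler_pdivlMr//; nra.
Qed.

Lemma phi_tail k : exists2 C : R, 0 <= C &
  forall y, 1 <= y -> `|phi k.+1 y| <= C / y.
Proof.
case: k => [|k].
  exists 2 => // y y1; have y0 : 0 < y by rewrite (lt_le_trans ltr01).
  rewrite /phi y0 /phi_pos /= hornerX expr0 fact0 expr1 mulr1 div1r.
  rewrite (le_trans (ler_normB _ _))// (gtr0_norm (planck_gt0 y0)).
  rewrite gtr0_norm ?invr_gt0//; have := planck_le_inv y0.
  by move: (planck y) (y^-1) => ? ? h; lra.
have [C C0 HC] := phi_pos_le k ltr01; exists C => // y y1.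
have y0 : 0 < y by rewrite (lt_le_trans ltr01).
rewrite /phi y0 (le_trans (HC y y1))// ler_wpM2l// lef_pV2 ?posrE ?exprn_gt0//.
by rewrite expr2 ler_peMl// ltW.
Qed.

Lemma phi_cvg k (t : R) : 0 < t -> phi k.+1 (t * M%:R) @[M --> \oo] --> (0 : R).
Proof.
move=> t0; have [C C0 HC] := phi_tail k.
apply/cvgrPdist_le => e e0; near=> M; rewrite sub0r normrN.
have M1 : 1 <= t * M%:R.
  rewrite -ler_pdivrMl// mulr1; near: M; exact: nbhs_infty_ger.
rewrite (le_trans (HC _ M1))// ler_pdivrMr ?(lt_le_trans ltr01)//.
rewrite mulrA -ler_pdivrMl ?mulr_gt0//; near: M; exact: nbhs_infty_ger.
Unshelve. all: by end_near. Qed.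

End PhiBounds.

(** * Euler-Maclaurin summation *)

Section EulerMaclaurin.
Context {R : realType}.
Context (B : nat -> {poly R}) (hB : is_bernoulli_polynomials B).
Local Notation bern := (bern B).

(** The weights are characterized by [em_weight_rec], which says that the formula of
[em_step] is exact for polynomials. *)
Definition em_weight (x : R) (k : nat) : R := bern 1 k - bern x k.

Lemma em_weight_rec x p :
  \sum_(1 <= k < p.+1) em_weight x k / (p.+1 - k)`!%:R = (1 - x ^+ p) / p`!%:R.
Proof.
have h1 := bern_rec hB 1 p; have h2 := bern_rec hB x p.
rewrite big_nat_recl// (bern0 hB) expr1n in h1.
rewrite big_nat_recl// (bern0 hB) in h2.
rewrite mulrBl -h1 -h2 opprD addrACA subrr add0r -sumrB big_add1 /=.
by apply: eq_bigr => k _; rewrite /em_weight mulrBl.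
Qed.

Context (g : nat -> R -> R)
  (cg : forall k (a b : R), 0 <= a -> {within `[a, b], continuous (g k)})
  (dg : forall k (y : R), 0 < y -> is_derive y 1 (g k) (g k.+1 y)).

Definition em_bound (x : R) (K : nat) : R :=
  1 + Num.max 1 x ^+ K + \sum_(1 <= k < K.+1) `|em_weight x k|.

(** The correction terms cancel the Taylor polynomials at [a] exactly, by the
recurrence of the Bernoulli polynomials; only Taylor remainders are left. *)
Lemma em_step (x t a M : R) K : 0 < x -> 0 <= t -> 0 <= a ->
  (forall y, a <= y -> y <= a + t * Num.max 1 x -> `|g K y| <= M) ->
  `|g 0 (a + t) - g 0 (a + t * x) -
    \sum_(1 <= k < K.+1) em_weight x k * (t ^+ k.-1 * (g k.-1 (a + t) - g k.-1 a))|
  <= em_bound x K * (t ^+ K * M).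
Proof.
move=> x0 t0 a0 gM.
pose X := Num.max 1 x.
have X1 : 1 <= X by rewrite le_max lexx.
have xX : x <= X by rewrite le_max lexx orbT.
have M0 : 0 <= M.
  rewrite (le_trans _ (gM a (lexx a) _))// lerDl mulr_ge0//.
  exact: le_trans X1.
(* the Taylor polynomial of g i at a, of the order that leaves g K in the
   remainder *)
pose T i h := \sum_(0 <= j < K - i) h ^+ j / j`!%:R * g (i + j) a.
have rem i h : (i <= K)%N -> 0 <= h -> h <= t * X ->
    `|g i (a + h) - T i h| <= M * h ^+ (K - i).
  move=> iK h0 hX.
  have ah : a <= a + h by rewrite lerDl.
  have H : `|g (i + 0) (a + h) - taylor_sum (K - i) a (fun j => g (i + j) a) (a + h)|
      <= M * (a + h - a) ^+ (K - i) / (K - i)`!%:R.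
    apply: (taylor_ineq (g := fun j => g (i + j)) ah).
    - by move=> j _; exact: cg.
    - move=> j y _; rewrite in_itv /= => /andP[ay _]; rewrite addnS.
      exact: dg (le_lt_trans a0 ay).
    - move=> y; rewrite in_itv /= subnKC// => /andP[ay yh].
      by apply: gM => //; rewrite (le_trans yh)// lerD2l.
  move: H; rewrite addn0 /taylor_sum addrAC subrr add0r => H.
  rewrite (le_trans H)// ler_piMr ?mulr_ge0 ?exprn_ge0//.
  by rewrite invf_le1 ?ler1n ?ltr0n ?fact_gt0.
have HT : T 0 t - T 0 (t * x) =
    \sum_(1 <= k < K.+1) em_weight x k * (t ^+ k.-1 * (T k.-1 t - g k.-1 a)).
  pose c k p : R := if (k <= p)%N then t ^+ p / (p.+1 - k)`!%:R * g p a else 0.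
  have HTk k : (1 <= k < K.+1)%N ->
      t ^+ k.-1 * (T k.-1 t - g k.-1 a) = \sum_(0 <= p < K) c k p.
    case: k => // k /andP[_ kK]; rewrite /T /= -subnSK//.
    rewrite big_nat_recl// expr0 fact0 divr1 mul1r addn0 addrAC subrr add0r.
    rewrite [RHS](big_cat_nat (n := k.+1))//= [X in _ = X + _]big1_seq ?add0r; last first.
      by move=> p /= /[!mem_index_iota] /andP[_ pk]; rewrite /c leqNgt pk.
    rewrite -{2}[k.+1]add0n big_addn mulr_sumr; apply: eq_bigr => j _.
    rewrite /c leq_addl -addSn addnK (_ : (j + k.+1 = k + j.+1)%N); last by lia.
    by rewrite exprD; ring.
  under eq_big_nat => k kK do rewrite (HTk k kK) mulr_sumr.
  rewrite exchange_big /= -sumrB subn0; apply: eq_big_nat => p /andP[_ pK].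
  rewrite add0n [RHS](big_cat_nat (n := p.+1))//=; last exact: ltnW.
  rewrite [X in _ = _ + X]big1_seq ?addr0; last first.
    by move=> k /= /[!mem_index_iota] /andP[pk _]; rewrite /c leqNgt pk mulr0.
  rewrite (eq_big_nat _ _ (F2 := fun k => em_weight x k / (p.+1 - k)`!%:R * (t ^+ p * g p a))).
    by rewrite -mulr_suml em_weight_rec exprMn; ring.
  by move=> k /andP[_ kp]; rewrite /c -ltnS kp; ring.
pose E i h := g i (a + h) - T i h.
have -> : g 0 (a + t) - g 0 (a + t * x) -
    \sum_(1 <= k < K.+1) em_weight x k * (t ^+ k.-1 * (g k.-1 (a + t) - g k.-1 a)) =
    E 0%N t - E 0%N (t * x) - \sum_(1 <= k < K.+1) em_weight x k * (t ^+ k.-1 * E k.-1 t).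
  rewrite (eq_bigr (fun k => em_weight x k * (t ^+ k.-1 * (T k.-1 t - g k.-1 a)) +
    em_weight x k * (t ^+ k.-1 * E k.-1 t))); last by move=> k _; rewrite /E; ring.
  by rewrite big_split /= -HT /E; ring.
have tX : t <= t * X by rewrite ler_peMr.
have txX : t * x <= t * X by rewrite ler_wpM2l.
rewrite (le_trans (ler_normB _ _))// mulrDl lerD//.
  rewrite (le_trans (ler_normB _ _))// mulrDl mul1r lerD//.
    by rewrite (le_trans (rem 0%N t _ _ _))// subn0 mulrC.
  rewrite (le_trans (rem 0%N _ _ _ txX))// ?mulr_ge0 ?(ltW x0)// subn0 exprMn.
  rewrite mulrC -mulrA mulrC -mulrA [M * _]mulrC.
  rewrite mulrC [leRHS]mulrC -!mulrA ler_wpM2l ?exprn_ge0// ler_wpM2l//.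
  by rewrite lerXn2r ?nnegrE ?(ltW x0)// (le_trans _ X1).
rewrite (le_trans (ler_norm_sum _ _ _))// mulr_suml; apply: ler_sum_nat => k /andP[k1 kK].
rewrite normrM ler_wpM2l// normrM normrX (ger0_norm t0).
have kK' : (k.-1 <= K)%N by rewrite (leq_trans (leq_pred _)).
rewrite (le_trans (ler_wpM2l (exprn_ge0 _ t0) (rem k.-1 t kK' t0 tX)))//.
by rewrite mulrCA -exprD subnKC// mulrC.
Qed.

End EulerMaclaurin.

Section EMSum.
Context {R : realType}.
Context (B : nat -> {poly R}) (hB : is_bernoulli_polynomials B).
Local Notation phi := (phi B).

(** A Riemann sum of [1 / (1 + y) ^ 2], compared with its integral [1] by
telescoping.  This is where one power of [t] is lost. *)
Lemma sum_riemann_le (t : R) M : 0 < t ->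
  \sum_(0 <= n < M) t / (1 + t * n%:R) ^+ 2 <= 1 + t.
Proof.
move=> t0; have p0 n : 0 < 1 + t * n%:R by rewrite ltr_pwDl// mulr_ge0 ?(ltW t0).
case: M => [|M]; first by rewrite big_geq// addr_ge0 ?(ltW t0).
suff : \sum_(0 <= n < M.+1) t / (1 + t * n%:R) ^+ 2 <= 1 + t - (1 + t * M%:R)^-1.
  by move=> /le_trans; apply; rewrite gerBl invr_ge0 ltW.
elim: M => [|M IH].
  by rewrite big_nat1 mulr0 addr0 expr1n invr1 mulr1 addrAC subrr add0r.
rewrite big_nat_recr//= (le_trans (lerD IH (lexx _)))//.
have := p0 M; have := p0 M.+1; rewrite -[M.+1%:R]natr1 mulrDr mulr1.
set a := 1 + t * M%:R; rewrite addrA -/a => b0 a0.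
rewrite -subr_ge0 (_ : _ - _ = t ^+ 2 / (a * (a + t) ^+ 2)).
  by rewrite divr_ge0 ?sqr_ge0// mulr_ge0 ?sqr_ge0// ltW.
by field; rewrite !gt_eqF.
Qed.

Definition phi_sum (x t : R) (M : nat) : R :=
  \sum_(0 <= n < M) (phi 0 (t * n.+1%:R) - phi 0 (t * (n%:R + x))).

Definition em_main (x t : R) (K M : nat) : R :=
  \sum_(1 <= k < K.+1) em_weight B x k *
    (t ^+ k.-1 * (phi k.-1 (t * M%:R) - phi k.-1 0)).

(** Summing [em_step] over the intervals of length [t], the main terms telescope and
the remainders form an absolutely convergent series by [phi_decay]. *)
Lemma em_sum (x : R) k : 0 < x -> exists2 C : R, 0 <= C & forall t, 0 < t -> t <= 1 ->
  exists2 l : R, `|l| <= C * t ^+ k.+1 &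
    phi_sum x t M - em_main x t k.+2 M @[M --> \oo] --> l.
Proof.
move=> x0; have [C C0 HC] := phi_decay hB k.
have b0 : 0 <= em_bound B x k.+2.
  rewrite /em_bound !addr_ge0//; last exact: sumr_ge0.
  by rewrite exprn_ge0// le_max ler01.
exists (em_bound B x k.+2 * C * 2); first by rewrite !mulr_ge0.
move=> t t0 t1.
pose v n : R := phi 0 (t * n.+1%:R) - phi 0 (t * (n%:R + x)) -
    \sum_(1 <= j < k.+3) em_weight B x j * (t ^+ j.-1 *
       (phi j.-1 (t * n.+1%:R) - phi j.-1 (t * n%:R))).
pose b := em_bound B x k.+2 * C * 2 * t ^+ k.+1.
have step n : `|v n| <=
    em_bound B x k.+2 * (t ^+ k.+2 * (C / (1 + t * n%:R) ^+ 2)).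
  have a0 : 0 <= t * n%:R by rewrite mulr_ge0 ?(ltW t0).
  rewrite /v -[n.+1%:R]natr1 !mulrDr mulr1.
  apply: (em_step hB (g := phi) _ _ x0 (ltW t0) a0).
  - by move=> j a b' a'; exact: phi_continuous.
  - by move=> j y y0; exact: is_derive_phi.
  move=> y ay _; have y0 : 0 <= y by rewrite (le_trans a0).
  rewrite (le_trans (HC y y0))// ler_wpM2l// lef_pV2 ?posrE ?exprn_gt0 ?ltr_pwDl//.
  by rewrite lerXn2r ?nnegrE ?addr_ge0// lerD2l.
have -> : (fun M => phi_sum x t M - em_main x t k.+2 M) = series v.
  apply/funext => M; rewrite /series /= /v sumrB; congr (_ - _).
  rewrite exchange_big /=; apply: eq_bigr => j _.
  rewrite -!mulr_sumr; congr (_ * (_ * _)).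
  by rewrite (telescope_sumr (fun n => phi j.-1 (t * n%:R)))// mulr0.
have sum_le M : \sum_(0 <= n < M) `|v n| <= b.
  rewrite (le_trans (ler_sum _ (fun n _ => step n)))//.
  have -> : \sum_(0 <= n < M) em_bound B x k.+2 * (t ^+ k.+2 * (C / (1 + t * n%:R) ^+ 2)) =
      em_bound B x k.+2 * C * t ^+ k.+1 * \sum_(0 <= n < M) t / (1 + t * n%:R) ^+ 2.
    by rewrite mulr_sumr; apply: eq_bigr => n _; rewrite exprSr; ring.
  rewrite /b [leRHS]mulrAC ler_wpM2l ?mulr_ge0 ?exprn_ge0 ?(ltW t0)//.
  rewrite (le_trans (sum_riemann_le _ t0))//; lra.
have nc : cvgn [normed series v] by exact: bounded_series_cvg sum_le.
exists (limn (series v)); last exact: normed_cvg.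
rewrite (le_trans (lim_series_norm nc))//.
by apply: limr_le => //; near=> M; exact: sum_le.
Unshelve. all: by end_near. Qed.

End EMSum.

(** * Gauss' product for the gamma function *)

Section GammaFunction.
Context {R : realType}.
Local Notation mu := (@lebesgue_measure R).

Definition euler (x u : R) : R := u `^ (x - 1) * expR (- u).

Lemma euler_ge0 x u : 0 <= euler x u.
Proof. by rewrite mulr_ge0 ?powR_ge0 ?expR_ge0. Qed.

Lemma is_derive_euler (x u : R) : 0 < u ->
  is_derive u 1 (euler (x + 1)) (x * euler x u - euler (x + 1) u).
Proof.
move=> u0.
have dN := is_derive_opp (is_derive_var u).
have dE := is_derive_comp (g := fun u => - u) (is_derive_expR (- u)) dN.
have dP := is_derive1_powR (x + 1 - 1) u0.
apply: (is_derive_eqr (is_derive_mul dP dE)).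
by rewrite /euler addrK; ring.
Qed.

Lemma euler_continuous (x u : R) : 0 < u -> {for u, continuous (euler x)}.
Proof.
move=> u0; rewrite -[x](subrK 1).
exact: is_derive_continuous (is_derive_euler (x - 1) u0).
Qed.

Lemma euler_within (x a b : R) : 0 < a -> {within `[a, b], continuous (euler x)}.
Proof.
move=> a0; apply: continuous_in_subspaceT => u; rewrite inE/= in_itv/=.
by move=> /andP[au _]; apply: euler_continuous; exact: lt_le_trans au.
Qed.

Lemma euler_integrable (x a b : R) : 0 < a ->
  mu.-integrable `[a, b] (EFin \o euler x).
Proof.
move=> a0; apply: continuous_compact_integrable; first exact: segment_compact.
exact: euler_within.
Qed.

Definition hi (n : nat) : R := n.+2%:R.

Lemma small_lt_hi n : small n < hi n.
Proof.
by rewrite (@lt_trans _ _ 1)// ?invf_lt1 ?ltr1n.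
Qed.

(** Truncations of Euler's integral to compact intervals of positive numbers.
Identities and inequalities are proved for them, where the integrand is
continuous, and then pass to the limit. *)
Definition gamma_part (x : R) (n : nat) : R :=
  \int[mu]_(u in `[small n, hi n]) euler x u.

Lemma gamma_partE x n :
  (\int[mu]_(u in `[small n, hi n]) (euler x u)%:E)%E = (gamma_part x n)%:E.
Proof.
rewrite /gamma_part /Rintegral fineK//.
by apply: integrable_fin_num => //; exact: euler_integrable (small_gt0 n).
Qed.

Lemma exhaust_nd : nondecreasing_seq (fun n => `[small n, hi n]%classic : set R).
Proof.
apply/nondecreasing_seqP => n; rewrite subsetEset; apply: subset_itv; rewrite bnd_simp.
  by rewrite lef_pV2 ?posrE// ler_nat.
by rewrite ler_nat.
Qed.

Lemma exhaust_bigcup : \bigcup_n `[small n, hi n]%classic = `]0, +oo[%classic :> set R.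
Proof.
apply/seteqP; split => u /=.
  by move=> [n _] /=; rewrite !in_itv /= andbT => /andP[+ _]; exact: lt_le_trans (small_gt0 n).
rewrite in_itv /= andbT => u0.
pose n := Num.truncn (Num.max u u^-1).
have hn : Num.max u u^-1 <= n.+1%:R by exact: ltW (truncnS_gt _).
exists n => //=; rewrite in_itv /=; apply/andP; split.
  rewrite /small -[leRHS]invrK lef_pV2 ?posrE ?invr_gt0//.
  rewrite (@le_trans _ _ n.+1%:R) ?ler_nat//.
  by rewrite (le_trans _ hn)// le_max lexx orbT.
by rewrite (@le_trans _ _ n.+1%:R) ?ler_nat// (le_trans _ hn)// le_max lexx.
Qed.

(** The integrand is nonnegative and the intervals increase to the half-line. *)
Lemma gamma_part_cvgE x : (gamma_part x n)%:E @[n --> \oo] -->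
  (\int[mu]_(u in `]0%R, +oo[) (euler x u)%:E)%E.
Proof.
have H : (\int[mu]_(u in `[small n, hi n]) (euler x u)%:E)%E @[n --> \oo] -->
    (\int[mu]_(u in \bigcup_n `[small n, hi n]%classic) (euler x u)%:E)%E.
  apply: (@ge0_nondecreasing_set_cvg_integral _ (measurableTypeR R) R
    (fun n => [set` `[small n, hi n]]) (fun u => (euler x u)%:E) mu exhaust_nd) => //.
  - by move=> n; exact: measurable_int (euler_integrable x (hi n) (small_gt0 n)).
  - by move=> n u _; rewrite lee_fin euler_ge0.
by move: H; rewrite exhaust_bigcup; under eq_fun do rewrite gamma_partE.
Qed.

Lemma gamma_part_nd x : nondecreasing_seq (gamma_part x).
Proof.
have H : nondecreasing_seq (fun n => (\int[mu]_(u in `[small n, hi n]) (euler x u)%:E)%E).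
  apply: (@ge0_nondecreasing_set_nondecreasing_integral _ (measurableTypeR R) R
    (fun n => [set` `[small n, hi n]]) (fun u => (euler x u)%:E) mu exhaust_nd) => //.
  - by move=> i; exact: measurable_int (euler_integrable x (hi i) (small_gt0 i)).
  - by move=> i u _; rewrite lee_fin euler_ge0.
by move=> m n mn; have := H _ _ mn; rewrite !gamma_partE lee_fin.
Qed.

(** Since [Gamma] is the finite part of an integral that could be infinite, its
value is obtained from a finite limit of the truncations. *)
Lemma gamma_part_Gamma x (l : R) : gamma_part x @ \oo --> l -> Gamma x = l.
Proof.
move=> xl; have H : (gamma_part x n)%:E @[n --> \oo] --> l%:E.
  by apply: cvg_EFin => //; near=> n.
rewrite /Gamma /Rintegral.
have -> : (\int[mu]_(u in `]0%R, +oo[) (u `^ (x - 1) * expR (- u))%:E)%E = l%:E.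
  rewrite -(cvg_lim _ H)//; apply/esym/cvg_lim => //.
  exact: gamma_part_cvgE.
by [].
Unshelve. all: by end_near. Qed.

(** Integration by parts, in the form of the fundamental theorem of calculus for
[euler (x + 1)]. *)
Lemma gamma_part_rec x n :
  x * gamma_part x n - gamma_part (x + 1) n = euler (x + 1) (hi n) - euler (x + 1) (small n).
Proof.
have a0 := small_gt0 (R := R) n.
have H := @continuous_FTC2 R (fun u => x * euler x u - euler (x + 1) u) (euler (x + 1)) _ _
  (small_lt_hi n).
have {}H : (\int[mu]_(u in `[small n, hi n]) (x * euler x u - euler (x + 1) u)%:E)%E =
    ((euler (x + 1) (hi n))%:E - (euler (x + 1) (small n))%:E)%E.
  apply: H.
  - move=> u; apply: cvgB; last exact: euler_within.
    by apply: cvgM; [exact: cvg_cst|exact: euler_within].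
  - split.
    + move=> u; rewrite in_itv /= => /andP[au _].
      by have [] := is_derive_euler x (lt_trans a0 au).
    + apply: cvg_at_right_filter; exact: euler_continuous.
    + apply: cvg_at_left_filter; apply: euler_continuous; exact: lt_trans (small_lt_hi n).
  - move=> u; rewrite in_itv /= => /andP[au _].
    by rewrite derive1E; have [_ ->] := is_derive_euler x (lt_trans a0 au).
have iZ : mu.-integrable `[small n, hi n] (EFin \o (fun u => x * euler x u)).
  apply: continuous_compact_integrable; first exact: segment_compact.
  by move=> u; apply: cvgM; [exact: cvg_cst|exact: euler_within].
rewrite /gamma_part -RintegralZl//; last exact: euler_integrable.
rewrite -RintegralB//; last exact: euler_integrable.
by rewrite /Rintegral H -EFinB.
Qed.

End GammaFunction.

Section GaussProduct.
Context {R : realType}.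
Local Notation mu := (@lebesgue_measure R).

Lemma euler_lo (x : R) : 0 < x -> euler (x + 1) (@small R n) @[n --> \oo] --> (0 : R).
Proof.
move=> x0; apply: (squeeze_cvgr _ (cvg_cst 0) (cvg_powN x0)); near=> n.
rewrite euler_ge0 /= /euler addrK.
have l0 := small_gt0 (R := R) n.
rewrite /powR gt_eqF// lnV ?posrE// mulrN ler_piMr ?expR_ge0//.
by rewrite expR_le1 oppr_le0 ltW.
Unshelve. all: by end_near. Qed.

Lemma euler_hi (x : R) : euler (x + 1) (@hi R n) @[n --> \oo] --> (0 : R).
Proof.
pose m := (Num.truncn x).+1.
have xm : x <= m%:R by exact: ltW (truncnS_gt _).
have H : m.+1`!%:R * @small R n @[n --> \oo] --> (0 : R).
  by rewrite -[X in _ --> X](mulr0 m.+1`!%:R); apply: cvgM; [exact: cvg_cst|exact: cvg_small].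
apply: (squeeze_cvgr _ (cvg_cst 0) H); near=> n.
rewrite euler_ge0 /= /euler addrK.
have h0 : 0 < @hi R n by rewrite ltr0n.
have h1 : 1 <= @hi R n by rewrite ler1n.
have f0 : 0 < m.+1`!%:R :> R by rewrite ltr0n fact_gt0.
rewrite (@le_trans _ _ (@hi R n ^+ m * expR (- @hi R n)))//.
  by rewrite ler_wpM2r ?expR_ge0// -powR_mulrn ?(ltW h0)// ler_powR.
rewrite expRN ler_pdivrMr ?expR_gt0//.
have e1 : @hi R n ^+ m.+1 / m.+1`!%:R <= expR (@hi R n).
  by have := expR_ge1Dxn m (ltW h0); lra.
rewrite (le_trans _ (ler_wpM2l _ e1)) ?mulr_ge0 ?(ltW f0) ?invr_ge0 ?(ltW h0)//.
rewrite le_eqVlt; apply/orP; left; apply/eqP.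
by rewrite /small -/(@hi R n) exprS; field; rewrite !gt_eqF.
Unshelve. all: by end_near. Qed.

Lemma gamma_part_rec_cvg (x : R) : 0 < x ->
  x * gamma_part x n - gamma_part (x + 1) n @[n --> \oo] --> (0 : R).
Proof.
move=> x0; rewrite -[X in _ --> X](subrr 0).
under eq_fun do rewrite gamma_part_rec.
by apply: cvgB; [exact: euler_hi|exact: euler_lo].
Qed.

Lemma gamma_part1 : gamma_part 1 @ \oo --> (1 : R).
Proof.
pose F (u : R) := - expR (- u).
have dF (u : R) : is_derive u 1 F (euler 1 u).
  have dN := is_derive_opp (is_derive_var u).
  have dE := is_derive_opp (is_derive_comp (g := fun u => - u) (is_derive_expR (- u)) dN).
  by apply: (is_derive_eqr dE); rewrite /euler subrr powRr0 mulrN1 opprK mul1r.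
have E n : gamma_part 1 n = F (@hi R n) - F (@small R n).
  have lh := small_lt_hi (R := R) n; have l0 := small_gt0 (R := R) n.
  have cF u : {for u, continuous F} := is_derive_continuous (dF u).
  apply/EFin_inj; rewrite -gamma_partE EFinB.
  apply: (continuous_FTC2 lh).
  - exact: euler_within.
  - split; first by move=> u _; case: (dF u).
      by apply: cvg_at_right_filter; exact: cF.
    by apply: cvg_at_left_filter; exact: cF.
  - by move=> u _; rewrite derive1E; case: (dF u).
have H : F (@hi R n) - F (@small R n) @[n --> \oo] --> - 0 - - (expR (- 0) : R).
  apply: cvgB; apply: cvgN; last first.
    apply: continuous_cvg; first exact: continuous_expR.
    by apply: cvgN; exact: cvg_small.
  have := @euler_hi 0; apply: cvg_trans; apply: near_eq_cvg; near=> n.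
  by rewrite /euler addrK powRr0 mul1r.
rewrite oppr0 expR0 sub0r opprK in H.
by rewrite (_ : gamma_part 1 = fun n => F (@hi R n) - F (@small R n))//; apply/funext.
Unshelve. all: by end_near. Qed.

Lemma gamma_part_succ (x l : R) : 0 < x ->
  gamma_part x @ \oo --> l -> gamma_part (x + 1) @ \oo --> x * l.
Proof.
move=> x0 xl; rewrite -[X in _ --> X](subr0 (x * l)).
have -> : gamma_part (x + 1) =
    (fun n => x * gamma_part x n - (x * gamma_part x n - gamma_part (x + 1) n)).
  by apply/funext => n; rewrite opprB addrCA subrr addr0.
apply: cvgB; last exact: gamma_part_rec_cvg.
by apply: cvgM => //; exact: cvg_cst.
Qed.

Lemma gamma_part_fact m : gamma_part m.+1%:R @ \oo --> (m`!%:R : R).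
Proof.
elim: m => [|m IH]; first by rewrite fact0; exact: gamma_part1.
by rewrite -natr1 factS natrM; apply: gamma_part_succ.
Qed.

(** By [gamma_part_rec] it suffices to treat [x + 1], where [u `^ x <= 1 + u `^ m]
for a natural number [m >= x] and the truncations are bounded by [1 + m!]. *)
Lemma gamma_part_cvg (x : R) : 0 < x -> gamma_part x @ \oo --> Gamma x.
Proof.
suff H : 0 < x -> cvgn (gamma_part x).
  by move=> /H xc; have := xc; move/(gamma_part_Gamma) => ->.
move=> x0.
have c1 : cvgn (gamma_part (x + 1)).
  apply: nondecreasing_is_cvgn; first exact: gamma_part_nd.
  pose m := (Num.truncn x).+1.
  have xm : x <= m%:R by exact: ltW (truncnS_gt _).
  exists (1 + m`!%:R) => _ [n _ <-].
  have le1 : gamma_part 1 n <= (1 : R).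
    have c : cvgn (gamma_part (1 : R)) by apply/cvg_ex; eexists; exact: gamma_part1.
    rewrite -[leRHS](cvg_lim _ gamma_part1)//.
    exact: (nondecreasing_cvgn_le (gamma_part_nd 1) c).
  have lem : gamma_part m.+1%:R n <= m`!%:R :> R.
    have c : cvgn (gamma_part (m.+1%:R : R)) by apply/cvg_ex; eexists; exact: gamma_part_fact.
    rewrite -[leRHS](cvg_lim _ (@gamma_part_fact m))//.
    exact: (nondecreasing_cvgn_le (gamma_part_nd _) c).
  rewrite (le_trans _ (lerD le1 lem))//.
  have l0 := small_gt0 (R := R) n.
  rewrite /gamma_part -RintegralD//; try exact: euler_integrable.
  apply: le_Rintegral => //; first exact: euler_integrable.
    apply: continuous_compact_integrable; first exact: segment_compact.
    by move=> u; apply: cvgD; exact: euler_within.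
  move=> u /=; rewrite in_itv /= => /andP[lu _].
  have u0 : 0 < u := lt_le_trans l0 lu.
  rewrite /euler -mulrDl ler_wpM2r ?expR_ge0// addrK subrr powRr0 -natr1 addrK.
  have [u1|/ltW u1] := leP 1 u.
    by rewrite (le_trans (ler_powR u1 xm))// lerDr.
  by rewrite (@le_trans _ _ 1) ?lerDl ?powR_ge0// -(powRr0 u) ger_powR ?u0 ?u1 ?(ltW x0).
apply/cvg_ex; exists (x^-1 * limn (gamma_part (x + 1))).
have -> : gamma_part x = (fun n => x^-1 * (gamma_part (x + 1) n +
    (x * gamma_part x n - gamma_part (x + 1) n))).
  by apply/funext => n; rewrite addrCA subrr addr0 mulKf ?gt_eqF.
apply: cvgM; first exact: cvg_cst.
rewrite -[X in _ --> X]addr0; apply: cvgD => //; exact: gamma_part_rec_cvg.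
Qed.

Lemma GammaS (x : R) : 0 < x -> Gamma (x + 1) = x * Gamma x.
Proof.
by move=> x0; apply: gamma_part_Gamma; apply: gamma_part_succ => //; exact: gamma_part_cvg.
Qed.

Lemma Gamma_nat m : Gamma (m.+1%:R : R) = m`!%:R.
Proof. by apply: gamma_part_Gamma; exact: gamma_part_fact. Qed.

Lemma Gamma_ge0 (x : R) : 0 <= Gamma x.
Proof. by apply: Rintegral_ge0 => u _; exact: euler_ge0. Qed.

(** Both [expR l] and [1] are compared with the tangent to [expR] at [x * l]. *)
Lemma expR_convex_le (l x : R) : 0 <= x -> x <= 1 ->
  expR (x * l) <= (1 - x) + x * expR l.
Proof.
move=> x0 x1.
have h1 := expR_ge1Dx ((1 - x) * l); have h2 := expR_ge1Dx (- (x * l)).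
have e0 := expR_gt0 (x * l).
have E1 : expR l = expR (x * l) * expR ((1 - x) * l) by rewrite -expRD; congr expR; ring.
have E2 : 1 = expR (x * l) * expR (- (x * l)) by rewrite -expRD subrr expR0.
have E3 : 1 - x = (1 - x) * (expR (x * l) * expR (- (x * l))) by rewrite -E2 mulr1.
rewrite E1 [X in _ <= X + _]E3.
move: (expR (x * l)) (expR ((1 - x) * l)) (expR (- (x * l))) h1 h2 e0.
move=> a b c h1 h2 a0.
have -> : (1 - x) * (a * c) + x * (a * b) = a * ((1 - x) * c + x * b) by ring.
rewrite ler_peMr ?(ltW a0)//.
have : (1 - x) * (1 - x * l) <= (1 - x) * c by rewrite ler_wpM2l// subr_ge0.
have : x * (1 + (1 - x) * l) <= x * b by rewrite ler_wpM2l.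
lra.
Qed.

(** Integrate the weighted arithmetic-geometric mean inequality
[(u / y) `^ x <= (1 - x) + x * (u / y)] against the gamma density of parameter
[y], whose mean is [y] by [GammaS]. *)
Lemma Gamma_le (y x : R) : 0 < y -> 0 <= x -> x <= 1 ->
  Gamma (y + x) <= y `^ x * Gamma y.
Proof.
move=> y0 x0 x1.
have c1 := @gamma_part_cvg (y + x) (ltr_wpDr x0 y0).
have c2 := gamma_part_cvg y0; have c3 := @gamma_part_cvg (y + 1) (addr_gt0 y0 ltr01).
pose p := y `^ x.
have p0 : 0 < p by exact: powR_gt0.
have H : p * ((1 - x) * gamma_part y n + x / y * gamma_part (y + 1) n) @[n --> \oo] -->
    p * ((1 - x) * Gamma y + x / y * Gamma (y + 1)).
  apply: cvgM; first exact: cvg_cst.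
  by apply: cvgD; (apply: cvgM; first exact: cvg_cst); [exact: c2|exact: c3].
have -> : p * Gamma y = p * ((1 - x) * Gamma y + x / y * Gamma (y + 1)).
  by rewrite GammaS//; field; rewrite gt_eqF.
rewrite -(cvg_lim _ c1)// -(cvg_lim _ H)//.
apply: ler_lim; [by apply/cvg_ex; eexists; exact: c1|by apply/cvg_ex; eexists; exact: H|].
near=> n; have l0 := small_gt0 (R := R) n.
have iZ (c : R) z : mu.-integrable `[@small R n, @hi R n] (EFin \o (fun u => c * euler z u)).
  apply: continuous_compact_integrable; first exact: segment_compact.
  by move=> u; apply: cvgM; [exact: cvg_cst|exact: euler_within].
rewrite /gamma_part -!RintegralZl//; try exact: euler_integrable.
rewrite -RintegralD// -RintegralZl//; last first.
  apply: continuous_compact_integrable; first exact: segment_compact.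
  by move=> u; apply: cvgD; apply: cvgM; (exact: cvg_cst || exact: euler_within).
apply: le_Rintegral => //; first exact: euler_integrable.
  apply: continuous_compact_integrable; first exact: segment_compact.
  move=> u; apply: cvgM; first exact: cvg_cst.
  by apply: cvgD; apply: cvgM; (exact: cvg_cst || exact: euler_within).
move=> u /=; rewrite in_itv /= => /andP[lu _].
have u0 : 0 < u := lt_le_trans l0 lu.
have un0 : u != 0 by rewrite gt_eqF.
have yn0 : y != 0 by rewrite gt_eqF.
have e1 : euler (y + x) u = u `^ x * euler y u.
  rewrite /euler mulrA -powRD; last by rewrite un0 implybT.
  by congr (_ `^ _ * _); ring.
have e2 : euler (y + 1) u = u * euler y u.
  by rewrite /euler addrK mulrA mulr_powRB1 ?(ltW u0).
have AM : u `^ x <= p * ((1 - x) + x / y * u).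
  have -> : u `^ x = p * expR (x * ln (u / y)).
    rewrite /p /powR (negPf un0) (negPf yn0) ln_div ?posrE// -expRD.
    by rewrite mulrBr addrCA subrr addr0.
  rewrite ler_wpM2l ?(ltW p0)// (le_trans (expR_convex_le _ x0 x1))//.
  by rewrite lnK ?posrE ?divr_gt0// lerD2l mulrAC mulrA.
have -> : p * ((1 - x) * euler y u + x / y * euler (y + 1) u) =
    p * ((1 - x) + x / y * u) * euler y u by rewrite e2; ring.
by rewrite e1 ler_wpM2r ?euler_ge0.
Unshelve. all: by end_near. Qed.

(** [Gamma_le] bounds [Gamma 2 = 1] by a multiple of [Gamma (1 + x) = x * Gamma x]. *)
Lemma Gamma_gt0 (x : R) : 0 < x -> x <= 1 -> 0 < Gamma x.
Proof.
move=> x0 x1; have x10 : 0 < 1 + x by rewrite addr_gt0.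
have y0 : 0 <= 1 - x by rewrite subr_ge0.
have y1 : 1 - x <= 1 by rewrite gerBl (ltW x0).
have := Gamma_le x10 y0 y1.
have -> : 1 + x + (1 - x) = 2%:R :> R by ring.
rewrite (Gamma_nat 1) factS fact0 [1 + x]addrC GammaS// => h.
rewrite lt0r Gamma_ge0 andbT; apply/eqP => G0; move: h; rewrite G0 !mulr0.
by rewrite ler10.
Qed.

Definition pochhammer (x : R) M := \prod_(0 <= n < M) (n%:R + x).

Lemma pochhammer_gt0 x M : 0 < x -> 0 < pochhammer x M.
Proof. by move=> x0; apply: prodr_gt0 => n _; rewrite ltr_wpDl. Qed.

Lemma Gamma_pochhammer x M : 0 < x -> Gamma (M%:R + x) = pochhammer x M * Gamma x.
Proof.
move=> x0; elim: M => [|M IH]; first by rewrite add0r /pochhammer big_geq// mul1r.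
have Mx : 0 < M%:R + x by rewrite ltr_wpDl.
rewrite -natr1 addrAC (GammaS Mx) IH.
by rewrite /pochhammer [in RHS]big_nat_recr// mulrCA mulrA.
Qed.

Definition gauss (x : R) (M : nat) : R := M`!%:R * M%:R `^ (x - 1) / pochhammer x M.

(** Apply [Gamma_le] twice, going from [M] to [M + x] and from [M + x] to [M + 1]:
[Gamma (M + x)] is squeezed between two powers of [M] times factorials, and
dividing by [x (x + 1) ... (x + M - 1)] gives [Gamma x]. *)
Lemma gauss_unit_cvg x : 0 < x -> x <= 1 -> gauss x @ \oo --> Gamma x.
Proof.
move=> x0 x1; have G0 := Gamma_gt0 x0 x1.
have HU : Gamma x * (1 + x * small n) `^ (1 - x) @[n --> \oo] --> Gamma x.
  rewrite -[X in _ --> X]mulr1; apply: cvgM; first exact: cvg_cst.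
  have H : (1 - x) * ln (1 + x * @small R n) @[n --> \oo] --> (1 - x) * ln 1.
    apply: cvgM; first exact: cvg_cst.
    apply: continuous_cvg; first by apply: continuous_ln.
    rewrite -[X in _ --> X](addr0 1) -[X in 1 + X](mulr0 x).
    apply: cvgD; first exact: cvg_cst.
    by apply: cvgM; [exact: cvg_cst|exact: cvg_small].
  rewrite ln1 mulr0 in H.
  have {H} : expR ((1 - x) * ln (1 + x * @small R n)) @[n --> \oo] --> expR 0.
    by apply: continuous_cvg => //; exact: continuous_expR.
  rewrite expR0; apply: cvg_trans; apply: near_eq_cvg; near=> n.
  by rewrite /powR gt_eqF// ltr_pwDl// mulr_ge0 ?ltW// small_gt0.
have : gauss x (n + 2)%N @[n --> \oo] --> Gamma x.
  apply: (squeeze_cvgr _ (cvg_cst (Gamma x)) HU); near=> n; rewrite addn2.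
  have M0 : 0 < n.+2%:R :> R by [].
  have P0 := pochhammer_gt0 n.+2 x0.
  have Mx0 : 0 < n.+2%:R + x by rewrite addr_gt0.
  have fE : (n.+2)`!%:R * n.+2%:R `^ (x - 1) = n.+2%:R `^ x * (n.+1)`!%:R :> R.
    by rewrite factS natrM mulrAC mulr_powRB1 ?(ltW M0).
  have fM : 0 < (n.+2)`!%:R :> R by rewrite ltr0n fact_gt0.
  apply/andP; split.
    rewrite /gauss ler_pdivlMr// mulrC -Gamma_pochhammer// fE -Gamma_nat.
    by apply: Gamma_le => //; exact: ltW.
  rewrite /gauss ler_pdivrMr// mulrAC -[Gamma x * _]mulrC -Gamma_pochhammer//.
  have y0 : 0 <= 1 - x by rewrite subr_ge0.
  have y1 : 1 - x <= 1 by rewrite gerBl (ltW x0).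
  have h := Gamma_le Mx0 y0 y1.
  rewrite (_ : n.+2%:R + x + (1 - x) = n.+3%:R) ?Gamma_nat in h; last first.
    by rewrite -[n.+3%:R]natr1; ring.
  have -> : 1 + x * @small R n = (n.+2%:R + x) * n.+2%:R^-1.
    by rewrite mulrDl divff ?gt_eqF.
  rewrite powRM ?invr_ge0 ?(ltW Mx0) ?(ltW M0)//.
  have -> : n.+2%:R^-1 `^ (1 - x) = n.+2%:R `^ (x - 1) :> R.
    by rewrite -powR_inv1 ?(ltW M0)// -powRrM; congr (_ `^ _); ring.
  by rewrite mulrA ler_wpM2r ?powR_ge0// mulrC.
by rewrite (cvg_shiftn 2 (gauss x)).
Unshelve. all: by end_near. Qed.

Lemma gauss_succ x M : 0 < x -> (0 < M)%N ->
  gauss (x + 1) M = gauss x M * (x * (M%:R / (M%:R + x))).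
Proof.
move=> x0 M0.
have P : x * pochhammer (x + 1) M = pochhammer x M * (M%:R + x).
  rewrite /pochhammer -[RHS](big_nat_recr M 0 (fun n => n%:R + x))// big_nat_recl//= add0r.
  by congr (_ * _); apply: eq_bigr => n _; rewrite -natr1; ring.
have P0 := pochhammer_gt0 M x0; have P1 := pochhammer_gt0 M (addr_gt0 x0 ltr01).
have Mr : 0 < M%:R :> R by rewrite ltr0n.
have Mx : 0 < M%:R + x by rewrite addr_gt0.
rewrite /gauss addrK -(mulr_powRB1 (ltW Mr) x0).
have -> : pochhammer (x + 1) M = pochhammer x M * (M%:R + x) / x.
  by rewrite -P mulrAC mulfV ?mul1r// gt_eqF.
by field; rewrite !gt_eqF.
Qed.

(** The functional equations of [gauss] and of [Gamma] carry the result from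
[x - 1] to [x]. *)
Lemma gauss_cvg_pos x : 0 < x -> gauss x @ \oo --> Gamma x /\ 0 < Gamma x.
Proof.
suff H m : 0 < x -> x <= m.+1%:R -> gauss x @ \oo --> Gamma x /\ 0 < Gamma x.
  by move=> x0; apply: (H (Num.truncn x)) => //; exact: ltW (truncnS_gt _).
elim: m x => [|m IH] x x0 xm.
  by split; [exact: gauss_unit_cvg|exact: Gamma_gt0].
have [x1|x1] := leP x 1.
  by split; [exact: gauss_unit_cvg|exact: Gamma_gt0].
have y0 : 0 < x - 1 by rewrite subr_gt0.
have [yc yG] : gauss (x - 1) @ \oo --> Gamma (x - 1) /\ 0 < Gamma (x - 1).
  by apply: IH => //; rewrite lerBlDr natr1.
rewrite -[x](subrK 1); move: (x - 1) y0 yc yG => y y0 yc yG.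
rewrite GammaS//; split; last by rewrite mulr_gt0.
have H : y * (M.+2%:R / (M.+2%:R + y)) @[M --> \oo] --> y.
  rewrite -[X in _ --> X]mulr1; apply: cvgM; first exact: cvg_cst.
  have H : (1 + y * @small R n)^-1 @[n --> \oo] --> (1 : R).
    rewrite -[X in _ --> X]invr1; apply: cvgV; first exact: oner_neq0.
    rewrite -[X in _ --> X](addr0 1) -[X in 1 + X](mulr0 y).
    apply: cvgD; first exact: cvg_cst.
    by apply: cvgM; [exact: cvg_cst|exact: cvg_small].
  apply: cvg_trans H; apply: near_eq_cvg; near=> n.
  have M0 : n.+2%:R != 0 :> R by rewrite pnatr_eq0.
  have My0 : n.+2%:R + y != 0 by rewrite gt_eqF// addr_gt0.
  rewrite /small; have -> : 1 + y / n.+2%:R = (n.+2%:R + y) / n.+2%:R.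
    by rewrite mulrDl divff.
  by rewrite invfM invrK mulrC.
have : gauss (y + 1) (n + 2)%N @[n --> \oo] --> Gamma y * y.
  have yc2 : gauss y (n + 2)%N @[n --> \oo] --> Gamma y.
    by rewrite (cvg_shiftn 2 (gauss y)).
  have H2 : gauss y (n + 2)%N * (y * (n.+2%:R / (n.+2%:R + y))) @[n --> \oo]
    --> Gamma y * y by exact: cvgM yc2 H.
  apply: cvg_trans H2; apply: near_eq_cvg; near=> n.
  by rewrite /= addn2 gauss_succ.
by rewrite (cvg_shiftn 2 (gauss _)) mulrC.
Unshelve. all: by end_near. Qed.

End GaussProduct.

(** * The asymptotic expansion of the q-gamma function *)

Section QGammaLimit.
Context {R : realType}.
Context (B : nat -> {poly R}) (hB : is_bernoulli_polynomials B).
Local Notation phi := (phi B).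
Local Notation phi_sum := (phi_sum B).
Local Notation em_main := (em_main B).
Local Notation em_weight := (em_weight B).

Definition qprod (x q : R) (M : nat) : R :=
  \prod_(0 <= n < M) ((1 - q ^+ n.+1) / (1 - q `^ (n%:R + x))).

Lemma one_sub_expRN y : 0 < y -> 1 - expR (- y) = y * expR (phi 0 y).
Proof.
move=> y0; have p0 : 0 < 1 - expR (- y) by rewrite subr_gt0 expR_lt1 oppr_lt0.
by rewrite /phi y0 /phi_pos expRB !lnK ?posrE// mulrC divfK ?gt_eqF.
Qed.

Lemma qprodE x t M : 0 < x -> 0 < t ->
  qprod x (expR (- t)) M = M`!%:R / pochhammer x M * expR (phi_sum x t M).
Proof.
move=> x0 t0; rewrite /qprod /phi_sum /pochhammer expR_sum.
rewrite fact_prod natr_prod big_add1 -prodf_div -big_split /=; apply: eq_bigr => n _.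
have nx : 0 < n%:R + x by rewrite ltr_wpDl.
have -> : expR (- t) ^+ n.+1 = expR (- (t * n.+1%:R)).
  by rewrite -expRM_natr mulNr.
rewrite -expRM mulNr !one_sub_expRN ?mulr_gt0// expRB.
by field; rewrite !gt_eqF ?expR_gt0.
Qed.

(** Since [ln M = ln (1 - expR (- t M)) - ln t - phi (t M)], the power [M ^ (1 - x)]
that is missing from Gauss' product is traded for a boundary term of the
Euler-Maclaurin formula and factors that converge. *)
Lemma qprod_gauss x t M : 0 < x -> 0 < t -> (0 < M)%N ->
  qprod x (expR (- t)) M = gauss x M *
    expR ((1 - x) * (ln (1 - expR (- (t * M%:R))) - ln t)
          + (phi_sum x t M - (1 - x) * phi 0 (t * M%:R))).
Proof.
move=> x0 t0 M0; have Mr : 0 < M%:R :> R by rewrite ltr0n.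
rewrite qprodE// /gauss /powR gt_eqF// mulrAC [RHS]mulrAC -[_ * _ * expR _]mulrA -expRD.
congr (_ * expR _ / _); rewrite /phi mulr_gt0// /phi_pos lnM ?posrE//; ring.
Qed.

(** The boundary terms at [0], with the sign changed; [k = 1] is left out because
[phi 0 0 = 0]. *)
Definition em_const (x t : R) (K : nat) : R :=
  \sum_(2 <= k < K) em_weight x k * (t ^+ k.-1 * phi k.-1 0).

(** The boundary terms at infinity tend to [0], and the one of [k = 1] has been
absorbed by [qprod_gauss].  The term of order [k + 2] at [0] has the size of the
error and is counted with it. *)
Lemma qprod_cvg x k : 0 < x -> exists2 C : R, 0 <= C & forall t, 0 < t -> t <= 1 ->
  exists2 e : R, `|e| <= C * t ^+ k.+1 &
    qprod x (expR (- t)) @ \oo -->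
      Gamma x * expR ((x - 1) * ln t - em_const x t k.+2 + e).
Proof.
move=> x0; have [C C0 HC] := em_sum hB k x0.
pose c := em_weight x k.+2 * phi k.+1 0.
exists (C + `|c|); first by rewrite addr_ge0.
move=> t t0 t1; have [l ll hl] := HC t t0 t1.
exists (l - c * t ^+ k.+1).
  rewrite (le_trans (ler_normB _ _))// mulrDl lerD// normrM ler_wpM2l//.
  by rewrite ger0_norm// exprn_ge0 ?(ltW t0).
pose S := \sum_(2 <= j < k.+3) em_weight x j * (t ^+ j.-1 * (0 - phi j.-1 0)).
have phi0M : phi 0 0 = 0 by rewrite /phi ltxx.
have Elim : phi_sum x t M - (1 - x) * phi 0 (t * M%:R) @[M --> \oo] -->
    l + S.
  have -> : (fun M => phi_sum x t M - (1 - x) * phi 0 (t * M%:R)) =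
    (fun M => phi_sum x t M - em_main x t k.+2 M +
       \sum_(2 <= j < k.+3) em_weight x j * (t ^+ j.-1 * (phi j.-1 (t * M%:R) - phi j.-1 0))).
    apply/funext => M; rewrite /em_main [X in _ = _ - X + _]big_ltn//= phi0M expr0 subr0 mul1r.
    have -> : em_weight x 1 = 1 - x.
      by rewrite /em_weight !(bern1 hB); ring.
    by ring.
  apply: cvgD => //; rewrite /S 2!big_add1 /=.
  under eq_fun do rewrite 2!big_add1 /=.
  apply: cvg_big => [|j _]; first exact: add_continuous.
  apply: cvgM; first exact: cvg_cst.
  apply: cvgM; first exact: cvg_cst.
  apply: cvgB; last exact: cvg_cst.
  exact: phi_cvg.
have [G0 G1] := gauss_cvg_pos x0.
have -> : Gamma x * expR ((x - 1) * ln t - em_const x t k.+2 + (l - c * t ^+ k.+1)) =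
  Gamma x * expR ((1 - x) * (ln (1 - 0) - ln t) + (l + S)).
  congr (_ * expR _); rewrite subr0 ln1 sub0r /em_const /S.
  rewrite [in RHS]big_nat_recr//= /c.
  under [in RHS]eq_bigr do rewrite sub0r !mulrN.
  rewrite sumrN; ring.
suff H : gauss x M *
    expR ((1 - x) * (ln (1 - expR (- (t * M%:R))) - ln t)
          + (phi_sum x t M - (1 - x) * phi 0 (t * M%:R))) @[M --> \oo] -->
  Gamma x * expR ((1 - x) * (ln (1 - 0) - ln t) + (l + S)).
  apply: cvg_trans H; apply: near_eq_cvg; near=> M.
  by rewrite qprod_gauss//; near: M; exact: nbhs_infty_gt.
apply: cvgM => //; apply: continuous_cvg; first exact: continuous_expR.
apply: cvgD => //; apply: cvgM; first exact: cvg_cst.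
apply: cvgB; last exact: cvg_cst.
apply: continuous_cvg; first by apply: continuous_ln; rewrite subr0.
apply: cvgB; first exact: cvg_cst.
apply: (cvg_comp _ _ _ (@cvgr_expR R)).
apply/cvgryPge => A; near=> M; rewrite -ler_pdivrMl//.
by near: M; exact: nbhs_infty_ger.
Unshelve. all: by end_near. Qed.

Context (zeta : R[i] -> R[i]) (hzeta : is_riemann_zeta zeta).

(** For odd [k], [bern 1 k = 0] and the sign of [t ^ k.-1] does not change; for even
[k], both sides contain the vanishing factor [bern 0 k.-1]. *)
Lemma em_const_zeta x t k : (2 < k)%N ->
  em_weight x k * (t ^+ k.-1 * phi k.-1 0) =
  complex.Re (zeta (2 - k%:R)) / k`!%:R * (B k).[x] * (- t) ^+ k.-1.
Proof.
case: k => [|[|[|m]]] // _ /=.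
have -> : 2 - m.+3%:R = - m.+1%:R :> R[i] by rewrite -[m.+3]addn2 natrD; ring.
have -> : phi m.+2 0 = bern B 0 m.+2 * m.+1`!%:R by rewrite /phi ltxx.
rewrite (zeta_neg hB hzeta) (bern_01 hB)//.
have [om|em] := boolP (odd m.+2).
  rewrite (bern_odd hB om)//; ring.
have -> : (- t) ^+ m.+2 = t ^+ m.+2 by rewrite exprNn -signr_odd (negPf em) mul1r.
have b0 : bern B 0 m.+3 = 0 by rewrite (bern_odd hB)//= em.
by rewrite /em_weight (bern_01 hB)// b0 /bern; ring.
Qed.

(** The term [k = 2] is computed from [bern 0 1 = - 1 / 2] and
[bern x 2 = (x ^ 2 - x + 1 / 6) / 2]. *)
Lemma em_const_exp x t k : (2 < k)%N ->
  em_const x t k = t * x * (x - 1) / 4 + \sum_(3 <= j < k)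
    complex.Re (zeta (2 - j%:R)) / j`!%:R * (B j).[x] * (- t) ^+ j.-1.
Proof.
move=> k2; rewrite /em_const big_ltn//; congr (_ + _).
  have -> : phi 2.-1 0 = bern B 0 1 by rewrite /phi /= ltxx mulr1.
  by rewrite /em_weight !(bern2 hB) (bern1 hB) expr1; field.
by apply: eq_big_nat => j /andP[j2 _]; exact: em_const_zeta.
Qed.

Lemma expR_sub1_le (c e : R) : `|e| <= c -> `|expR e - 1| <= expR c * `|e|.
Proof.
move=> ec; have [e0|/ltW e0] := leP 0 e.
  have e1 : 1 <= expR e by rewrite -expR0 ler_expR.
  rewrite ger0_norm ?subr_ge0//.
  have : e * expR e <= e * expR c by rewrite ler_wpM2l// ler_expR (le_trans (ler_norm e)).
  have : expR e * (1 + - e) <= expR e * expR (- e).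
    by rewrite ler_wpM2l ?expR_ge0// expR_ge1Dx.
  by rewrite -expRD subrr expR0 (ger0_norm e0); lra.
have e1 : expR e <= 1 by rewrite expR_le1.
rewrite ler0_norm ?subr_le0// opprB.
rewrite (@le_trans _ _ `|e|)//; first by rewrite ler0_norm//; have := expR_ge1Dx e; lra.
by rewrite ler_peMl// -expR0 ler_expR (le_trans _ ec).
Qed.

End QGammaLimit.

Theorem theorem4p1 (R : realType) (zeta : R[i] -> R[i]) (B : nat -> {poly R})
    (hzeta : is_riemann_zeta zeta) (hB : is_bernoulli_polynomials B)
    (x : R) (hx : 0 < x) :
  asymptotic_product (FilterType 1^'- _) (fun k q => ln q ^+ k.-1)
    (fun q => qGamma q x)
    (fun q => Gamma x * (ln q / (q - 1) * q `^ (x / 4)) `^ (x - 1))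
    3
    (fun k q => expR (- (complex.Re (zeta (2 - k%:R)) / k`!%:R
                         * (B k).[x] * ln q ^+ k.-1))).
Proof.
move=> N N3; have [k Nk] : exists k, N = k.+2 by exists N.-2; lia.
have [C C0 HC] := qprod_cvg hB k hx.
apply/eqO_exP; exists (expR C * (C + 1)); first by rewrite mulr_gt0 ?expR_gt0 ?ltr_wpDl.
near=> q.
have q1 : q < 1 by [].
have qe : expR (- 1) <= q.
  by near: q; apply: nbhs_left_ge; rewrite expR_lt1 oppr_lt0.
have q0 : 0 < q by exact: lt_le_trans (expR_gt0 _) qe.
have [t qt] : exists t, q = expR (- t) by exists (- ln q); rewrite opprK lnK.
have t0 : 0 < t by rewrite -oppr_lt0 -expR_lt1 -qt.
have t1 : t <= 1 by move: qe; rewrite qt ler_expR lerN2.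
have [e ele he] := HC t t0 t1.
have tk : t ^+ k.+1 <= 1 by rewrite exprn_ile1// ltW.
have [_ G0] := gauss_cvg_pos hx.
have lnq : ln q = - t by rewrite qt expRK.
have p0 : 0 < 1 - q by rewrite subr_gt0.
have -> : qGamma q x / (Gamma x * (ln q / (q - 1) * q `^ (x / 4)) `^ (x - 1) *
    \prod_(3 <= j < N) expR (- (complex.Re (zeta (2 - j%:R)) / j`!%:R
                         * (B j).[x] * ln q ^+ j.-1))) = expR e.
  have -> : qGamma q x = expR ((1 - x) * ln (1 - q)) *
      (Gamma x * expR ((x - 1) * ln t - em_const B x t N + e)).
    rewrite /qGamma {1}/powR gt_eqF//; congr (_ * _).
    by rewrite Nk; apply: cvg_lim => //; rewrite qt; exact: he.
  have -> : ln q / (q - 1) * q `^ (x / 4) = expR (ln t - ln (1 - q) - t * (x / 4)).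
    rewrite /powR gt_eqF// lnq !expRB !lnK ?posrE// mulrN expRN [x / 4 * t]mulrC; congr (_ / _).
    by rewrite -[q - 1]opprB invrN mulrNN.
  rewrite -expRM -expR_sum sumrN (em_const_exp hB hzeta)// lnq.
  set S := \sum_(3 <= j < N) _.
  rewrite mulrCA -[Gamma x * _ * _]mulrA -!expRD -mulf_div divff ?gt_eqF// mul1r -expRB.
  by congr expR; field.
rewrite lnq normrX normrN (gtr0_norm t0) -[in leRHS]mulrA.
have eC : `|e| <= C by rewrite (le_trans ele)// ler_piMr.
rewrite (le_trans (expR_sub1_le eC))// ler_wpM2l ?expR_ge0//.
by rewrite Nk (le_trans ele)// ler_wpM2r ?exprn_ge0 ?(ltW t0)// lerDl.
Unshelve. all: by end_near. Qed.
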